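(* Let $\varphi:\mathbb{R}\to\mathbb{R}$ be continuous and nondecreasing, let $\mu\ge0$ be an even Radon measure on $\mathbb{R}^N\setminus\{0\}$ with $\int_{|z|\le1}|z|^2\mu(\mathrm{d}z)+\int_{|z|>1}\mu(\mathrm{d}z)<\infty$, and let $u_0\in L^1(\mathbb{R}^N)\cap L^\infty(\mathbb{R}^N)$. Then there exists a distributional solution $u$ of $\partial_tu-\mathcal{L}^\mu[\varphi(u)]=0$ in $Q_T$, $u(\cdot,0)=u_0$ on $\mathbb{R}^N$, satisfying (i) $u\in L^1(Q_T)\cap L^\infty(Q_T)\cap C([0,T];L^1_{\mathrm{loc}}(\mathbb{R}^N))$; and (ii) $\varphi(u)\in L^2(0,T;E_\mu(\mathbb{R}^N))$.
   Context: $T>0$, $Q_T:=\mathbb{R}^N\times(0,T)$; $\mu$ even means $\mu(B)=\mu(-B)$ for all Borel $B$. The operator is $$\mathcal{L}^\mu[\phi](x)=\int_{\mathbb{R}^N\setminus\{0\}}\big(\phi(x+z)-\phi(x)-z\cdot D\phi(x)\mathbf{1}_{|z|\le1}\big)\mu(\mathrm{d}z).$$ Set $\mathcal{E}_\mu[f,g]:=\frac12\int_{\mathbb{R}^N}\int_{|z|>0}(f(x+z)-f(x))(g(x+z)-g(x))\,\mu(\mathrm{d}z)\mathrm{d}x$, $|f|_{E_\mu}^2:=\mathcal{E}_\mu[f,f]$, and $L^2(0,T;E_\mu(\mathbb{R}^N)):=\{f:Q_T\to\mathbb{R}\text{ measurable}:\int_0^T|f(\cdot,t)|_{E_\mu}^2\mathrm{d}t<\infty\}$.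 Distributional solution: $u\in L^1_{\mathrm{loc}}(Q_T)$ such that, for all $\psi\in C_c^\infty(\mathbb{R}^N\times[0,T))$, $\iint_{Q_T}\big(u\,\partial_t\psi+\varphi(u)\mathcal{L}^\mu[\psi]\big)\mathrm{d}x\mathrm{d}t+\int_{\mathbb{R}^N}u_0(x)\psi(x,0)\,\mathrm{d}x=0$. *)

(* Defs.v *)
From HB Require Import structures.
From mathcomp Require Import all_boot all_order all_algebra.
From mathcomp Require Import all_classical all_reals all_analysis.
From mathcomp Require Import measurable_realfun.

Set Implicit Arguments.
Unset Strict Implicit.
Unset Printing Implicit Defensive.

Import Order.TTheory GRing.Theory Num.Theory.
Import numFieldNormedType.Exports.

Local Open Scope classical_set_scope.
Local Open Scope ring_scope.

(* No measurable structure on row vectors exists in the library: equip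
   'rV[R]_n with its Borel sigma-algebra. *)
Fact borel_display : measure_display. Proof. exact: default_measure_display. Qed.

Section borel.
Context (R : realType) (n : nat).
Let b0 : <<s @open 'rV[R]_n >> set0. Proof. exact: sigma_algebra0. Qed.
Let bC A : <<s @open 'rV[R]_n >> A -> <<s @open 'rV[R]_n >> (~` A).
Proof. exact: sigma_algebraC. Qed.
Let bU (F : _^nat) : (forall i, <<s @open 'rV[R]_n >> (F i)) ->
  <<s @open 'rV[R]_n >> (\bigcup_i (F i)).
Proof. exact: sigma_algebra_bigcup. Qed.
HB.instance Definition _ :=
  @isMeasurable.Build borel_display 'rV[R]_n <<s @open 'rV[R]_n >> b0 bC bU.
End borel.

Section lebesgue.
Context (R : realType).

Lemma measurable_coord n (i : 'I_n) :
  measurable_fun [set: 'rV[R]_n] (fun x : 'rV[R]_n => x ord0 i).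
Proof.
apply: (measurability (@RGenOpens.G R)); first exact: RGenOpens.measurableE.
move=> _ [_ [a [b ->]] <-]; rewrite setTI; apply: sub_sigma_algebra.
by apply: open_comp => [x _|]; [exact: coord_continuous|exact: interval_open].
Qed.

Lemma open_rV_bigcup n (A : set 'rV[R]_n) : open A ->
  A = \bigcup_(q in [set q : 'rV[rat]_n * rat |
        ball (map_mx ratr q.1 : 'rV[R]_n) (ratr q.2) `<=` A])
        ball (map_mx ratr q.1 : 'rV[R]_n) (ratr q.2).
Proof.
move=> oA; apply/seteqP; split => [x Ax|x [q /=]]; last exact.
have /nbhs_ballP[e /= e0 xeA] : nbhs x A by exact: open_nbhs_nbhs.
have [|r] := @rat_in_itvoo R 0 (e / 2); first by rewrite divr_gt0.
rewrite in_itv/= => /andP[r0 re].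
have qx i : {q : rat | `|x ord0 i - ratr q| < ratr r}.
  apply/cid; have [|q] := @rat_in_itvoo R (x ord0 i - ratr r) (x ord0 i + ratr r).
    by rewrite ltrD2l gtrN.
  by rewrite in_itv/= => /andP[q1 q2]; exists q; rewrite distrC ltr_distl q1 q2.
pose q : 'rV[rat]_n := \row_i sval (qx i).
have xq : ball (map_mx ratr q : 'rV[R]_n) (ratr r) x.
  split; first exact: r0.
  by move=> i j; rewrite ord1 !mxE /ball/= distrC; exact: svalP (qx j).
exists (q, r) => //= y qy; apply: xeA.
apply: (@le_ball _ _ _ (ratr r + ratr r)); last first.
  exact: ball_triangle (ball_sym xq) qy.
by rewrite [leRHS]splitr lerD// ltW.
Qed.

Lemma measurable_fun_rV d (T : measurableType d) n (f : T -> 'rV[R]_n) :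
  (forall i, measurable_fun [set: T] (fun x => f x ord0 i)) ->
  measurable_fun [set: T] f.
Proof.
move=> mf; apply: (measurability (@open 'rV[R]_n)) => //.
move=> _ [A oA <-]; rewrite setTI (open_rV_bigcup oA) bigcup_mkcond.
rewrite preimage_bigcup; apply: countable_bigcupT_measurable => // -[q r].
case: ifPn => _; last by rewrite preimage_set0.
have [r0|r0] := boolP (0 < ratr r :> R); last first.
  rewrite (_ : _ @^-1` _ = set0)//; apply/seteqP; split=> // x [/= h].
  by rewrite h in r0.
rewrite -[X in measurable X]setCK; apply: measurableC.
rewrite (_ : ~` _ = \bigcup_i ~` ((fun x => f x ord0 i) @^-1`
    ball (ratr (q ord0 i) : R) (ratr r))).
  apply: countable_bigcupT_measurable => // i; apply: measurableC.
  by rewrite -[X in measurable X]setTI; apply: mf => //; exact: measurable_ball.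
rewrite -setC_bigcap; congr (~` _).
apply/seteqP; split=> [x [_ qx] i _|x qx].
  by have := qx ord0 i; rewrite mxE.
by split=> // i j; rewrite ord1 mxE; exact: qx.
Qed.

Section lebesgue_step.
Context (n : nat) (m : {sigma_finite_measure set 'rV[R]_n -> \bar R}).

Definition rV_cons (p : measurableTypeR R * 'rV[R]_n) : 'rV[R]_n.+1 :=
  @row_mx R 1 1 n (const_mx p.1) p.2.

Definition rV_uncons (v : 'rV[R]_n.+1) : measurableTypeR R * 'rV[R]_n :=
  (v ord0 ord0, @rsubmx R 1 1 n v).

Lemma rV_cons0 p : rV_cons p ord0 ord0 = p.1.
Proof.
have -> : (ord0 : 'I_n.+1) = lshift n (ord0 : 'I_1) by exact: val_inj.
by apply: etrans (row_mxEl _ _ _ _) _; rewrite mxE.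
Qed.

Lemma rV_consS p i : rV_cons p ord0 (lift ord0 i) = p.2 ord0 i.
Proof.
have -> : lift ord0 i = rshift 1 i by exact: val_inj.
exact: row_mxEr.
Qed.

Lemma rV_consK : cancel rV_cons rV_uncons.
Proof.
by move=> [a v]; rewrite /rV_uncons rV_cons0 row_mxKr.
Qed.

Lemma rV_unconsK : cancel rV_uncons rV_cons.
Proof.
move=> v; rewrite /rV_cons /rV_uncons/=.
rewrite (_ : const_mx _ = @lsubmx R 1 1 n v) ?hsubmxK//.
by apply/rowP => i; rewrite !mxE; congr (v _ _); apply: val_inj; rewrite ord1.
Qed.

Lemma measurable_rV_cons : measurable_fun setT rV_cons.
Proof.
apply: measurable_fun_rV => i; case: (unliftP ord0 i) => [j|] ->.
  under eq_fun do rewrite rV_consS.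
  exact: (measurableT_comp (measurable_coord j) measurable_snd).
under eq_fun do rewrite rV_cons0; exact: measurable_fst.
Qed.

Lemma measurable_rV_uncons : measurable_fun setT rV_uncons.
Proof.
apply/measurable_fun_pairP; split; first exact: measurable_coord.
apply: measurable_fun_rV => i /=.
under eq_fun do rewrite mxE; exact: measurable_coord.
Qed.

Definition lebesgue_step : set 'rV[R]_n.+1 -> \bar R :=
  pushforward (lebesgue_measure \x m)%E rV_cons.

Let preim_cons A : measurable A -> measurable (rV_cons @^-1` A).
Proof.
by move=> mA; rewrite -[X in measurable X]setTI; exact: measurable_rV_cons.
Qed.

Let lebesgue_step0 : lebesgue_step set0 = 0%E.
Proof. by rewrite /lebesgue_step /pushforward preimage_set0 measure0. Qed.

Let lebesgue_step_ge0 A : (0 <= lebesgue_step A)%E.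
Proof. exact: (@measure_ge0 _ _ _ (lebesgue_measure \x m)%E). Qed.

Let lebesgue_step_sigma_additive : semi_sigma_additive lebesgue_step.
Proof.
move=> F mF tF mUF; rewrite /lebesgue_step /pushforward preimage_bigcup.
apply: measure_semi_sigma_additive => [i||].
- exact: preim_cons.
- apply/trivIsetP => i j _ _ ij; rewrite -preimage_setI.
  by move/trivIsetP : tF => /(_ _ _ _ _ ij) ->//; rewrite preimage_set0.
- by rewrite -preimage_bigcup; exact: preim_cons.
Qed.

HB.instance Definition _ := isMeasure.Build _ _ _ lebesgue_step
  lebesgue_step0 lebesgue_step_ge0 lebesgue_step_sigma_additive.

Let sigma_finite_lebesgue_step : sigma_finite setT lebesgue_step.
Proof.
have /sigma_finiteP[F [TF ndF Foo]] := sigma_finiteT (@lebesgue_measure R).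
have /sigma_finiteP[G [TG ndG Goo]] := sigma_finiteT m.
exists (fun k => rV_uncons @^-1` (F k `*` G k)).
  rewrite -preimage_bigcup (_ : \bigcup_k _ = setT) ?preimage_setT//.
  rewrite -setXTT TF TG; apply/seteqP; split=> [x [k _ [? ?]]|].
    by split; exists k.
  move=> x [[k _ Fk] [l _ Gl]]; exists (maxn k l) => //; split.
  - by move: Fk; exact/subsetPset/ndF/leq_maxl.
  - by move: Gl; exact/subsetPset/ndG/leq_maxr.
move=> k; have [mF Fk] := Foo k; have [mG Gk] := Goo k; split.
  rewrite -[X in measurable X]setTI; apply: measurable_rV_uncons => //.
  exact: measurableX.
rewrite /lebesgue_step /pushforward -comp_preimage.
rewrite (_ : _ \o _ = id); last by apply/funext => p /=; rewrite rV_consK.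
by rewrite preimage_id product_measure1E// lte_mul_pinfty// ge0_fin_numE.
Qed.

HB.instance Definition _ := @Measure_isSigmaFinite.Build _ _ _
  lebesgue_step sigma_finite_lebesgue_step.

End lebesgue_step.

(* Lebesgue measure on R^n, as the n-fold product of the one on R;
   lebesgue_rV_box below is a sanity check. *)
Fixpoint lebesgue_rV n : {sigma_finite_measure set 'rV[R]_n -> \bar R} :=
  if n is n'.+1 then lebesgue_step (lebesgue_rV n') else \d_(0 : 'rV[R]_0).

Lemma measurable_box n (a b : 'rV[R]_n) :
  measurable [set x : 'rV[R]_n | forall i, x ord0 i \in `[a ord0 i, b ord0 i]].
Proof.
rewrite -[X in measurable X]setCK; apply: measurableC.
rewrite (_ : ~` _ = \bigcup_i ~` ((fun x : 'rV[R]_n => x ord0 i) @^-1`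
    `[a ord0 i, b ord0 i]%classic)).
  apply: countable_bigcupT_measurable => // i; apply: measurableC.
  by rewrite -[X in measurable X]setTI; exact: measurable_coord.
rewrite -setC_bigcap; congr (~` _).
by apply/seteqP; split=> [x xab i _|x xab i]; [exact: xab|exact: (xab i)].
Qed.

Lemma lebesgue_rV_box n (a b : 'rV[R]_n) : (forall i, a ord0 i <= b ord0 i) ->
  lebesgue_rV n [set x | forall i, x ord0 i \in `[a ord0 i, b ord0 i]] =
  (\prod_(i < n) (b ord0 i - a ord0 i))%:E.
Proof.
elim: n a b => [|n ih] a b ab.
  by rewrite big_ord0 /= diracE mem_set//= => -[].
pose a' : 'rV[R]_n := \row_i a ord0 (lift ord0 i).
pose b' : 'rV[R]_n := \row_i b ord0 (lift ord0 i).
transitivity ((lebesgue_measure \x lebesgue_rV n)%E (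
    `[a ord0 ord0, b ord0 ord0]%classic `*`
    [set x : 'rV_n | forall i, x ord0 i \in `[a' ord0 i, b' ord0 i]])).
  congr ((lebesgue_measure \x lebesgue_rV n)%E _).
  apply/seteqP; split=> [p pab|p [pab1 pab2] i].
    split=> [|i]; first by have := pab ord0; rewrite rV_cons0.
    by have := pab (lift ord0 i); rewrite rV_consS !mxE.
  case: (unliftP ord0 i) => [j|] ->; last by rewrite rV_cons0.
  by have := pab2 j; rewrite rV_consS !mxE.
rewrite product_measure1E//; last exact: measurable_box.
rewrite ih; last by move=> i; rewrite !mxE; exact: ab.
rewrite big_ord_recl EFinM; congr (_ * _)%E.
  transitivity (@lebesgue_measure R `[a ord0 ord0, b ord0 ord0]) => //.
  rewrite lebesgue_measure_itv/= lte_fin; case: ltP => [//|ba].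
  by congr EFin; apply/eqP; rewrite eq_sym subr_eq0 eq_le ba ab.
by congr EFin; apply: eq_bigr => i _; rewrite !mxE.
Qed.
End lebesgue.
Arguments lebesgue_rV {R} n.

Section calculus.
Context {R : realType}.

(* The library norm on 'rV is the sup norm. *)
Definition dotv n (x y : 'rV[R]_n) : R := \sum_i x ord0 i * y ord0 i.
Definition enorm n (x : 'rV[R]_n) : R := Num.sqrt (dotv x x).

Definition gradient n (f : 'rV[R]_n -> R) (x : 'rV[R]_n) : 'rV[R]_n :=
  \row_i 'D_(delta_mx ord0 i) f x.

(* All iterated directional derivatives up to order k exist everywhere and are
   continuous. *)
Fixpoint Ck (V : normedModType R) (k : nat) (f : V -> R) : Prop :=
  if k is k'.+1 then
    continuous f /\ forall v, (forall x, derivable f x v) /\ Ck k' ('D_v f)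
  else continuous f.

Definition smooth (V : normedModType R) (f : V -> R) := forall k, Ck k f.

End calculus.

Section levy.
Context {R : realType} {N : nat}.
Implicit Types (mu : {measure set 'rV[R]_N -> \bar R}) (f g : 'rV[R]_N -> R).

(* A measure on R^N \ {0} is identified with its extension by zero to R^N;
   a subset of R^N \ {0} is compact there iff it is compact in R^N. *)
Definition radon_off0 mu :=
  [/\ mu [set 0] = 0%E,
      forall K : set 'rV[R]_N, compact K -> ~ K 0 -> (mu K < +oo)%E &
      forall B : set 'rV[R]_N, measurable B -> ~ B 0 ->
        mu B = ereal_sup
          [set mu K | K in [set K : set 'rV[R]_N | compact K /\ K `<=` B]]].

Definition even_measure mu :=
  forall B : set 'rV[R]_N, measurable B -> mu B = mu [set - z | z in B].

Definition levy_integrable mu :=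
  (\int[mu]_(z in [set z | z != 0%R /\ (enorm z <= 1)%R]) (enorm z ^+ 2)%:E +
   \int[mu]_(z in [set z | (1 < enorm z)%R]) 1 < +oo)%E.

Definition levy_op mu f (x : 'rV[R]_N) : R :=
  \int[mu]_(z in ~` [set 0])
    (f (x + z) - f x - dotv z (gradient f x) * \1_[set z | enorm z <= 1] z).

Definition energy mu f g : \bar R :=
  ((2^-1)%:E * \int[lebesgue_rV N]_x \int[mu]_(z in [set z | (0 < enorm z)%R])
     ((f (x + z) - f x) * (g (x + z) - g x))%:E)%E.

End levy.

Notation lebesgue_rVxR N := (lebesgue_rV N \x lebesgue_measure)%E.

Section spaces.
Context {R : realType} (N : nat) (T : R).
Implicit Types (u : 'rV[R]_N * R -> R) (mu : {measure set 'rV[R]_N -> \bar R}).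

Definition cylinder : set ('rV[R]_N * R) := setT `*` `]0, T[.

Definition L1loc_cylinder u :=
  forall K : set ('rV[R]_N * R), compact K -> K `<=` cylinder ->
    (lebesgue_rVxR N).-integrable K (EFin \o u).

(* u : Q_T -> R, identified almost everywhere, has a representative v which is
   a continuous curve on [0, T] in L^1_loc(R^N), the latter being topologised by
   the L^1(K) seminorms, K compact. *)
Definition continuous_L1loc u :=
  exists v : R -> 'rV[R]_N -> R,
  [/\ forall t, t \in `[0, T] -> forall K : set 'rV[R]_N, compact K ->
        (lebesgue_rV N).-integrable K (EFin \o v t),
      forall t, t \in `[0, T] -> forall K : set 'rV[R]_N, compact K ->
        (fun s => \int[lebesgue_rV N]_(x in K) `|v s x - v t x|%:E)%E
          @ within `[0, T] (nbhs t) --> 0%E &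
      {ae lebesgue_measure, forall t : R, t \in `]0, T[ ->
        {ae lebesgue_rV N, forall x, u (x, t) = v t x}}].

Definition L2_energy mu u :=
  measurable_fun cylinder u /\
  (\int[lebesgue_measure]_(t in `]0%R, T[)
     energy mu (fun x => u (x, t)) (fun x => u (x, t)) < +oo)%E.

(* C_c^oo(R^N x [0,T)): smooth functions up to t = 0 are represented by smooth
   extensions to t < 0; only their values on t >= 0 are used below. *)
Definition test_function (psi : 'rV[R]_N * R -> R) :=
  smooth psi /\
  exists K : set ('rV[R]_N * R),
    [/\ compact K, K `<=` setT `*` `]-oo, T[ & forall p, ~ K p -> psi p = 0].

(* The integrals are taken in \bar R, where a sum or difference involving an
   infinite term is never 0: the equation forces both to be finite. *)
Definition distributional_solution mu (phi : R -> R) (u0 : 'rV[R]_N -> R) u :=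
  L1loc_cylinder u /\
  forall psi, test_function psi ->
  (\int[lebesgue_rVxR N]_(p in cylinder)
     (u p * derive1 (fun s => psi (p.1, s)) p.2 +
      phi (u p) * levy_op mu (fun x => psi (x, p.2)) p.1)%:E +
   \int[lebesgue_rV N]_x (u0 x * psi (x, 0))%:E = 0)%E.

End spaces.
Arguments cylinder {R} N T.

(* Main.v *)
(** The solution is the limit of an explicit Euler scheme.  Replace mu by its
    restriction nu to |z| > 1/k, which has finite mass m, and phi by a Lipschitz
    nondecreasing phi_k with |phi_k - phi| <= 1/k on the range [-M, M] of the data.
    One step is U' = U + h (nu * phi_k(U) - m phi_k(U)); when h m Lip(phi_k) is small
    it is monotone, hence it preserves the bound M and contracts L^1, and it
    commutes with translations.  Testing against phi_k(U) with the convex primitive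
    of phi_k bounds the sum over the steps of h times the energy of phi_k(U).

    Compactness.  Translations of the initial data control the translations of
    the iterates uniformly in k, and the weak form of the scheme makes the mollified
    iterates Lipschitz in time up to h.  So the mollified iterates are equicontinuous,
    along an ultrafilter they converge uniformly on compact sets, and some
    subsequence of the scheme is rapidly Cauchy in L^1 of every cube, uniformly in
    time.  Its limit u is an almost everywhere limit at every time t.

    Summation by parts turns the scheme into an exact discrete weak formulation,
    in which dominated convergence applies because the truncated operators applied
    to a test function are bounded, uniformly in k, by an integrable function.
    The energy bound follows from Fatou's lemma, and the time continuity of u from
    that of the scheme. *)

Require Import Defs.
From HB Require Import structures.
From mathcomp Require Import all_boot all_order all_algebra.
From mathcomp Require Import all_classical all_reals all_analysis.
From mathcomp Require Import measurable_realfun ring lra.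

Set Implicit Arguments.
Unset Strict Implicit.
Unset Printing Implicit Defensive.

Import Order.TTheory GRing.Theory Num.Theory.
Import numFieldNormedType.Exports.

Local Open Scope classical_set_scope.
Local Open Scope ring_scope.

(** * Translations and cubes in R^N *)

(** Truncation makes the operator bounded, so an explicit step is available: no resolvent equation
    has to be solved, and the estimates are pointwise inequalities integrated in space. Monotonicity
    only asks for h m Lip(phi_k) <= 1; the factor 4 in the step restriction keeps the second-order
    error of the explicit step below half of the dissipation in the energy balance.

    The obstacle is the nonlinearity: weak limits would not identify phi(u). Translation control is
    what makes the convergence strong, because it bounds the L^1 distance from an iterate to its
    mollification uniformly in k and in time. An ultrafilter stands in for Arzela-Ascoli and
    diagonal extraction, since a single one serves all mollifiers and all cubes.

    The compensator z.D psi disappears by evenness: the operator is half the integral of psi(x+z) +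
    psi(x-z) - 2 psi(x), which is of order min(|z|^2, 1). Hence a mollifier needs only bounded
    second differences, and the square of the positive part of a quadratic polynomial will do. *)

Section measure_preserving.
Local Open Scope ereal_scope.
Context d (X : measurableType d) (R : realType).
Variables (m : {measure set X -> \bar R}) (g : X -> X).
Hypothesis mg : measurable_fun setT g.
Hypothesis gm : forall A, measurable A -> m (g @^-1` A) = m A.

Lemma ge0_integral_preserving (f : X -> \bar R) :
  measurable_fun setT f -> (forall x, 0 <= f x) ->
  \int[m]_x f (g x) = \int[m]_x f x.
Proof.
move=> mf f0.
have := @ge0_integral_pushforward _ _ _ _ R _ mg m setT f measurableT mf (fun y _ => f0 y).
rewrite preimage_setT => <-.
by apply: eq_measure_integral => A mA _; rewrite -gm.
Qed.

Lemma integral_preserving (f : X -> \bar R) : measurable_fun setT f ->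
  \int[m]_x f (g x) = \int[m]_x f x.
Proof.
move=> mf; rewrite integralE [RHS]integralE; congr (_ - _).
- rewrite -[RHS]ge0_integral_preserving//; last exact: measurable_funepos.
  by apply: eq_integral => x _; rewrite !funeposE.
- rewrite -[RHS]ge0_integral_preserving//; last exact: measurable_funeneg.
  by apply: eq_integral => x _; rewrite !funenegE.
Qed.

End measure_preserving.

Section lebesgue_rV.
Context (R : realType).

Lemma lebesgue_measure_shift (a : R) (A : set R) : measurable A ->
  lebesgue_measure ((fun x : R => x + a) @^-1` A) = lebesgue_measure A.
Proof.
move=> mA.
rewrite -[LHS]/(pushforward lebesgue_measure
  ((fun x => x + a) : _ -> measurableTypeR R) A).
apply/esym/lebesgue_measure_unique => //=; first exact: measurable_funD.
move=> mf _ [[b c]] _ <-.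
rewrite /pushforward /= (_ : _ @^-1` _ = `]b - a, c - a]%classic); last first.
  by apply/seteqP; split=> x /=; rewrite !in_itv/= ltrBlDr lerBrDr.
by rewrite !lebesgue_measure_itv/= !lte_fin ltrD2r -!EFinB; case: ifP => // _; congr EFin; lra.
Qed.

(** Induction on the dimension: each section of the set is shifted by the remaining coordinates of
    [y], which is the induction hypothesis, and the outer integral is shifted by the first
    coordinate. *)
Lemma lebesgue_rV_shift n (y : 'rV[R]_n) (A : set 'rV[R]_n) : measurable A ->
  lebesgue_rV n ((fun x => x + y) @^-1` A) = lebesgue_rV n A.
Proof.
elim: n y A => [|n ih] y A mA.
  by rewrite (_ : _ @^-1` A = A)//; apply/seteqP; split=> x /=; rewrite (_ : x + y = x)//; apply/rowP => -[].
have mB : measurable (@rV_cons R n @^-1` A).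
  by rewrite -[X in measurable X]setTI; exact: measurable_rV_cons.
pose g a := lebesgue_rV n (xsection (@rV_cons R n @^-1` A) a).
have mg : measurable_fun setT g by exact: measurable_fun_xsection.
transitivity (\int[lebesgue_measure]_a g ((a : R) + y ord0 ord0)%R)%E.
  apply: eq_integral => a _ /=.
  rewrite -[RHS](ih (@rsubmx R 1 1 n y)); last exact: measurable_xsection.
  congr (lebesgue_rV n _); apply/seteqP; split=> v; rewrite /xsection/= !inE/=;
    (rewrite (_ : rV_cons _ + y = rV_cons (a + y ord0 ord0, v + @rsubmx R 1 1 n y))//;
     rewrite -[in LHS](rV_unconsK y); apply/rowP => i;
     case: (unliftP ord0 i) => [j|] ->; rewrite mxE ?rV_consS ?rV_cons0//=;
     by rewrite !mxE).
apply: (@ge0_integral_preserving _ _ R lebesgue_measure (fun x => x + y ord0 ord0)) => //.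
- exact: measurable_funD.
- by move=> B; exact: lebesgue_measure_shift.
Qed.

Lemma continuous_measurable_rV n (f : 'rV[R]_n -> R) : continuous f ->
  measurable_fun setT f.
Proof.
move=> cf; apply: (measurability (@RGenOpens.G R)); first exact: RGenOpens.measurableE.
move=> _ [_ [a [b ->]] <-]; rewrite setTI; apply: sub_sigma_algebra.
by apply: open_comp => [x _|]; [exact: cf|exact: interval_open].
Qed.

Lemma measurable_fun_addrV d (T : measurableType d) n (f g : T -> 'rV[R]_n) :
  measurable_fun setT f -> measurable_fun setT g ->
  measurable_fun setT (fun x => f x + g x).
Proof.
move=> mf mg; apply: measurable_fun_rV => i.
under eq_fun do rewrite mxE.
by apply: measurable_funD; apply: (measurableT_comp (measurable_coord i)).
Qed.

Lemma measurable_fun_opprV d (T : measurableType d) n (f : T -> 'rV[R]_n) :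
  measurable_fun setT f -> measurable_fun setT (fun x => - f x).
Proof.
move=> mf; apply: measurable_fun_rV => i.
under eq_fun do rewrite mxE.
by apply: measurableT_comp => //; apply: (measurableT_comp (measurable_coord i)).
Qed.


Lemma integral_shift n (f : 'rV[R]_n -> \bar R) (y : 'rV[R]_n) :
  measurable_fun setT f ->
  (\int[lebesgue_rV n]_x f (x + y)%R = \int[lebesgue_rV n]_x f x)%E.
Proof.
move=> mf.
have mg : measurable_fun setT (fun x : 'rV[R]_n => x + y).
  by apply: measurable_fun_addrV => //; exact: measurable_id.
have gm A : measurable A -> lebesgue_rV n ((fun x => x + y) @^-1` A) = lebesgue_rV n A.
  exact: lebesgue_rV_shift.
exact: (integral_preserving mg gm mf).
Qed.

Lemma coord_le_norm n (x : 'rV[R]_n) i : `|x ord0 i| <= `|x|.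
Proof.
rewrite [leRHS]/Num.norm/= mx_normrE.
exact: (le_bigmax_cond _ (fun ij : 'I_1 * 'I_n => `|x ij.1 ij.2|) (j := (ord0, i))).
Qed.

(** For [r >= 0], the closed sup-norm ball, spelled coordinatewise so that [lebesgue_rV_box] gives
    its measure. *)
Definition cube n (r : R) := [set x : 'rV[R]_n | forall i, `|x ord0 i| <= r].

Lemma cubeE n r : cube r = [set x : 'rV[R]_n |
  forall i, x ord0 i \in `[(const_mx (- r) : 'rV[R]_n) ord0 i, (const_mx r : 'rV[R]_n) ord0 i]].
Proof.
by apply/seteqP; split=> x /= + i => /(_ i); rewrite !mxE in_itv/= ler_norml.
Qed.

Lemma measurable_cube n r : measurable (@cube n r).
Proof. by rewrite cubeE; exact: measurable_box. Qed.

Lemma lebesgue_cube n r : 0 <= r -> lebesgue_rV n (@cube n r) = (\prod_(i < n) (r + r))%:E.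
Proof.
move=> r0; rewrite cubeE lebesgue_rV_box; last by move=> i; rewrite !mxE; lra.
by congr EFin; apply: eq_bigr => i _; rewrite !mxE opprK.
Qed.

Lemma lebesgue_cube_lty n r : (lebesgue_rV n (@cube n r) < +oo)%E.
Proof.
have [r0|r0] := leP 0 r; first by rewrite lebesgue_cube// ltry.
apply: (@le_lt_trans _ _ (lebesgue_rV n (@cube n 0))); last by rewrite lebesgue_cube// ltry.
apply: le_measure; rewrite ?inE; try exact: measurable_cube.
by move=> x /= h i; apply: (le_trans (h i)); exact: ltW.
Qed.

Lemma compact_sub_cube n (K : set 'rV[R]_n) : compact K -> exists j : nat, K `<=` @cube n j%:R.
Proof.
move=> /compact_bounded[M [Mr h]].
exists (Num.bound (Num.max M 0)) => x Kx i.
have /h/(_ x Kx)/= : M < (Num.bound (Num.max M 0))%:R.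
  have m0 : 0 <= Num.max M 0 by rewrite le_max lexx orbT.
  have := archi_boundP m0.
  by apply: le_lt_trans; rewrite le_max lexx.
apply: le_trans; exact: coord_le_norm.
Qed.

Lemma cube_cover n (x : 'rV[R]_n) : exists j : nat, @cube n j%:R x.
Proof. by have [j /(_ x erefl)] := compact_sub_cube (@compact_set1 _ x); exists j. Qed.

Lemma compact_cube n r : compact (@cube n r).
Proof.
have := @rV_compact R n (fun=> `[- r, r]%classic) (fun=> @segment_compact R _ _).
rewrite (_ : [set _ | _] = cube r)//.
by apply/seteqP; split=> x /= + i => /(_ i); rewrite in_itv/= ler_norml.
Qed.

End lebesgue_rV.

(** * Continuity of translations in L^1 *)

Lemma cvge0P (R : realType) (I : Type) (F : set_system I) {FF : Filter F} (u : I -> \bar R) :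
  (forall n, 0 <= u n)%E ->
  u n @[n --> F] --> 0%E <-> forall e, 0 < e -> \forall n \near F, (u n <= e%:E)%E.
Proof.
move=> u0; split=> [cu e e0|h].
  move/fine_cvgP : cu => [fu /cvgr0Pnorm_le/(_ _ e0)].
  apply: filterS2 fu => n fn; rewrite ger0_norm ?fine_ge0// => h.
  by rewrite -(fineK fn) lee_fin.
apply/fine_cvgP; split.
  by have := h 1 ltr01; apply: filterS => n un; rewrite ge0_fin_numE// (le_lt_trans un)// ltry.
apply/cvgr0Pnorm_le => e /h; apply: filterS => n un /=.
by rewrite ger0_norm ?fine_ge0// -lee_fin fineK// ge0_fin_numE// (le_lt_trans un)// ltry.
Qed.

Section L1_distance.
Context d (X : measurableType d) (R : realType).
Variable m : {measure set X -> \bar R}.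
Implicit Types f g h : X -> R.

Definition L1dist f g := (\int[m]_x `|f x - g x|%:E)%E.

Lemma measurable_normB f g : measurable_fun setT f -> measurable_fun setT g ->
  measurable_fun setT (fun x => `|f x - g x|%:E).
Proof.
by move=> mf mg; apply/measurable_EFinP/measurableT_comp => //; exact: measurable_funB.
Qed.

Lemma L1dist_ge0 f g : (0 <= L1dist f g)%E.
Proof. by apply: integral_ge0 => x _; rewrite lee_fin. Qed.

Lemma L1distC f g : L1dist f g = L1dist g f.
Proof. by apply: eq_integral => x _; rewrite distrC. Qed.

Lemma L1dist_triangle f g h :
  measurable_fun setT f -> measurable_fun setT g -> measurable_fun setT h ->
  (L1dist f h <= L1dist f g + L1dist g h)%E.
Proof.
move=> mf mg mh; rewrite -ge0_integralD//; try exact: measurable_normB.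
apply: ge0_le_integral => //; try exact: measurable_normB.
- by apply: emeasurable_funD; exact: measurable_normB.
- by move=> x _; rewrite -EFinD lee_fin; exact: ler_distD.
Qed.

Lemma L1dist_dominated (f_ : nat -> X -> R) f g :
  (forall n, measurable_fun setT (f_ n)) -> measurable_fun setT f ->
  (forall x, f_ ^~ x @ \oo --> f x) -> m.-integrable setT (EFin \o g) ->
  (forall n x, `|f_ n x| <= g x) ->
  L1dist (f_ n) f @[n --> \oo] --> 0%E.
Proof.
move=> mf_ mf cf ig fg.
have [//|//|||] := @dominated_convergence _ _ _ m setT measurableT
  (fun n => EFin \o f_ n) (EFin \o f) (EFin \o g) _ _ _ ig _.
- by move=> n; exact/measurable_EFinP.
- exact/measurable_EFinP.
- by apply: aeW => x _; apply/cvg_EFin; [exact: nearW|exact: cf].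
- by apply: aeW => x n _; rewrite lee_fin.
- by move=> _ + _; apply: cvg_trans; apply: near_eq_cvg; apply: nearW => n.
Qed.

End L1_distance.

(** Written as a sum with a scalar multiple, the shape to which [tcontD] and [tcontZ] apply. *)
Lemma indic_setDI (T : Type) (R : pzRingType) (B C D : set T) : D `<=` C ->
  \1_((C `\` D) `&` B) = (fun x => \1_(C `&` B) x + (-1) * \1_(D `&` B) x) :> (T -> R).
Proof.
move=> DC; apply/funext => x; rewrite !indicE in_setI in_setD !in_setI.
have [xD|xD] := boolP (x \in D); last first.
  by rewrite mulr0 addr0 andbT.
have -> : x \in C by move: xD; rewrite !inE; exact: DC.
by rewrite /= mulN1r subrr.
Qed.

Section translation_continuity.
Context (R : realType) (N : nat).
Local Notation V := 'rV[R]_N.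
Local Notation leb := (@lebesgue_rV R N).
Implicit Types f g : V -> R.

(** Sequential continuity at 0 of the translation map into L^1; sequences give access to dominated
    convergence. *)
Definition tcont f := forall y : nat -> V, y n @[n --> \oo] --> (0 : V) ->
  L1dist leb (fun x : V => f (x + y n)) f @[n --> \oo] --> 0%E.

Lemma measurable_shift f (y : V) : measurable_fun setT f ->
  measurable_fun setT (fun x : V => f (x + y)).
Proof.
by move=> mf; apply: (measurableT_comp mf); apply: measurable_fun_addrV => //; exact: measurable_id.
Qed.

Lemma L1dist_shift f g (y : V) : measurable_fun setT f -> measurable_fun setT g ->
  L1dist leb (fun x : V => f (x + y)) (fun x : V => g (x + y)) = L1dist leb f g.
Proof. by move=> mf mg; rewrite -[RHS](integral_shift y)//; exact: measurable_normB. Qed.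

(** Translations are L^1 isometries, so the approximation error is paid twice and the modulus of the
    approximant once: three thirds of [e]. *)
Lemma tcont_approx f : measurable_fun setT f ->
  (forall e, 0 < e -> exists g, [/\ measurable_fun setT g, tcont g & (L1dist leb f g <= e%:E)%E]) ->
  tcont f.
Proof.
move=> mf fg y y0; apply/cvge0P => [n|e e0]; first exact: L1dist_ge0.
have e3 : 0 < e / 3 by rewrite divr_gt0.
have [g [mg tg fge]] := fg _ e3.
have /cvge0P-/(_ (fun _ => L1dist_ge0 _ _ _))/(_ _ e3) := tg _ y0.
apply: filterS => n h.
have mfn := measurable_shift (y n) mf; have mgn := measurable_shift (y n) mg.
apply: (le_trans (L1dist_triangle leb mfn mgn mf)).
apply: (le_trans (leeD2l _ (L1dist_triangle leb mgn mg mf))).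
rewrite L1dist_shift// (L1distC _ g f).
rewrite [e in e%:E](_ : e = e/3 + (e/3+e/3)); last by field.
by rewrite !EFinD; apply: leeD => //; exact: leeD.
Qed.

Lemma tcontD f g : measurable_fun setT f -> measurable_fun setT g ->
  tcont f -> tcont g -> tcont (fun x => f x + g x).
Proof.
move=> mf mg tf tg y y0; apply/cvge0P => [n|e e0]; first exact: L1dist_ge0.
have e2 : 0 < e / 2 by rewrite divr_gt0.
have /cvge0P-/(_ (fun _ => L1dist_ge0 _ _ _))/(_ _ e2) := tf _ y0.
have /cvge0P-/(_ (fun _ => L1dist_ge0 _ _ _))/(_ _ e2) := tg _ y0.
apply: filterS2 => n h1 h2.
have mfn := measurable_shift (y n) mf; have mgn := measurable_shift (y n) mg.
rewrite [e]splitr EFinD; apply: le_trans (leeD h2 h1).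
rewrite /L1dist -ge0_integralD//; try exact: measurable_normB.
apply: ge0_le_integral => //; try by apply: measurable_normB; exact: measurable_funD.
  by apply: emeasurable_funD; exact: measurable_normB.
by move=> x _; rewrite -EFinD lee_fin opprD addrACA; exact: ler_normD.
Qed.

Lemma tcontZ c f : measurable_fun setT f -> tcont f -> tcont (fun x => c * f x).
Proof.
move=> mf tf y y0.
rewrite (_ : (fun n => _) = (fun n => `|c|%:E * L1dist leb (fun x => f (x + y n)%R) f)%E).
  by have := cvgeZl (y := `|c|%:E) isT (tf y y0); rewrite mule0.
apply/funext => n; rewrite /L1dist -ge0_integralZl//; last first.
  by apply: measurable_normB => //; exact: measurable_shift.
by apply: eq_integral => x _; rewrite -mulrBr normrM.
Qed.

(** Openness makes the positive part of the difference vanish pointwise in the limit, dominated by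
    the indicator of [O]. The negative part needs no separate limit: it has the same integral. *)
Lemma tcont_open (O : set V) : open O -> (leb O < +oo)%E -> tcont \1_O.
Proof.
move=> oO Oy y y0.
have mO : measurable O by exact: sub_sigma_algebra.
have mf : measurable_fun setT (\1_O : V -> R) by exact: measurable_indic.
have mfn n := measurable_shift (y n) mf.
pose q n (x : V) : R := Num.max (\1_O x - \1_O (x + y n)) 0.
have q0 n x : 0 <= q n x by rewrite le_max lexx orbT.
have mq n : measurable_fun setT (q n).
  exact: (measurable_maxr (measurable_funB mf (mfn n)) (measurable_cst (0 : R))).
pose J n := (\int[leb]_x (q n x)%:E)%E.
have J0 : J n @[n --> \oo] --> 0%E.
  have -> : J = (fun n => L1dist leb (q n) (cst 0)).
    by apply/funext => n; apply: eq_integral => x _; rewrite /= subr0 ger0_norm.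
  apply: (@L1dist_dominated _ _ R leb q (cst 0) \1_O mq) => //.
  - move=> x; have [Ox|Ox] := pselect (O x); last first.
      apply: cvg_near_cst; apply: nearW => n.
      by rewrite /q indicE memNset// sub0r; apply/max_idPr; rewrite oppr_le0.
    have : x + y n @[n --> \oo] --> x + 0 by apply: cvgD => //; exact: cvg_cst.
    rewrite addr0 => /(_ O (open_nbhs_nbhs (conj oO Ox))) h.
    have {}h : \forall n \near \oo, O (x + y n) by [].
    apply: cvg_near_cst; apply: filterS h => n h.
    by rewrite /q !indicE !mem_set// subrr maxxx.
  - apply/integrableP; split; first exact/measurable_EFinP.
    rewrite (eq_integral (fun x => (\1_O x)%:E)) ?integral_indic ?setIT//.
    by move=> x _; rewrite /= ger0_norm.
  - move=> n x; rewrite ger0_norm// /q ge_max.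
    by rewrite lerBlDr lerDl !indicE !ler0n.
(* From |a - b| + a = 2 max(a - b, 0) + b with a and b the two indicators, whose integrals agree by
   translation invariance and are finite. *)
have JE n : L1dist leb (fun x => \1_O (x + y n)%R) \1_O = (2%:E * J n)%E.
  have : (L1dist leb (fun x => \1_O (x + y n)%R) \1_O + leb O = 2%:E * J n + leb O)%E.
    have {1}-> : leb O = (\int[leb]_x (\1_O x)%:E)%E by rewrite integral_indic ?setIT.
    have -> : leb O = (\int[leb]_x (\1_O (x + y n)%R)%:E)%E.
      rewrite (integral_shift _ (f := EFin \o \1_O)) ?integral_indic ?setIT//.
      exact/measurable_EFinP.
    rewrite /L1dist /J -ge0_integralZl//; last 2 first.
    - exact/measurable_EFinP.
    - by move=> x _; rewrite lee_fin.
    rewrite -!ge0_integralD//; last 5 first.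
    - by move=> x _; rewrite mule_ge0// lee_fin.
    - by apply: measurable_funeM; exact/measurable_EFinP.
    - exact/measurable_EFinP.
    - exact: measurable_normB.
    - exact/measurable_EFinP.
    apply: eq_integral => x _; rewrite -EFinM -!EFinD /q; congr EFin.
    by case: (leP (\1_O x - \1_O (x + y n)) 0) => h; [rewrite ger0_norm|rewrite ltr0_norm]; lra.
  by move/(congr1 (fun z => z - leb O)%E); rewrite !addeK// ge0_fin_numE.
under eq_fun do rewrite JE.
by have := cvgeZl (y := 2%:E) isT J0; rewrite mule0.
Qed.

(** A Dynkin class argument from the open sets, which are stable under intersection. The fixed ball
    provides an integrable majorant for increasing unions and finite measure for open sets. *)
Lemma tcont_indic_ball (A : set V) (r : R) : measurable A ->
  tcont \1_(A `&` ball (0 : V) r).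
Proof.
set B : set V := ball _ r => mA.
have oB : open B by exact: ball_open.
have mB : measurable B by exact: sub_sigma_algebra.
have By : (leb B < +oo)%E.
  apply: (@le_lt_trans _ _ (leb (@cube R N r))); last exact: lebesgue_cube_lty.
  apply: le_measure; rewrite ?inE//; first exact: measurable_cube.
  move=> x; rewrite /B -ball_normE/= sub0r normrN => /ltW xr i.
  by apply: le_trans xr; exact: coord_le_norm.
have iB : leb.-integrable setT (EFin \o (\1_B : V -> R)).
  apply/integrableP; split; first by apply/measurable_EFinP; exact: measurable_indic.
  rewrite (eq_integral (fun x => (\1_B x)%:E)) ?integral_indic ?setIT//.
  by move=> x _; rewrite /= ger0_norm.
have mI (C : set V) : measurable C -> measurable_fun setT (\1_(C `&` B) : V -> R).
  by move=> mC; apply: measurable_indic; exact: measurableI.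
pose H := [set C : set V | measurable C /\ tcont \1_(C `&` B)].
suff : @measurable _ V `<=` H by move=> /(_ _ mA)[].
apply: (@lambda_system_subset _ (@open V) _ setT H) => //.
- by move=> C D oC oD; exact: openI.
- split=> //.
  + split=> //; rewrite setTI; exact: tcont_open.
  + move=> C D DC [mC tC] [mD tD]; split; first exact: measurableD.
    rewrite (_ : \1_ _ = fun x => \1_(C `&` B) x + (-1) * \1_(D `&` B) x).
      apply: tcontD => //; [exact: mI| |exact: tcontZ (mI _ mD) tD].
      by apply: measurable_funM => //; exact: mI.
    exact: indic_setDI.
  + move=> F ndF HF.
    have mF k : measurable (F k) by have [] := HF k.
    have mUF : measurable (\bigcup_i F i) by exact: bigcupT_measurable.
    split=> //; apply: tcont_approx => [|e e0]; first exact: mI.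
    have : L1dist leb (\1_(F n `&` B)) (\1_(\bigcup_i F i `&` B)) @[n --> \oo] --> 0%E.
      apply: (L1dist_dominated _ _ _ iB) => //.
      * by move=> n; exact: mI.
      * exact: mI.
      * move=> x; have [[k _ Fk]|nF] := pselect ((\bigcup_i F i) x); last first.
          rewrite [\1_(\bigcup_i F i `&` B) x]indicE memNset; last by case.
          apply: cvg_near_cst; apply: nearW => n; rewrite indicE memNset// => -[Fn _].
          by apply: nF; exists n.
        apply: cvg_near_cst; exists k => // n /= kn; rewrite !indicE !in_setI.
        have Fn : F n x by move: Fk; apply/subsetPset; exact: ndF.
        by rewrite (mem_set Fn) (@mem_set _ (\bigcup_i F i))//; exists k.
      * move=> n x; rewrite ger0_norm// !indicE in_setI ler_nat.
        by case: (x \in F n).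
    move=> /(cvge0P (fun n => L1dist_ge0 leb _ _))/(_ _ e0)[n _ /(_ n (leqnn n)) h].
    exists \1_(F n `&` B); split; [exact: mI|by have [] := HF n|by rewrite L1distC].
- move=> C oC; split; first exact: sub_sigma_algebra.
  apply: tcont_open; first exact: openI.
  apply: le_lt_trans By; apply: le_measure; rewrite ?inE//.
  by apply: measurableI => //; exact: sub_sigma_algebra.
Qed.

Lemma tcont_sum (I : eqType) (s : seq I) (h : I -> V -> R) :
  (forall i, measurable_fun setT (h i)) -> (forall i, tcont (h i)) ->
  tcont (fun x => \sum_(i <- s) h i x).
Proof.
move=> mh th; elim: s => [|i s ih].
  under eq_fun do rewrite big_nil.
  move=> y _; rewrite /L1dist; apply: cvg_near_cst; apply: nearW => n.
  by rewrite integral0_eq// => x _; rewrite subrr normr0.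
under eq_fun do rewrite big_cons.
by apply: tcontD => //; exact: measurable_sum.
Qed.

Lemma ball0_cover (x : V) : \forall n \near \oo, ball (0 : V) n.+1%:R x.
Proof.
exists (Num.bound `|x|) => // n /= xn; rewrite -ball_normE/= sub0r normrN.
rewrite (lt_le_trans (archi_boundP (normr_ge0 x)))// ler_nat.
exact: (leq_trans xn).
Qed.

Import HBSimple.

(** Approximation in two stages: by a simple function, then by its restriction to a large ball,
    which is a finite combination of indicators covered by [tcont_indic_ball]. *)
Lemma tcont_integrable f : leb.-integrable setT (EFin \o f) -> tcont f.
Proof.
move=> fi; have mf : measurable_fun setT f by apply/measurable_EFinP; exact: measurable_int fi.
apply: tcont_approx => // e e0.
have [g_ [ig _ fg]] := approximation_sfun_integrable measurableT fi.
have e2 : 0 < e / 2 by rewrite divr_gt0.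
have : exists n, (L1dist leb f (g_ n) <= (e / 2)%:E)%E.
  have [n _ /(_ n (leqnn n)) h] := (cvge0P (fun n => L1dist_ge0 leb f (g_ n))).1 fg _ e2.
  by exists n.
move=> [n fgn]; set g := g_ n in fgn.
have mg : measurable_fun setT g by exact: measurable_funP.
pose B k : set V := ball (0 : V) k.+1%:R.
pose gB k (x : V) : R := g x * \1_(B k) x.
have mB k : measurable (B k) by apply: sub_sigma_algebra; exact: ball_open.
have mgB k : measurable_fun setT (gB k).
  by apply: measurable_funM => //; exact: measurable_indic.
have : exists k, (L1dist leb g (gB k) <= (e / 2)%:E)%E.
  have : L1dist leb (gB k) g @[k --> \oo] --> 0%E.
    apply: (@L1dist_dominated _ _ R leb gB g (fun x => `|g x|) mgB mg).
    - move=> x; apply: cvg_near_cst; have := ball0_cover x; apply: filterS => k xk.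
      by rewrite /gB indicE mem_set// mulr1.
    - exact: (integrable_norm (ig n)).
    - by move=> k x; rewrite /gB normrM ler_piMr// indicE; case: (_ \in _); rewrite ?normr1 ?normr0.
  move=> /(cvge0P (fun n => L1dist_ge0 leb _ _))/(_ _ e2)[k _ /(_ k (leqnn k)) h].
  by exists k; rewrite L1distC.
move=> [k gk]; exists (gB k); split => //; last first.
  by apply: (le_trans (L1dist_triangle leb mf mg (mgB k))); rewrite [e]splitr EFinD leeD.
rewrite (_ : gB k = fun x =>
    \sum_(y <- finmap.enum_fset (fset_set (range g))) (y * \1_(g @^-1` [set y] `&` B k) x)); last first.
  apply/funext => x; rewrite /gB [in LHS]fimfunE fsbig_finite//= big_distrl/=.
  by apply: eq_bigr => y _; rewrite -mulrA indicI.
have mA y : measurable (g @^-1` [set y]).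
  by rewrite -[X in measurable X]setTI; exact: mg.
apply: tcont_sum => y.
  by apply: measurable_funM => //; apply: measurable_indic; exact: measurableI.
apply: tcontZ; first by apply: measurable_indic; exact: measurableI.
exact: tcont_indic_ball.
Qed.

(** From sequences to a radius by contradiction: otherwise there are bad shifts of norm at most
    1/(n+1). *)
Lemma translation_continuous f : leb.-integrable setT (EFin \o f) ->
  forall e : R, 0 < e -> exists2 r : R, 0 < r & forall y : V, `|y| <= r ->
    (L1dist leb (fun x : V => f (x + y)%R) f <= e%:E)%E.
Proof.
move=> fi e e0; apply: contrapT => h.
have h' n : exists y : V, `|y| <= n.+1%:R^-1 /\ ~ (L1dist leb (fun x : V => f (x + y)%R) f <= e%:E)%E.
  apply: contrapT => h1; apply: h; exists n.+1%:R^-1; first by rewrite invr_gt0.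
  by move=> y yn; apply: contrapT => h2; apply: h1; exists y.
have [y hy] := choice h'.
have y0 : y n @[n --> \oo] --> (0 : V).
  apply/cvgr0Pnorm_le => eps eps0.
  have /cvgr0Pnorm_le/(_ eps eps0) := @cvg_harmonic R.
  apply: filterS => n; rewrite /harmonic/= ger0_norm ?invr_ge0//.
  exact: le_trans (hy n).1.
have /(cvge0P (fun n => L1dist_ge0 leb _ _))/(_ _ e0)[n _ /(_ n (leqnn n))] := tcont_integrable fi y0.
by have [_] := hy n.
Qed.

End translation_continuity.

(** * The Euler scheme for a finite even measure *)

(** Tonelli applied separately to the positive and the negative part. *)
Lemma measurable_fun_Rintegral d1 d2 (X : measurableType d1) (Y : measurableType d2)
    (R : realType) (m : {sigma_finite_measure set Y -> \bar R}) (f : X * Y -> R) :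
  measurable_fun setT f -> measurable_fun setT (fun x => \int[m]_y f (x, y)).
Proof.
move=> mf; have mF : measurable_fun setT (EFin \o f) by exact/measurable_EFinP.
rewrite /Rintegral; apply: measurableT_comp => //.
under eq_fun do rewrite integralE.
apply: emeasurable_funB.
- apply: (@eq_measurable_fun _ _ _ _ _ (fubini_F m (EFin \o f)^\+)%E).
    by move=> x _; apply: eq_integral => y _; rewrite !funeposE.
  by apply: measurable_fun_fubini_tonelli_F => //; exact: measurable_funepos.
- apply: (@eq_measurable_fun _ _ _ _ _ (fubini_F m (EFin \o f)^\-)%E).
    by move=> x _; apply: eq_integral => y _; rewrite !funenegE.
  by apply: measurable_fun_fubini_tonelli_F => //; exact: measurable_funeneg.
Qed.

Section finite_measure_integral.
Context d (X : measurableType d) (R : realType).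
Variable nu : {finite_measure set X -> \bar R}.
Implicit Types f g : X -> R.

Lemma bounded_integrable f C : measurable_fun setT f -> (forall x, `|f x| <= C) ->
  nu.-integrable setT (EFin \o f).
Proof.
move=> mf fC; apply: measurable_bounded_integrable => //.
  exact: fin_num_fun_lty.
by exists C; split=> [|M CM x _ /=]; rewrite ?num_real//; exact: le_trans (fC x) (ltW CM).
Qed.

(* Jensen, from the nonnegativity of the integral of [(f - mean f)^2]. *)
Lemma sqr_Rintegral_le f C : measurable_fun setT f -> (forall x, `|f x| <= C) ->
  (\int[nu]_x f x) ^+ 2 <= fine (nu setT) * \int[nu]_x (f x) ^+ 2.
Proof.
move=> mf fC; set m := fine _; set I := \int[nu]_x f x.
have fi := bounded_integrable mf fC.
have mf2 : measurable_fun setT (fun x => f x ^+ 2) by exact: measurable_funX.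
have f2i : nu.-integrable setT (EFin \o (fun x => f x ^+ 2)).
  by apply: (bounded_integrable (C := C ^+ 2)) => // x; rewrite normrX lerXn2r ?nnegrE//; exact: le_trans (fC x).
have m0 : 0 <= m by rewrite fine_ge0.
(* A null measure has no mean value; both sides are then 0. *)
have [m00|mn0] := eqVneq m 0.
  have nu0 : nu setT = 0%E.
    by rewrite -[LHS]fineK; [rewrite -/m m00|exact: fin_num_measure].
  have -> : I = 0.
    rewrite /I /Rintegral null_set_integral// ; exact: measurable_int fi.
  by rewrite expr0n/= m00 mul0r.
have mp : 0 < m by rewrite lt_neqAle eq_sym mn0.
have : 0 <= \int[nu]_x (f x ^+ 2 - 2 * (I / m) * f x + (I / m) ^+ 2).
  apply: Rintegral_ge0 => x _.
  rewrite (_ : _ + _ = (f x - I / m) ^+ 2) ?sqr_ge0//; ring.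
rewrite RintegralD//; last 2 first.
- have := integrableB measurableT f2i (integrableZl measurableT (2 * (I / m)) fi).
  by apply: eq_integrable => // x _ /=; rewrite -EFinM -EFinB.
- exact: finite_measure_integrable_cst.
rewrite RintegralB//; last first.
  have := integrableZl measurableT (2 * (I / m)) fi.
  by apply: eq_integrable => // x _ /=; rewrite -EFinM.
rewrite RintegralZl// Rintegral_cst// -/m -/I.
set S := \int[nu]_x _ => h.
have -> : I ^+ 2 = m * (2 * (I / m) * I - (I / m) ^+ 2 * m) by field.
by rewrite ler_pM2l//; lra.
Qed.

End finite_measure_integral.

Section averaging.
Context (R : realType) (N : nat).
Local Notation V := 'rV[R]_N.
Local Notation leb := (@lebesgue_rV R N).
Variable nu : {finite_measure set V -> \bar R}.
Implicit Types f g w : V -> R.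

Definition mass : R := fine (nu setT).

Lemma mass_ge0 : 0 <= mass. Proof. exact: fine_ge0. Qed.

Lemma massE : nu setT = mass%:E.
Proof. by rewrite fineK// fin_num_measure. Qed.

(** Not normalised: constants are multiplied by [mass]. *)
Definition avg w (x : V) := \int[nu]_z w (x + z).

Lemma measurable_shift2 f : measurable_fun setT f ->
  measurable_fun setT (fun p : V * V => f (p.1 + p.2)).
Proof.
by move=> mf; apply: (measurableT_comp mf); exact: measurable_fun_addrV.
Qed.

Lemma measurable_shiftl f (x : V) : measurable_fun setT f ->
  measurable_fun setT (fun z : V => f (x + z)).
Proof.
by move=> mf; apply: (measurableT_comp mf); exact: measurable_fun_addrV.
Qed.

Lemma measurable_avg w : measurable_fun setT w -> measurable_fun setT (avg w).
Proof. by move=> mw; exact: (@measurable_fun_Rintegral _ _ _ _ R nu _ (measurable_shift2 mw)). Qed.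

Lemma integrable_shift w C x : measurable_fun setT w -> (forall x, `|w x| <= C) ->
  nu.-integrable setT (EFin \o (fun z : V => w (x + z))).
Proof. by move=> mw wC; exact: (@bounded_integrable _ _ R nu _ C (measurable_shiftl x mw) (fun z => wC _)). Qed.

Lemma avg_cst c x : avg (cst c) x = mass * c.
Proof. by rewrite /avg Rintegral_cst// mulrC. Qed.

Lemma le_avg f g C D x : measurable_fun setT f -> (forall x, `|f x| <= C) ->
  measurable_fun setT g -> (forall x, `|g x| <= D) ->
  (forall x, f x <= g x) -> avg f x <= avg g x.
Proof.
by move=> mf fC mg gD fg; apply: le_Rintegral => //; [exact: integrable_shift fC|exact: integrable_shift gD].
Qed.

Lemma norm_avg_le f C x : measurable_fun setT f -> (forall x, `|f x| <= C) ->
  `|avg f x| <= avg (fun x => `|f x|) x.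
Proof. by move=> mf fC; apply: le_normr_Rintegral => //; exact: integrable_shift fC. Qed.

Lemma avgB f g C D x : measurable_fun setT f -> (forall x, `|f x| <= C) ->
  measurable_fun setT g -> (forall x, `|g x| <= D) ->
  avg (fun x => f x - g x) x = avg f x - avg g x.
Proof.
by move=> mf fC mg gD; apply: RintegralB => //; [exact: integrable_shift fC|exact: integrable_shift gD].
Qed.

Lemma avg_ge0 w x : (forall x, 0 <= w x) -> 0 <= avg w x.
Proof. by move=> w0; exact: Rintegral_ge0. Qed.

(** Tonelli, then translation invariance of the integral in [x] for each fixed [z]. This identity is
    what lets averages cancel against [mass] times the function after integration. *)
Lemma integral_avg w C : measurable_fun setT w -> (forall x, 0 <= w x <= C) ->
  (\int[leb]_x (avg w x)%:E = mass%:E * \int[leb]_x (w x)%:E)%E.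
Proof.
move=> mw w0C.
have mw2 : measurable_fun setT (fun p : V * V => (w (p.1 + p.2))%:E).
  by apply/measurable_EFinP; exact: measurable_shift2.
transitivity (\int[leb]_x \int[nu]_z (w (x + z)%R)%:E)%E.
  apply: eq_integral => x _; rewrite /avg /Rintegral fineK//.
  apply: (integrable_fin_num measurableT (f := EFin \o (fun z : V => w (x + z)))).
  by apply: (integrable_shift (C := C)) => // y; have /andP[w0 wC] := w0C y; rewrite ger0_norm.
rewrite (@fubini_tonelli _ _ _ _ _ leb nu (fun p => (w (p.1 + p.2))%:E))//=; last first.
  by move=> p; rewrite lee_fin; have /andP[] := w0C (p.1 + p.2).
transitivity (\int[nu]_z (\int[leb]_x (w x)%:E))%E.
  apply: eq_integral => z _; apply: (integral_shift z (f := EFin \o w)).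
  exact/measurable_EFinP.
by rewrite integral_cst// muleC -massE.
Qed.

(** The Levy operator of a finite measure without its gradient term: that term is odd in z, so an
    even finite measure integrates it to 0. *)
Definition levyf w x := avg w x - mass * w x.

Lemma measurable_levyf w : measurable_fun setT w -> measurable_fun setT (levyf w).
Proof.
by move=> mw; apply: measurable_funB; [exact: measurable_avg|exact: measurable_funM].
Qed.

Section euler_step.
Variables (phi : R -> R) (K h : R).
Hypothesis phi_homo : {homo phi : x y / x <= y}.
Hypothesis K0 : 0 <= K.
Hypothesis phi_lip : forall a b, `|phi a - phi b| <= K * `|a - b|.
Hypothesis h0 : 0 <= h.
Hypothesis cfl : 4 * h * mass * K <= 1.

Definition euler_step f x := f x + h * levyf (phi \o f) x.

(** The form in which the step restriction yields monotonicity; its factor 4 is spent in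
    [energy_step]. *)
Lemma cfl1 : h * mass * K <= 1.
Proof.
have : 0 <= h * mass * K by rewrite !mulr_ge0// mass_ge0.
move: cfl; have -> : 4 * h * mass * K = 4 * (h * mass * K) by rewrite !mulrA.
lra.
Qed.

Lemma measurable_phi : measurable_fun setT phi.
Proof.
apply: continuous_measurable_fun => x; apply/cvgrPdist_le => e e0.
have K1 : 0 < K + 1 by rewrite ltr_wpDl.
near=> y; apply: (le_trans (phi_lip _ _)).
apply: (@le_trans _ _ ((K + 1) * `|x - y|)); first by rewrite ler_wpM2r// lerDl.
rewrite -ler_pdivlMl// mulrC; near: y; apply: cvgr_dist_le => //.
by rewrite divr_gt0.
Unshelve. all: by end_near. Qed.

Lemma measurable_phi_comp f : measurable_fun setT f -> measurable_fun setT (phi \o f).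
Proof. by move=> mf; apply: measurableT_comp => //; exact: measurable_phi. Qed.

Lemma phi_bounded f M x : `|f x| <= M -> `|phi (f x)| <= `|phi 0| + K * M.
Proof.
move=> fM; rewrite -[phi (f x)](subrK (phi 0)) addrC (le_trans (ler_normD _ _))// lerD2l.
by rewrite (le_trans (phi_lip _ _))// subr0 ler_wpM2l.
Qed.

Lemma measurable_euler_step f : measurable_fun setT f -> measurable_fun setT (euler_step f).
Proof.
move=> mf; apply: measurable_funD => //; apply: measurable_funM => //.
by apply: measurable_levyf; exact: measurable_phi_comp.
Qed.

(** The slope of [phi] is at most [K], so subtracting [h mass phi] cannot reverse the order. Since
    the average is monotone too, the whole step is monotone in its argument. *)
Lemma cfl_homo a b : a <= b -> a - h * mass * phi a <= b - h * mass * phi b.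
Proof.
move=> ab; have := phi_lip b a.
rewrite !ger0_norm ?subr_ge0 ?phi_homo// => L.
have : h * mass * (phi b - phi a) <= h * mass * (K * (b - a)).
  by rewrite ler_wpM2l// mulr_ge0// mass_ge0.
rewrite !mulrA => h1.
have h2 : h * mass * K * (b - a) <= 1 * (b - a) by rewrite ler_wpM2r ?subr_ge0// cfl1.
by move: h1 h2; rewrite mul1r mulrBr; lra.
Qed.

(** A comparison with the constants M and -M, which the step leaves fixed: the local part is handled
    by [cfl_homo], the average by monotonicity of [phi]. *)
Lemma euler_step_bounded f M : measurable_fun setT f -> (forall x, `|f x| <= M) ->
  forall x, `|euler_step f x| <= M.
Proof.
move=> mf fM x.
have M0 : 0 <= M by exact: le_trans (fM x).
have fMM y : - M <= f y <= M by rewrite -ler_norml.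
have /andP[f1 f2] := fMM x.
have mw := measurable_phi_comp mf.
have wb y := phi_bounded (fM y).
have a1 : avg (phi \o f) x <= mass * phi M.
  rewrite -(avg_cst (phi M) x); apply: (le_avg _ mw wb (D := `|phi M|)) => // y /=.
  by apply: phi_homo; have /andP[] := fMM y.
have a2 : mass * phi (- M) <= avg (phi \o f) x.
  rewrite -(avg_cst (phi (- M)) x); apply: (@le_avg _ _ `|phi (- M)| _ _ _ _ mw wb) => // y /=.
  by apply: phi_homo; have /andP[] := fMM y.
have /(ler_wpM2l h0) := a1; have /(ler_wpM2l h0) := a2.
have := cfl_homo f1; have := cfl_homo f2.
rewrite /euler_step /levyf /= ler_norml mulrBr !mulrA; lra.
Qed.

Lemma euler_step_cst c : euler_step (cst c) = cst c.
Proof.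
apply/funext => x; rewrite /euler_step /levyf /=.
by rewrite (_ : phi \o cst c = cst (phi c))// avg_cst subrr mulr0 addr0.
Qed.

Lemma euler_step_shift f y :
  euler_step (fun x => f (x + y)) = (fun x => euler_step f (x + y)).
Proof.
apply/funext => x; rewrite /euler_step /levyf /avg /=; congr (_ + h * (_ - _)).
by apply: eq_Rintegral => z _ /=; rewrite addrAC.
Qed.

(* [a |-> a - h m phi a] is nondecreasing under the CFL condition, hence
   [|a - b| = |a - b - h m (phi a - phi b)| + h m |phi a - phi b|]. *)
Lemma euler_step_contraction f g M : measurable_fun setT f -> measurable_fun setT g ->
  (forall x, `|f x| <= M) -> (forall x, `|g x| <= M) ->
  (L1dist leb (euler_step f) (euler_step g) <= L1dist leb f g)%E.
Proof.
move=> mf mg fM gM.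
(* An integral of [w] is added to both sides and cancelled at the end, so it has to be finite; it is
   at most [K] times the distance. *)
have [->|] := eqVneq (L1dist leb f g) +oo%E; first by rewrite leey.
rewrite -ltey => fgy.
pose w x := `|phi (f x) - phi (g x)|.
have mpf := measurable_phi_comp mf; have mpg := measurable_phi_comp mg.
have mw : measurable_fun setT w by apply: measurableT_comp => //; exact: measurable_funB.
have pfb x := phi_bounded (fM x); have pgb x := phi_bounded (gM x).
have wC x : `|w x| <= (`|phi 0| + K * M) + (`|phi 0| + K * M).
  by rewrite normr_id (le_trans (ler_normB _ _))// lerD.
have w0 x : 0 <= w x by exact: normr_ge0.
have wfin : (\int[leb]_x (w x)%:E < +oo)%E.
  apply: (@le_lt_trans _ _ (K%:E * L1dist leb f g)%E); last first.
    by rewrite lte_mul_pinfty// ?lee_fin.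
  rewrite /L1dist -ge0_integralZl//; last exact: measurable_normB.
  apply: ge0_le_integral => //.
  - by move=> x _; rewrite lee_fin normr_ge0.
  - exact/measurable_EFinP.
  - by apply: measurable_funeM; exact: measurable_normB.
  - by move=> x _; rewrite -EFinM lee_fin; exact: phi_lip.
(* Pointwise form of the contraction: [h mass w] on the left and [h avg w] on the right have equal
   integrals by [integral_avg]. *)
have key x : `|euler_step f x - euler_step g x| + h * mass * w x <= `|f x - g x| + h * avg w x.
  have A1 : `|avg (phi \o f) x - avg (phi \o g) x| <= avg w x.
    rewrite -(avgB _ mpf pfb mpg pgb).
    apply: (norm_avg_le _ (C := (`|phi 0| + K * M) + (`|phi 0| + K * M))).
      exact: measurable_funB.
    by move=> y /=; rewrite (le_trans (ler_normB _ _))// lerD.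
  have A2 : `|f x - h * mass * phi (f x) - (g x - h * mass * phi (g x))| + h * mass * w x = `|f x - g x|.
    rewrite /w; have [fg|/ltW fg] := leP (f x) (g x).
      have := cfl_homo fg; have := phi_homo fg => h1 h2.
      rewrite !ler0_norm; lra.
    have := cfl_homo fg; have := phi_homo fg => h1 h2.
    rewrite !ger0_norm; lra.
  rewrite -A2 [leRHS]addrAC lerD2r.
  rewrite (_ : euler_step f x - euler_step g x =
    (f x - h * mass * phi (f x) - (g x - h * mass * phi (g x))) +
    h * (avg (phi \o f) x - avg (phi \o g) x)); last by rewrite /euler_step /levyf /=; ring.
  by rewrite (le_trans (ler_normD _ _))// lerD2l normrM ger0_norm// ler_wpM2l.
have mE := measurable_euler_step.
have hm0 : (0 <= (h * mass)%:E)%E by rewrite lee_fin mulr_ge0// mass_ge0.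
have : (L1dist leb (euler_step f) (euler_step g) + (h * mass)%:E * \int[leb]_x (w x)%:E <=
  L1dist leb f g + (h * mass)%:E * \int[leb]_x (w x)%:E)%E.
  have hE : ((h * mass)%:E * \int[leb]_x (w x)%:E = h%:E * \int[leb]_x (avg w x)%:E)%E.
    rewrite EFinM -muleA -(integral_avg mw (C := (`|phi 0| + K * M) + (`|phi 0| + K * M)))//.
    by move=> x; rewrite w0 (le_trans (ler_norm _) (wC x)).
  rewrite [X in (_ <= _ + X)%E]hE.
  have mwE : measurable_fun setT (EFin \o w) by exact/measurable_EFinP.
  have maE : measurable_fun setT (fun x => (avg w x)%:E) by apply/measurable_EFinP; exact: measurable_avg.
  have aw0 x : 0 <= avg w x by exact: avg_ge0.
  rewrite -!ge0_integralZl//; try by move=> x _; rewrite lee_fin.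
  rewrite /L1dist -!ge0_integralD//.
  - apply: ge0_le_integral => //; last by move=> x _; rewrite -!EFinM -!EFinD lee_fin; exact: key.
    + by move=> x _; rewrite -EFinM -EFinD lee_fin addr_ge0// !mulr_ge0// mass_ge0.
    + apply: emeasurable_funD; last exact: measurable_funeM.
      by apply: measurable_normB; exact: mE.
    + by apply: emeasurable_funD; [exact: measurable_normB|exact: measurable_funeM].
  - exact: measurable_normB.
  - by move=> x _; rewrite mule_ge0// lee_fin.
  - exact: measurable_funeM.
  - by apply: measurable_normB; exact: mE.
  - by move=> x _; rewrite mule_ge0// lee_fin.
  - exact: measurable_funeM.
rewrite leeD2rE// fin_numM// ge0_fin_numE//.
by apply: integral_ge0 => x _; rewrite lee_fin.
Qed.

End euler_step.
End averaging.

(** * Energy dissipation and symmetry of the operator of a finite measure *)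

Section energy_symmetry.
Context (R : realType) (N : nat).
Local Notation V := 'rV[R]_N.
Local Notation leb := (@lebesgue_rV R N).
Variable nu : {finite_measure set V -> \bar R}.
Implicit Types f g w psi : V -> R.

Lemma integrable_L1 f : measurable_fun setT f -> (\int[leb]_x `|f x|%:E < +oo)%E ->
  leb.-integrable setT (EFin \o f).
Proof. by move=> mf fy; apply/integrableP; split; [exact/measurable_EFinP|exact: fy]. Qed.

Lemma integrable_boundedM w f C : measurable_fun setT w -> (forall x, `|w x| <= C) ->
  leb.-integrable setT (EFin \o f) -> leb.-integrable setT (EFin \o (fun x => w x * f x)).
Proof.
move=> mw wC fi; have mf : measurable_fun setT f by apply/measurable_EFinP; exact: measurable_int fi.
have := integrableZl measurableT C fi.
apply: le_integrable => //; first by apply/measurable_EFinP; exact: measurable_funM.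
move=> x _ /=; rewrite lee_fin !normrM ler_wpM2r// (le_trans (wC x))//; exact: ler_norm.
Qed.

(** The carre du champ up to a factor: for bounded [w], its integral in [x] is twice the energy of
    [w]. *)
Definition sqdiff w (x : V) := \int[nu]_z (w (x + z) - w x) ^+ 2.

Lemma sqdiffE w C x : measurable_fun setT w -> (forall x, `|w x| <= C) ->
  sqdiff w x = avg nu (fun x => w x ^+ 2) x - 2 * w x * avg nu w x + mass nu * w x ^+ 2.
Proof.
move=> mw wC; have C0 : 0 <= C by exact: le_trans (wC 0).
have i1 : nu.-integrable setT (EFin \o (fun z => w (x + z) ^+ 2)).
  apply: (integrable_shift nu x (w := fun x => w x ^+ 2) (C := C ^+ 2)); first exact: measurable_funX.
  by move=> y; rewrite normrX lerXn2r ?nnegrE.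
have i2 : nu.-integrable setT (EFin \o (fun z => 2 * w x * w (x + z))).
  have := integrableZl measurableT (2 * w x) (integrable_shift nu x mw wC).
  by apply: eq_integrable => // z _.
rewrite /sqdiff /avg -RintegralZl//; last exact: integrable_shift wC.
rewrite -RintegralB// (mulrC (mass nu)) -(@Rintegral_cst _ _ _ nu setT measurableT) -RintegralD//.
- by apply: eq_Rintegral => z _; rewrite /cst; ring.
- by have := integrableB measurableT i1 i2; apply: eq_integrable => // z _.
- exact: finite_measure_integrable_cst.
Qed.

Lemma sqdiff_ge0 w x : 0 <= sqdiff w x.
Proof. by apply: Rintegral_ge0 => z _; exact: sqr_ge0. Qed.

Lemma measurable_sqdiff w : measurable_fun setT w -> measurable_fun setT (sqdiff w).
Proof.
move=> mw; apply: (@measurable_fun_Rintegral _ _ _ _ R nu (fun p : V * V => (w (p.1 + p.2) - w p.1) ^+ 2)).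
apply: measurable_funX; apply: measurable_funB; first exact: measurable_shift2.
exact: (measurableT_comp mw measurable_fst).
Qed.

(** Jensen: [levyf nu w x] is the integral of the increments [w (x + z) - w x]. *)
Lemma levyf_sqr_le w C x : measurable_fun setT w -> (forall x, `|w x| <= C) ->
  levyf nu w x ^+ 2 <= mass nu * sqdiff w x.
Proof.
move=> mw wC.
have mz : measurable_fun setT (fun z : V => w (x + z) - w x).
  by apply: measurable_funB => //; exact: measurable_shiftl.
have := @sqr_Rintegral_le _ _ R nu _ (C + C) mz.
rewrite RintegralB//; last 2 first.
- exact: integrable_shift wC.
- exact: finite_measure_integrable_cst.
rewrite Rintegral_cst// (mulrC (w x)); apply => z.
by rewrite (le_trans (ler_normB _ _))// lerD.
Qed.

Section energy_step.
Variables (phi : R -> R) (K h : R).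
Hypothesis phi_homo : {homo phi : x y / x <= y}.
Hypothesis K0 : 0 <= K.
Hypothesis phi_lip : forall a b, `|phi a - phi b| <= K * `|a - b|.
Hypothesis h0 : 0 <= h.
Hypothesis cfl : 4 * h * mass nu * K <= 1.
Hypothesis phi0 : phi 0 = 0.
(** [Phi] stands for a convex primitive of [phi]. It enters through its subgradient inequality on
    [-M, M], so that it is never differentiated. *)
Variables (Phi : R -> R) (M : R).
Hypothesis mPhi : measurable_fun setT Phi.
Hypothesis Phi_ge0 : forall a, `|a| <= M -> 0 <= Phi a.
Hypothesis Phi_subgradient : forall a b, `|a| <= M -> `|b| <= M ->
  Phi b - Phi a <= phi b * (b - a).

(* With [D = sqdiff w], one has [w * levyf w = (avg (w^2) - mass * w^2 - D) / 2];
   after integration the first two terms cancel by translation invariance. *)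
Lemma energy_step f : measurable_fun setT f -> (forall x, `|f x| <= M) ->
  (\int[leb]_x `|f x|%:E < +oo)%E ->
  (\int[leb]_x (Phi (euler_step nu phi h f x))%:E +
   (h / 4)%:E * \int[leb]_x (sqdiff (phi \o f) x)%:E <= \int[leb]_x (Phi (f x))%:E)%E.
Proof.
move=> mf fM fi; set w := phi \o f; set g := euler_step _ _ _ _.
have m0 : 0 <= mass nu by exact: mass_ge0.
have M0 : 0 <= M by exact: le_trans (fM 0).
have mw : measurable_fun setT w by exact: (measurable_phi_comp K0 phi_lip).
have wM x : `|w x| <= K * M.
  by have := phi_bounded K0 phi_lip (fM x); rewrite phi0 normr0 add0r.
have mg : measurable_fun setT g by exact: (measurable_euler_step _ _ K0 phi_lip).
have gM : forall x, `|g x| <= M.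
  exact: (euler_step_bounded phi_homo K0 phi_lip h0 cfl mf fM).
have wf x : `|w x| <= K * `|f x| by rewrite -[w x]subr0 -phi0 (le_trans (phi_lip _ _))// subr0.
have mw2 : measurable_fun setT (fun x => w x ^+ 2) by exact: measurable_funX.
have w2M x : 0 <= w x ^+ 2 <= (K * M) ^+ 2.
  by rewrite sqr_ge0/= -(ger0_norm (sqr_ge0 (w x))) normrX lerXn2r ?nnegrE ?mulr_ge0.
(* The subgradient inequality at the new value gives phi(g)(g - f) = w(g - f) + (phi(g) - w)(g - f).
   The first term carries the dissipation -(h/2) [sqdiff]. The second is the explicit error, at most
   K (g - f)^2 <= K h^2 mass [sqdiff] <= (h/4) [sqdiff]: this is where the factor 4 of [cfl] is
   spent, and h/4 of the dissipation survives. *)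
have key x : Phi (g x) + h / 4 * sqdiff w x + h / 2 * mass nu * w x ^+ 2 <=
    Phi (f x) + h / 2 * avg nu (fun x => w x ^+ 2) x.
  have s1 := Phi_subgradient (fM x) (gM x).
  have s2 : (phi (g x) - w x) * (g x - f x) <= K * (g x - f x) ^+ 2.
    rewrite (le_trans (ler_norm _))// normrM -(ger0_norm (sqr_ge0 (g x - f x))) normrX.
    by rewrite expr2 mulrA ler_wpM2r// phi_lip.
  have s3 : g x - f x = h * levyf nu w x by rewrite /g /euler_step addrC addKr.
  have s4 := levyf_sqr_le x mw wM.
  have s5 : K * (g x - f x) ^+ 2 <= h / 4 * sqdiff w x.
    rewrite s3 exprMn mulrA (le_trans (ler_wpM2l _ s4)) ?mulr_ge0 ?sqr_ge0//.
    rewrite (_ : _ * (_ * _) = (4 * h * mass nu * K) * (h / 4 * sqdiff w x)); last by field.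
    by rewrite ler_piMl// mulr_ge0 ?divr_ge0// sqdiff_ge0.
  have s6 : w x * (g x - f x) = h / 2 * (avg nu (fun x => w x ^+ 2) x - mass nu * w x ^+ 2 - sqdiff w x).
    by rewrite s3 /levyf (sqdiffE _ mw wM); field.
  have s7 : phi (g x) * (g x - f x) = (phi (g x) - w x) * (g x - f x) + w x * (g x - f x) by ring.
  move: s1; rewrite s7 s6 => s1.
  have s8 : Phi (g x) - Phi (f x) <= h / 4 * sqdiff w x +
     h / 2 * (avg nu (fun x => w x ^+ 2) x - mass nu * w x ^+ 2 - sqdiff w x).
    by apply: (le_trans s1); rewrite lerD2r (le_trans s2).
  have s9 : h / 2 * (avg nu (fun x => w x ^+ 2) x - mass nu * w x ^+ 2 - sqdiff w x) =
    h / 2 * avg nu (fun x => w x ^+ 2) x - h / 2 * mass nu * w x ^+ 2 - 2 * (h / 4 * sqdiff w x) by field.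
  move: s8; rewrite s9; lra.
(* Finiteness of this integral permits its cancellation at the end. It comes from |w| <= K M and |w|
   <= K |f|, the latter because [phi 0 = 0]. *)
have w2fin : (\int[leb]_x (w x ^+ 2)%:E < +oo)%E.
  apply: (@le_lt_trans _ _ ((K * M * K)%:E * \int[leb]_x `|f x|%:E)%E); last first.
    by rewrite lte_mul_pinfty// ?lee_fin ?mulr_ge0// ge0_fin_numE// integral_ge0// => x _; rewrite lee_fin.
  have mnf : measurable_fun setT (fun x => `|f x|%:E) by apply/measurable_EFinP; exact: measurableT_comp.
  rewrite -ge0_integralZl//; last by rewrite lee_fin !mulr_ge0.
  apply: ge0_le_integral => //.
  - by move=> x _; rewrite lee_fin sqr_ge0.
  - exact/measurable_EFinP.
  - exact: measurable_funeM.
  - move=> x _; rewrite -EFinM lee_fin -(ger0_norm (sqr_ge0 _)) normrX expr2.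
    by rewrite (_ : K * M * K * `|f x| = (K * M) * (K * `|f x|)) ?mulrA// -mulrA ler_pM.
set c := (h / 2 * mass nu)%:E.
have c0 : (0 <= c)%E by rewrite lee_fin !mulr_ge0// invr_ge0.
have : (\int[leb]_x (Phi (g x))%:E + (h / 4)%:E * \int[leb]_x (sqdiff w x)%:E +
    c * \int[leb]_x (w x ^+ 2)%:E <=
  \int[leb]_x (Phi (f x))%:E + c * \int[leb]_x (w x ^+ 2)%:E)%E.
  have hE : (c * \int[leb]_x (w x ^+ 2)%:E = (h / 2)%:E * \int[leb]_x (avg nu (fun x => w x ^+ 2) x)%:E)%E.
    by rewrite /c EFinM -muleA -(integral_avg nu mw2 w2M).
  rewrite [X in (_ <= _ + X)%E]hE.
  have e1 : measurable_fun setT (fun x => (w x ^+ 2)%:E) by exact/measurable_EFinP.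
  have e2 : measurable_fun setT (fun x => (avg nu (fun x => w x ^+ 2) x)%:E).
    by apply/measurable_EFinP; exact: measurable_avg.
  have e3 : measurable_fun setT (fun x => (sqdiff w x)%:E).
    by apply/measurable_EFinP; exact: measurable_sqdiff.
  have e4 : measurable_fun setT (fun x => (Phi (g x))%:E).
    by apply/measurable_EFinP; exact: measurableT_comp.
  have e5 : measurable_fun setT (fun x => (Phi (f x))%:E).
    by apply/measurable_EFinP; exact: measurableT_comp.
  have p1 x : (0 <= (w x ^+ 2)%:E)%E by rewrite lee_fin sqr_ge0.
  have p2 x : (0 <= (avg nu (fun x => w x ^+ 2) x)%:E)%E.
    by rewrite lee_fin avg_ge0// => y; rewrite sqr_ge0.
  have p3 x : (0 <= (sqdiff w x)%:E)%E by rewrite lee_fin sqdiff_ge0.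
  have p4 x : (0 <= (Phi (g x))%:E)%E by rewrite lee_fin Phi_ge0.
  have p5 x : (0 <= (Phi (f x))%:E)%E by rewrite lee_fin Phi_ge0.
  have h2 : (0 <= (h / 2)%:E)%E by rewrite lee_fin divr_ge0.
  have h4 : (0 <= (h / 4)%:E)%E by rewrite lee_fin divr_ge0.
  have E1 := measurable_funeM c e1; have E2 := measurable_funeM (h / 2)%:E e2.
  have E3 := measurable_funeM (h / 4)%:E e3.
  rewrite -!ge0_integralZl// -!ge0_integralD//.
  - apply: ge0_le_integral => //.
    + by move=> x _; rewrite !adde_ge0// mule_ge0.
    + by apply: emeasurable_funD => //; exact: emeasurable_funD.
    + exact: emeasurable_funD.
    + by move=> x _; rewrite -!EFinM -!EFinD lee_fin; exact: key.
  - by move=> x _; rewrite mule_ge0.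
  - by move=> x _; rewrite adde_ge0// mule_ge0.
  - exact: emeasurable_funD.
  - by move=> x _; rewrite mule_ge0.
  - by move=> x _; rewrite mule_ge0.
rewrite leeD2rE// fin_numM// ge0_fin_numE//.
by apply: integral_ge0 => x _; rewrite lee_fin sqr_ge0.
Qed.

End energy_step.

Hypothesis nu_even : forall A : set V, measurable A -> nu (-%R @^-1` A) = nu A.

Lemma avg_opp w x : measurable_fun setT w ->
  \int[nu]_z w (x - z) = avg nu w x.
Proof.
move=> mw; rewrite /avg /Rintegral; congr fine.
apply: (integral_preserving _ nu_even (f := EFin \o (fun z : V => w (x + z)))).
  by apply: measurable_fun_opprV; exact: measurable_id.
by apply/measurable_EFinP; exact: measurable_shiftl.
Qed.

(** Fubini, the substitution x -> x - z for each fixed z, and evenness of [nu] to turn psi(x - z)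
    back into psi(x + z). *)
Lemma avg_sym w psi C D : measurable_fun setT w -> (forall x, `|w x| <= C) ->
  measurable_fun setT psi -> (forall x, `|psi x| <= D) ->
  leb.-integrable setT (EFin \o psi) ->
  \int[leb]_x (avg nu w x * psi x) = \int[leb]_x (w x * avg nu psi x).
Proof.
move=> mw wC mpsi psiD ipsi.
have C0 : 0 <= C by exact: le_trans (wC 0).
pose F (p : V * V) := w (p.1 + p.2) * psi p.1.
have mF : measurable_fun setT (EFin \o F).
  apply/measurable_EFinP; apply: measurable_funM; first exact: measurable_shift2.
  exact: (measurableT_comp mpsi measurable_fst).
have iF : (leb \x nu)%E.-integrable setT (EFin \o F).
  apply/(integrable12ltyP leb nu mF).
  apply: (@le_lt_trans _ _ (\int[leb]_x (C * mass nu * `|psi x|)%:E)%E).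
    apply: ge0_le_integral => //.
    - by move=> x _; apply: integral_ge0.
    - apply: (@measurable_fun_fubini_tonelli_F _ _ _ _ _ nu (fun p => `|(F p)%:E|%E)) => //.
      exact: measurableT_comp.
    - apply/measurable_EFinP; apply: measurable_funM => //; exact: measurableT_comp.
    - move=> x _; rewrite (mulrC C) -mulrA mulrC EFinM -massE -integral_cst//.
      apply: ge0_le_integral => //.
      + by apply: measurableT_comp => //; exact: measurableT_comp mF (measurable_pair1 x).
      + by move=> z _; rewrite /= lee_fin normrM ler_wpM2r.
  have := integrableZl measurableT (C * mass nu) ipsi.
  move=> /integrableP[_]; apply: le_lt_trans; apply: ge0_le_integral => //.
  - by move=> x _; rewrite lee_fin !mulr_ge0// mass_ge0.
  - apply/measurable_EFinP; apply: measurable_funM => //; exact: measurableT_comp.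
  - apply: measurableT_comp => //; apply: measurable_funeM; exact/measurable_EFinP.
  - by move=> x _; rewrite -EFinM lee_fin normrM ger0_norm ?mulr_ge0// mass_ge0.
have shw x := integrable_shift nu x mw wC.
have psish x : nu.-integrable setT (EFin \o (fun z : V => psi (x - z))).
  apply: (bounded_integrable nu (C := D)) => //.
  apply: (measurableT_comp mpsi); apply: measurable_fun_addrV => //.
  by apply: measurable_fun_opprV; exact: measurable_id.
transitivity (fine (\int[leb]_x \int[nu]_z (F (x, z))%:E)).
  rewrite /Rintegral; congr fine; apply: eq_integral => x _.
  rewrite /avg EFinM /Rintegral fineK; last exact: (integrable_fin_num measurableT (shw x)).
  rewrite -(integralZr measurableT (shw x)).
  by apply: eq_integral => z _; rewrite /= -EFinM.
rewrite (Fubini iF).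
pose G (p : V * V) := w p.1 * psi (p.1 - p.2).
have mG : measurable_fun setT (EFin \o G).
  apply/measurable_EFinP; apply: measurable_funM; first exact: (measurableT_comp mw measurable_fst).
  apply: (measurableT_comp mpsi); apply: measurable_fun_addrV => //.
  by apply: measurable_fun_opprV; exact: measurable_snd.
(* [G] is [F] after the shear (x, z) -> (x - z, z), a translation in x for each z; integrability of
   [G] is therefore read off the iterated integral with z outside. *)
have GF x z : G (x + z, z) = F (x, z) by rewrite /G /F /= addrK.
have iG : (leb \x nu)%E.-integrable setT (EFin \o G).
  apply/(integrable21ltyP leb nu mG).
  have /(integrable21ltyP leb nu mF) := iF.
  apply: le_lt_trans; rewrite le_eqVlt; apply/orP; left; apply/eqP.
  apply: eq_integral => z _; symmetry.
  rewrite -(integral_shift z (f := fun x => `|(G (x, z))%:E|%E)).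
    by apply: eq_integral => x _; rewrite /= GF.
  by apply: measurableT_comp => //; exact: measurableT_comp mG (measurable_pair2 z).
transitivity (fine (\int[nu]_z \int[leb]_x (G (x, z))%:E)).
  congr fine; apply: eq_integral => z _.
  rewrite -[RHS](integral_shift z).
    by apply: eq_integral => x _; rewrite /= GF.
  exact: measurableT_comp mG (measurable_pair2 z).
rewrite -(Fubini iG) /Rintegral; congr fine; apply: eq_integral => x _.
rewrite -(avg_opp x mpsi) EFinM /Rintegral fineK; last exact: (integrable_fin_num measurableT (psish x)).
rewrite -(integralZl measurableT (psish x)).
by apply: eq_integral => z _; rewrite /= -EFinM.
Qed.

Lemma levyfB_cst c w C x : measurable_fun setT w -> (forall x, `|w x| <= C) ->
  levyf nu (fun x => w x - c) x = levyf nu w x.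
Proof.
move=> mw wC; rewrite /levyf (avgB nu x mw wC (measurable_cst c) (D := `|c|))//.
by rewrite (avg_cst nu c x); ring.
Qed.

Lemma avg_bounded w C x : measurable_fun setT w -> (forall x, `|w x| <= C) ->
  `|avg nu w x| <= mass nu * C.
Proof.
move=> mw wC; apply: (le_trans (norm_avg_le nu x mw wC)).
rewrite -(avg_cst nu C x); apply: (@le_avg _ _ nu _ _ C C) => //.
- exact: measurableT_comp.
- by move=> y; rewrite normr_id.
- by move=> y /=; rewrite ger0_norm// (le_trans _ (wC y)).
Qed.

Lemma levyf_bounded w C x : measurable_fun setT w -> (forall x, `|w x| <= C) ->
  `|levyf nu w x| <= (mass nu + mass nu) * C.
Proof.
move=> mw wC; rewrite mulrDl (le_trans (ler_normB _ _))// lerD//; first exact: avg_bounded.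
by rewrite normrM ger0_norm ?mass_ge0// ler_wpM2l// mass_ge0.
Qed.

Lemma integrable_avg psi D : leb.-integrable setT (EFin \o psi) -> (forall x, `|psi x| <= D) ->
  leb.-integrable setT (EFin \o avg nu psi).
Proof.
move=> ipsi psiD.
have mpsi : measurable_fun setT psi by apply/measurable_EFinP; exact: measurable_int ipsi.
apply: integrable_L1; first exact: measurable_avg.
have mpn : measurable_fun setT (fun x => `|psi x|) by exact: measurableT_comp.
apply: (@le_lt_trans _ _ (\int[leb]_x (avg nu (fun x => `|psi x|) x)%:E)%E).
  apply: ge0_le_integral => //.
  - apply/measurable_EFinP; apply: measurableT_comp => //; exact: measurable_avg.
  - by apply/measurable_EFinP; exact: measurable_avg.
  - by move=> x _; rewrite lee_fin; exact: norm_avg_le psiD.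
rewrite (integral_avg nu mpn (C := D)); last by move=> x; rewrite normr_ge0/=.
rewrite lte_mul_pinfty// ?lee_fin ?mass_ge0//.
by case/integrableP : ipsi.
Qed.

Lemma integrable_levyf psi D : leb.-integrable setT (EFin \o psi) -> (forall x, `|psi x| <= D) ->
  leb.-integrable setT (EFin \o levyf nu psi).
Proof.
move=> ipsi psiD.
have := integrableB measurableT (integrable_avg ipsi psiD) (integrableZl measurableT (mass nu) ipsi).
by apply: eq_integrable.
Qed.

Lemma levyf_sym w psi C D : measurable_fun setT w -> (forall x, `|w x| <= C) ->
  measurable_fun setT psi -> (forall x, `|psi x| <= D) ->
  leb.-integrable setT (EFin \o psi) ->
  \int[leb]_x (levyf nu w x * psi x) = \int[leb]_x (w x * levyf nu psi x).
Proof.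
move=> mw wC mpsi psiD ipsi.
have C0 : 0 <= C by exact: le_trans (wC 0).
have D0 : 0 <= D by exact: le_trans (psiD 0).
have i1 : leb.-integrable setT (EFin \o (fun x => avg nu w x * psi x)).
  apply: (integrable_boundedM (C := mass nu * C)) => //; first exact: measurable_avg.
  by move=> x; exact: avg_bounded.
have i2 : leb.-integrable setT (EFin \o (fun x => w x * psi x)) by exact: (integrable_boundedM mw wC).
have i3 : leb.-integrable setT (EFin \o (fun x => w x * avg nu psi x)).
  by apply: (integrable_boundedM mw wC); exact: integrable_avg psiD.
have i4 : leb.-integrable setT (EFin \o (fun x => mass nu * (w x * psi x))).
  by have := integrableZl measurableT (mass nu) i2; apply: eq_integrable.
transitivity (\int[leb]_x (avg nu w x * psi x - mass nu * (w x * psi x))).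
  by apply: eq_Rintegral => x _; rewrite /levyf; ring.
rewrite RintegralB// (avg_sym mw wC mpsi psiD ipsi) -RintegralB//.
by apply: eq_Rintegral => x _; rewrite /levyf; ring.
Qed.

End energy_symmetry.

(** * Iterates of the step: stability, energy bound and weak form *)

Section euler_scheme.
Context (R : realType) (N : nat).
Local Notation V := 'rV[R]_N.
Local Notation leb := (@lebesgue_rV R N).
Variable nu : {finite_measure set V -> \bar R}.
Hypothesis nu_even : forall A : set V, measurable A -> nu (-%R @^-1` A) = nu A.
Variables (phi : R -> R) (K h : R).
Hypothesis phi_homo : {homo phi : x y / x <= y}.
Hypothesis K0 : 0 <= K.
Hypothesis phi_lip : forall a b, `|phi a - phi b| <= K * `|a - b|.
Hypothesis h0 : 0 <= h.
Hypothesis cfl : 4 * h * mass nu * K <= 1.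
Variables (u0 : V -> R) (M : R).
Hypothesis mu0 : measurable_fun setT u0.
Hypothesis u0M : forall x, `|u0 x| <= M.
Hypothesis u0_fin : (\int[leb]_x `|u0 x|%:E < +oo)%E.

Definition euler n := iter n (euler_step nu phi h) u0.

Lemma measurable_iter_step n (v : V -> R) : measurable_fun setT v ->
  measurable_fun setT (iter n (euler_step nu phi h) v).
Proof. by move=> mv; elim: n => //= n ih; exact: (measurable_euler_step _ _ K0 phi_lip). Qed.

Lemma iter_step_bounded n (v : V -> R) : measurable_fun setT v -> (forall x, `|v x| <= M) ->
  forall x, `|iter n (euler_step nu phi h) v x| <= M.
Proof.
move=> mv vM; elim: n => //= n ih.
by apply: (euler_step_bounded phi_homo K0 phi_lip h0 cfl) => //; exact: measurable_iter_step.
Qed.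

Lemma measurable_euler n : measurable_fun setT (euler n).
Proof. exact: measurable_iter_step. Qed.

Lemma euler_bounded n x : `|euler n x| <= M.
Proof.
exact: iter_step_bounded.
Qed.

Lemma M_ge0 : 0 <= M. Proof. exact: le_trans (u0M 0). Qed.

Lemma euler_contraction n (v0 : V -> R) : measurable_fun setT v0 -> (forall x, `|v0 x| <= M) ->
  (L1dist leb (iter n (euler_step nu phi h) v0) (euler n) <= L1dist leb v0 u0)%E.
Proof.
move=> mv0 v0M; elim: n => //= n ih; apply: le_trans ih.
apply: (euler_step_contraction phi_homo K0 phi_lip h0 cfl (M := M)).
- exact: measurable_iter_step.
- exact: measurable_euler.
- exact: iter_step_bounded.
- exact: euler_bounded.
Qed.

(** The bound involves the initial datum alone, hence is uniform in the measure, the nonlinearity,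
    the step and the number of steps. *)
Lemma euler_shift n (y : V) :
  (L1dist leb (fun x : V => euler n (x + y)) (euler n) <= L1dist leb (fun x : V => u0 (x + y)%R) u0)%E.
Proof.
have -> : (fun x : V => euler n (x + y)) = iter n (euler_step nu phi h) (fun x => u0 (x + y)).
  by elim: n => //= n <-; rewrite euler_step_shift.
by apply: euler_contraction => //; exact: measurable_shift.
Qed.

(** Contraction against the zero function, a fixed point of the step. *)
Lemma euler_L1 n : (\int[leb]_x `|euler n x|%:E <= \int[leb]_x `|u0 x|%:E)%E.
Proof.
have E f : (\int[leb]_x `|f x|%:E)%E = L1dist leb (cst 0) f.
  by apply: eq_integral => x _; rewrite sub0r normrN.
rewrite !E.
have := @euler_contraction n (cst 0) (measurable_cst _).
have -> : iter n (euler_step nu phi h) (cst 0) = cst 0.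
  by elim: n => //= n ->; rewrite euler_step_cst.
by apply => x; rewrite normr0 M_ge0.
Qed.

Lemma euler_energy (Phi : R -> R) : measurable_fun setT Phi ->
  (forall a, `|a| <= M -> 0 <= Phi a) ->
  (forall a b, `|a| <= M -> `|b| <= M -> Phi b - Phi a <= (phi b - phi 0) * (b - a)) ->
  forall n, (\int[leb]_x (Phi (euler n x))%:E +
    \sum_(i < n) (h / 4)%:E * \int[leb]_x (sqdiff nu (phi \o euler i) x)%:E <=
     \int[leb]_x (Phi (u0 x))%:E)%E.
Proof.
move=> mPhi Phi0 Phis; elim=> [|n ih].
  by rewrite big_ord0 adde0.
(* The normalisation makes [phi'] of an integrable bounded function square integrable; it changes
   neither the scheme nor [sqdiff], which ignore additive constants. *)
pose phi' a := phi a - phi 0.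
have phi'_homo : {homo phi' : x y / x <= y} by move=> x y xy; rewrite lerD2r phi_homo.
have phi'_lip a b : `|phi' a - phi' b| <= K * `|a - b|.
  by rewrite /phi' opprB addrA subrK; exact: phi_lip.
have phi'0 : phi' 0 = 0 by rewrite /phi' subrr.
have := @energy_step _ _ nu phi' K h phi'_homo K0 phi'_lip h0 cfl phi'0 Phi M mPhi Phi0 Phis _
  (measurable_euler n) (euler_bounded n) (le_lt_trans (euler_L1 n) u0_fin).
rewrite (_ : euler_step nu phi' h (euler n) = euler n.+1); last first.
  apply/funext => x; rewrite /= /euler_step; congr (_ + h * _).
  exact: (levyfB_cst nu (phi 0) x (measurable_phi_comp K0 phi_lip (measurable_euler n))
    (fun x => phi_bounded K0 phi_lip (euler_bounded n x))).
rewrite (_ : sqdiff nu (phi' \o _) = sqdiff nu (phi \o euler n)); last first.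
  by apply/funext => x; apply: eq_Rintegral => z _; congr (_ ^+ 2); rewrite /phi'/=; ring.
by move=> e; rewrite big_ord_recr/= addeA addeAC; apply: le_trans ih; exact: leeD2r.
Qed.

(** Symmetry moves the operator onto [psi], where it can be bounded independently of the
    truncation. *)
Lemma euler_weak (psi : V -> R) D n : measurable_fun setT psi -> (forall x, `|psi x| <= D) ->
  leb.-integrable setT (EFin \o psi) ->
  \int[leb]_x (euler n.+1 x * psi x) =
  \int[leb]_x (euler n x * psi x) + h * \int[leb]_x (phi (euler n x) * levyf nu psi x).
Proof.
move=> mpsi psiD ipsi.
pose w := phi \o euler n.
have mw : measurable_fun setT w by exact: (measurable_phi_comp K0 phi_lip (measurable_euler n)).
have wB x : `|w x| <= `|phi 0| + K * M by apply: phi_bounded => //; exact: euler_bounded.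
rewrite -(levyf_sym nu_even mw wB mpsi psiD ipsi).
have i1 := integrable_boundedM (measurable_euler n) (euler_bounded n) ipsi.
have i2 : leb.-integrable setT (EFin \o (fun x => levyf nu w x * psi x)).
  apply: (integrable_boundedM _ _ ipsi (C := (mass nu + mass nu) * (`|phi 0| + K * M))).
    exact: measurable_levyf.
  by move=> x; exact: levyf_bounded.
have i3 : leb.-integrable setT (EFin \o (fun x => h * (levyf nu w x * psi x))).
  by have := integrableZl measurableT h i2; apply: eq_integrable.
rewrite -RintegralZl// -RintegralD//.
by apply: eq_Rintegral => x _; rewrite /= /euler_step; ring.
Qed.

(** Each step changes the pairing with [psi] by at most h B times the L^1 norm of [levyf nu psi]. No
    spatial regularity of the iterates is involved, only a bound on [phi] over their range. *)
Lemma euler_time (psi : V -> R) D B n k : measurable_fun setT psi -> (forall x, `|psi x| <= D) ->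
  leb.-integrable setT (EFin \o psi) -> (forall a, `|a| <= M -> `|phi a| <= B) ->
  `|\int[leb]_x (euler (n + k) x * psi x) - \int[leb]_x (euler n x * psi x)| <=
  (h *+ k) * (B * \int[leb]_x `|levyf nu psi x|).
Proof.
move=> mpsi psiD ipsi phiB.
have il := integrable_levyf nu ipsi psiD.
have ml : measurable_fun setT (levyf nu psi) by exact: measurable_levyf.
elim: k => [|k ih]; first by rewrite addn0 subrr normr0 mulr0n mul0r.
rewrite addnS (euler_weak _ mpsi psiD ipsi) -addrAC (le_trans (ler_normD _ _))//.
rewrite mulrSr mulrDl lerD// normrM (ger0_norm h0) ler_wpM2l//.
have mw : measurable_fun setT (phi \o euler (n + k)).
  exact: (measurable_phi_comp K0 phi_lip (measurable_euler _)).
have wB x : `|(phi \o euler (n + k)) x| <= B by apply: phiB; exact: euler_bounded.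
have i1 := integrable_boundedM mw wB il.
rewrite (le_trans (le_normr_Rintegral measurableT i1))// -RintegralZl//; last exact: integrable_norm.
apply: le_Rintegral => //.
- exact: (integrable_norm i1).
- by have := integrableZl measurableT B (integrable_norm il); apply: eq_integrable.
- by move=> x _; rewrite normrM ler_wpM2r.
Qed.

End euler_scheme.

(** * Truncation of the Levy measure *)

Section integral_mfrestr.
Local Open Scope ereal_scope.
Context d (X : measurableType d) (R : realType).
Variables (mu : {measure set X -> \bar R}) (D : set X) (mD : measurable D) (Dy : mu D < +oo).

Lemma ge0_integral_mfrestr (f : X -> \bar R) : measurable_fun setT f -> (forall x, 0 <= f x) ->
  \int[mfrestr mD Dy]_x f x = \int[mu]_(x in D) f x.
Proof.
move=> mf f0.
rewrite (@ge0_negligible_integral _ _ _ (mfrestr mD Dy) setT (~` D))//; last 2 first.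
- exact: measurableC.
- by rewrite -[LHS]/(mu (~` D `&` D)) setICl measure0.
rewrite setTD setCK; apply: eq_measure_integral => A mA AD.
by rewrite -[LHS]/(mu (A `&` D)) setIidl.
Qed.

Lemma integral_mfrestr (f : X -> \bar R) : measurable_fun setT f ->
  \int[mfrestr mD Dy]_x f x = \int[mu]_(x in D) f x.
Proof.
move=> mf; rewrite [LHS]integralE [RHS]integralE; congr (_ - _).
- by apply: ge0_integral_mfrestr => //; exact: measurable_funepos.
- by apply: ge0_integral_mfrestr => //; exact: measurable_funeneg.
Qed.

End integral_mfrestr.

Section euclidean_norm.
Context (R : realType) (N : nat).
Local Notation V := 'rV[R]_N.
Implicit Types x y z : V.

Lemma dotv_ge0 x : 0 <= dotv x x.
Proof. by apply: sumr_ge0 => i _; rewrite -expr2 sqr_ge0. Qed.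

Lemma enorm_ge0 x : 0 <= enorm x. Proof. exact: sqrtr_ge0. Qed.

Lemma enorm_sqr x : enorm x ^+ 2 = dotv x x.
Proof. by rewrite sqr_sqrtr// dotv_ge0. Qed.

Lemma coord_le_enorm x i : `|x ord0 i| <= enorm x.
Proof.
rewrite -sqrtr_sqr; apply: ler_wsqrtr.
rewrite /dotv (bigD1 i)//= -expr2 lerDl; apply: sumr_ge0 => j _.
by rewrite -expr2 sqr_ge0.
Qed.

Lemma enormN x : enorm (- x) = enorm x.
Proof. by congr Num.sqrt; apply: eq_bigr => i _; rewrite mxE mulrNN. Qed.

Lemma enorm0 : enorm (0 : V) = 0.
Proof. by rewrite /enorm /dotv big1 ?sqrtr0// => i _; rewrite mxE mul0r. Qed.

Lemma enorm_eq0 x : (enorm x == 0) = (x == 0).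
Proof.
apply/eqP/eqP => [x0|->]; last exact: enorm0.
apply/rowP => i; rewrite mxE; apply/eqP; rewrite -normr_le0 -x0.
exact: coord_le_enorm.
Qed.

Lemma enorm_gt0 x : (0 < enorm x) = (x != 0).
Proof. by rewrite lt_neqAle enorm_ge0 andbT eq_sym enorm_eq0. Qed.

Lemma measurable_enorm : measurable_fun setT (@enorm R N).
Proof.
apply: (@measurableT_comp _ _ _ _ _ _ (@Num.sqrt R)).
  by apply: continuous_measurable_fun; exact: sqrt_continuous.
apply: measurable_sum => i; apply: measurable_funM; exact: measurable_coord.
Qed.

Lemma measurable_set1V (y : V) : measurable [set y].
Proof.
rewrite -[X in measurable X]setCK; apply: measurableC; apply: sub_sigma_algebra.
rewrite openC; exact/accessible_closed_set1/hausdorff_accessible/norm_hausdorff.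
Qed.

Lemma measurable_ball_enorm (r : R) : measurable [set z : V | r < enorm z].
Proof.
rewrite (_ : [set _ | _] = @enorm R N @^-1` `]r, +oo[%classic).
  by rewrite -[X in measurable X]setTI; exact: measurable_enorm.
by apply/seteqP; split=> z /=; rewrite in_itv/= andbT.
Qed.

End euclidean_norm.

Section levy_measure.
Context (R : realType) (N : nat).
Local Notation V := 'rV[R]_N.
Local Notation leb := (@lebesgue_rV R N).
Variable mu : {measure set V -> \bar R}.
Hypothesis mu0 : mu [set 0] = 0%E.
Hypothesis mu_even : even_measure mu.
Hypothesis mu_levy : levy_integrable mu.

(** This is min(|z|^2, 1), the weight whose integrability is equivalent to the Levy condition. *)
Definition levy_weight (z : V) : R := if enorm z <= 1 then enorm z ^+ 2 else 1.

Lemma levy_weight_ge0 z : 0 <= levy_weight z.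
Proof. by rewrite /levy_weight; case: ifP => _; rewrite ?sqr_ge0. Qed.

Lemma measurable_levy_weight : measurable_fun setT levy_weight.
Proof.
apply: measurable_fun_ifT => //.
- by apply: measurable_fun_ler => //; exact: measurable_enorm.
- by apply: measurable_funX; exact: measurable_enorm.
Qed.

Lemma levy_weight_fin : (\int[mu]_z (levy_weight z)%:E < +oo)%E.
Proof.
apply: le_lt_trans mu_levy.
have m1 : measurable [set z : V | (1 < enorm z)%R] by exact: measurable_ball_enorm.
have m2 : measurable [set z : V | z != 0%R /\ (enorm z <= 1)%R].
  rewrite (_ : [set _ | _] = [set z | 0 < enorm z] `\` [set z | 1 < enorm z]).
    by apply: measurableD => //; exact: measurable_ball_enorm.
  by apply/seteqP; split => z /=; rewrite enorm_gt0 leNgt => -[? /negP]; split => //; exact/negP.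
rewrite [X in (_ <= X + _)%E]integral_mkcond [X in (_ <= _ + X)%E]integral_mkcond -ge0_integralD//.
- apply: ge0_le_integral => //.
  + by move=> z _; rewrite lee_fin levy_weight_ge0.
  + by apply/measurable_EFinP; exact: measurable_levy_weight.
  + apply: emeasurable_funD.
    * apply/(measurable_restrictT _ _).1 => //; apply/measurable_EFinP.
      by apply: measurable_funTS; apply: measurable_funX; exact: measurable_enorm.
    * by apply/(measurable_restrictT _ _).1.
  + move=> z _; rewrite /levy_weight /patch/=.
    have [z1|z1] := leP (enorm z) 1.
      rewrite [in X in (_ <= _ + X)%E]memNset; last by rewrite /= ltNge z1.
      rewrite adde0; case: ifPn => // /negP; rewrite inE/= => h.
      have [->|z0] := eqVneq z 0; first by rewrite enorm0 expr0n.
      by exfalso; apply: h.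
    by rewrite (@mem_set _ [set z0 : V | 1 < enorm z0])// leeDr//; case: ifP => // _; rewrite lee_fin sqr_ge0.
- by move=> z _; apply: erestrict_ge0 => // w _; rewrite lee_fin sqr_ge0.
- apply/(measurable_restrictT _ _).1 => //; apply/measurable_EFinP.
  by apply: measurable_funTS; apply: measurable_funX; exact: measurable_enorm.
- by move=> z _; apply: erestrict_ge0 => // w _; rewrite lee_fin.
- by apply/(measurable_restrictT _ _).1.
Qed.

Lemma integrable_levy_weight : mu.-integrable setT (EFin \o levy_weight).
Proof.
apply/integrableP; split; first by apply/measurable_EFinP; exact: measurable_levy_weight.
rewrite (eq_integral (fun z => (levy_weight z)%:E)); first exact: levy_weight_fin.
by move=> z _; rewrite /= ger0_norm// levy_weight_ge0.
Qed.

(** The threshold 1/(k+1) makes [far 0] the region of large jumps |z| > 1; the sets increase to the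
    complement of the origin. *)
Definition far k : set V := [set z | k.+1%:R^-1 < enorm z].

Lemma measurable_far k : measurable (far k).
Proof. exact: measurable_ball_enorm. Qed.

(** Chebyshev's inequality: on [far k] the weight is at least (k+1)^-2. *)
Lemma far_lty k : (mu (far k) < +oo)%E.
Proof.
pose a : R := (k.+1%:R^-1) ^+ 2.
have k0 : 0 < k.+1%:R^-1 :> R by rewrite invr_gt0.
have a0 : 0 < a by rewrite exprn_gt0.
have : (a%:E * mu (far k) < +oo)%E.
  apply: le_lt_trans levy_weight_fin.
  rewrite -integral_cst; last exact: measurable_far.
  rewrite integral_mkcond; apply: ge0_le_integral => //.
  - by move=> z _; apply: erestrict_ge0 => // w _; rewrite lee_fin ltW.
  - by apply/(measurable_restrictT _ _).1 => //; exact: measurable_far.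
  - by apply/measurable_EFinP; exact: measurable_levy_weight.
  - move=> z _; rewrite /patch; case: ifPn => [|_]; last by rewrite lee_fin levy_weight_ge0.
    rewrite inE/= /far/= lee_fin /levy_weight => kz.
    case: ifPn => _; first by rewrite lerXn2r ?nnegrE// ltW// (lt_trans k0).
    by rewrite /a exprn_ile1 ?(ltW k0)// invf_cp1 ?ler1n.
by apply: contraTT; rewrite -leNgt leye_eq => /eqP ->; rewrite gt0_muley// ltxx.
Qed.

Definition trunc k : {finite_measure set V -> \bar R} := mfrestr (measurable_far k) (far_lty k).

Lemma Rintegral_trunc k (f : V -> R) : measurable_fun setT f ->
  \int[trunc k]_z f z = \int[mu]_(z in far k) f z.
Proof. by move=> mf; rewrite /Rintegral integral_mfrestr//; exact/measurable_EFinP. Qed.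

Lemma preimage_opp (A : set V) : -%R @^-1` A = [set - z | z in A].
Proof.
apply/seteqP; split=> [z Az|_ [z Az <-]]; last by rewrite /= opprK.
by exists (- z) => //; rewrite opprK.
Qed.

Lemma mu_preimage_opp (A : set V) : measurable A -> mu (-%R @^-1` A) = mu A.
Proof. by move=> mA; rewrite preimage_opp -mu_even. Qed.

Lemma trunc_even k (A : set V) : measurable A -> trunc k (-%R @^-1` A) = trunc k A.
Proof.
move=> mA; rewrite /trunc -[LHS]/(mu ((-%R @^-1` A) `&` far k)) -[RHS]/(mu (A `&` far k)).
rewrite -[RHS]mu_preimage_opp; last by apply: measurableI => //; exact: measurable_far.
rewrite preimage_setI; congr (mu (_ `&` _)).
by apply/seteqP; split=> z /=; rewrite /far/= enormN.
Qed.

(** Covers by the null origin and the sets [far k]. It gives access to Tonelli in (x, z) for the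
    untruncated measure in the energy bound. *)
Lemma sigma_finite_levy : sigma_finite setT mu.
Proof.
exists (fun k => if k is k'.+1 then far k' else [set 0]).
  apply/seteqP; split=> // z _; have [->|z0] := eqVneq z 0; first by exists 0%N.
  have e0 : 0 < enorm z by rewrite enorm_gt0.
  have [k _ /(_ k (leqnn k)) kz] := @near_infty_natSinv_lt R (PosNum e0).
  by exists k.+1.
case=> [|k]; split.
- exact: measurable_set1V.
- by rewrite mu0.
- exact: measurable_far.
- exact: far_lty.
Qed.

End levy_measure.

(** * Truncated operators on test functions *)

Section real_dominated_convergence.
Context d (X : measurableType d) (R : realType).
Variables (m : {measure set X -> \bar R}) (D : set X).
Hypothesis mD : measurable D.

Lemma Rintegral_dominated (f_ : nat -> X -> R) (f g : X -> R) :
  (forall n, measurable_fun D (f_ n)) -> measurable_fun D f ->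
  {ae m, forall x, D x -> f_ ^~ x @ \oo --> f x} -> m.-integrable D (EFin \o g) ->
  (forall n x, D x -> `|f_ n x| <= g x) ->
  m.-integrable D (EFin \o f) /\
  \int[m]_(x in D) f_ n x @[n --> \oo] --> \int[m]_(x in D) f x.
Proof.
move=> mf_ mf cf ig fg.
have [||||fi _ cfi] := @dominated_convergence _ _ _ m D mD
  (fun n => EFin \o f_ n) (EFin \o f) (EFin \o g) _ _ _ ig _.
- by move=> n; exact/measurable_EFinP.
- exact/measurable_EFinP.
- by apply: filterS cf => x cx Dx; apply/cvg_EFin; [exact: nearW|exact: cx].
- by apply: aeW => x n Dx; rewrite lee_fin fg.
split=> //; apply: fine_cvg.
by rewrite fineK//; exact: (integrable_fin_num mD fi).
Qed.

End real_dominated_convergence.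

Section test_functions.
Context (R : realType) (N : nat).
Local Notation V := 'rV[R]_N.
Local Notation leb := (@lebesgue_rV R N).
Variable mu : {measure set V -> \bar R}.
Hypothesis mu0 : mu [set 0] = 0%E.
Hypothesis mu_even : even_measure mu.
Hypothesis mu_levy : levy_integrable mu.
Local Notation trunc := (trunc mu_levy).

(** The symmetric second difference: first-order terms cancel, so it is quadratic near z = 0 without
    any compensator. *)
Definition sdiff (psi : V -> R) (x z : V) := psi (x + z) + psi (x - z) - 2 * psi x.

(** One class for the time slices of test functions and for the mollifiers, which have only bounded
    second differences. The constants are parameters so that bounds can be uniform over a family of
    functions. *)
Definition tame (C C0 r : R) (psi : V -> R) :=
  [/\ [/\ 0 <= C, 0 <= C0 & 0 <= r], measurable_fun setT psi,
      forall x, `|psi x| <= C0 * \1_(cube r) x &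
      forall x z, `|sdiff psi x z| <= C * enorm z ^+ 2].

Section tame_fun.
Variables (C C0 r : R) (psi : V -> R).
Hypothesis psi_tame : tame C C0 r psi.

Lemma tame_bounded x : `|psi x| <= C0.
Proof.
have [[_ C00 _] _ h _] := psi_tame; apply: le_trans (h x) _.
by rewrite ler_piMr// indicE; case: (_ \in _).
Qed.

Lemma tame_measurable : measurable_fun setT psi. Proof. by case: psi_tame. Qed.

Lemma integrable_cube_indic s : leb.-integrable setT (EFin \o (\1_(@cube R N s) : V -> R)).
Proof.
have mc := @measurable_cube R N s.
apply: integrable_L1; first exact: measurable_indic.
rewrite (eq_integral (fun x => (\1_(cube s) x)%:E)).
  by rewrite integral_indic// setIT lebesgue_cube_lty.
by move=> x _; rewrite ger0_norm.
Qed.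

Lemma tame_integrable : leb.-integrable setT (EFin \o psi).
Proof.
have [_ mpsi h _] := psi_tame.
have := integrableZl measurableT C0 (integrable_cube_indic r).
apply: le_integrable => //; first exact/measurable_EFinP.
by move=> x _; rewrite /= lee_fin (le_trans (h x))// ler_norm.
Qed.

Lemma measurable_sdiff x : measurable_fun setT (sdiff psi x).
Proof.
have mpsi := tame_measurable.
apply: measurable_funB => //; apply: measurable_funD; first exact: measurable_shiftl.
apply: (measurableT_comp mpsi); apply: measurable_fun_addrV => //.
by apply: measurable_fun_opprV; exact: measurable_id.
Qed.

Lemma sdiff_le_weight x z : `|sdiff psi x z| <= (C + 4 * C0) * levy_weight z.
Proof.
have [[C1 C00 _] _ _ h] := psi_tame.
rewrite /levy_weight; case: ifPn => z1.
  by rewrite (le_trans (h x z))// ler_wpM2r ?sqr_ge0// lerDl mulr_ge0.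
have b := tame_bounded; rewrite mulr1.
have : `|sdiff psi x z| <= `|psi (x + z)| + `|psi (x - z)| + 2 * `|psi x|.
  rewrite (le_trans (ler_normB _ _))// lerD ?ler_normD// normrM ger0_norm//.
have := b (x + z); have := b (x - z); have := b x; lra.
Qed.

(** The average over z equals the average over -z for an even measure; half their sum is the
    symmetric form. *)
Lemma levyf_half k x : levyf (trunc k) psi x = 2^-1 * \int[trunc k]_z sdiff psi x z.
Proof.
have [_ mpsi _ _] := psi_tame; have b := tame_bounded.
have i1 := integrable_shift (trunc k) x mpsi b.
have i2 : (trunc k).-integrable setT (EFin \o (fun z => psi (x - z))).
  apply: (@bounded_integrable _ _ R (trunc k) _ C0) => //.
  apply: (measurableT_comp mpsi); apply: measurable_fun_addrV => //.
  by apply: measurable_fun_opprV; exact: measurable_id.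
rewrite /sdiff RintegralB//; last 2 first.
- by have := integrableD measurableT i1 i2; apply: eq_integrable.
- exact: finite_measure_integrable_cst.
rewrite RintegralD// (avg_opp (trunc_even mu_even mu_levy k) x mpsi) Rintegral_cst//.
rewrite -/(mass (trunc k)) /levyf /avg; by field.
Qed.

(** A majorant independent of the truncation. Small jumps contribute only within distance 1 of the
    support; large jumps are not localised, but form a measure of finite mass, whose average of an
    indicator is still integrable. *)
Definition levy_dom (C C0 r : R) (x : V) : R :=
  C * (\int[mu]_z levy_weight z) * \1_(cube (r + 1)) x +
  C0 * (avg (trunc 0) \1_(cube r) x + mass (trunc 0) * \1_(cube r) x).

Lemma cube_shift (x z : V) : enorm z <= 1 -> ~ cube (r + 1) x -> ~ cube r (x + z).
Proof.
move=> z1 xr xz; apply: xr => i; rewrite -[x ord0 i](addrK (z ord0 i)).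
rewrite (le_trans (ler_normB _ _))// lerD//; last exact: le_trans (coord_le_enorm z i) z1.
by have := xz i; rewrite mxE.
Qed.

(** Small jumps use the quadratic bound and vanish outside [cube (r + 1)]. For large jumps the three
    indicators are kept instead of a constant, since a constant would not be integrable in x. *)
Lemma sdiff_le x z : `|sdiff psi x z| <= C * \1_(cube (r + 1)) x * levy_weight z +
  C0 * (\1_(cube r) (x + z) + \1_(cube r) (x - z) + 2 * \1_(cube r) x) * \1_(far 0) z.
Proof.
have [[C1 C00 r0] _ s h] := psi_tame.
have w0 := levy_weight_ge0 z.
have p1 : 0 <= C * \1_(cube (r + 1)) x * levy_weight z by rewrite !mulr_ge0.
have [z1|z1] := leP (enorm z) 1; last first.
  rewrite [\1_(far 0) z]indicE mem_set /far/= ?invr1// mulr1.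
  have : `|sdiff psi x z| <= `|psi (x + z)| + `|psi (x - z)| + 2 * `|psi x|.
    by rewrite (le_trans (ler_normB _ _))// lerD ?ler_normD// normrM ger0_norm.
  have := s (x + z); have := s (x - z); have := s x; rewrite !mulrDr; lra.
rewrite [\1_(far 0) z]indicE memNset /far/= ?invr1; last by apply/negP; rewrite -leNgt.
rewrite mulr0 addr0 [levy_weight z]/levy_weight z1.
have [xr|xr] := pselect (@cube R N (r + 1) x).
  by rewrite indicE mem_set// mulr1; exact: h.
suff -> : sdiff psi x z = 0 by rewrite normr0; apply: mulr_ge0; [exact: mulr_ge0|exact: sqr_ge0].
have zr (y : V) : ~ cube r y -> psi y = 0.
  by move=> yr; apply/normr0_eq0/le_anti; rewrite normr_ge0 (le_trans (s y))// indicE memNset// mulr0.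
rewrite /sdiff !zr ?mulr0 ?subr0 ?addr0//.
- by move=> xr'; apply: xr => i; rewrite (le_trans (xr' i))// lerDl.
- by apply: cube_shift xr; rewrite enormN.
- exact: cube_shift xr.
Qed.

Lemma levyf_dom k x : `|levyf (trunc k) psi x| <= levy_dom C C0 r x.
Proof.
have [[C1 C00 r0] mpsi s h] := psi_tame.
have ms := measurable_sdiff x.
have msk k' : (trunc k').-integrable setT (EFin \o sdiff psi x).
  apply: (@bounded_integrable _ _ R (trunc k') _ (4 * C0)) => // z.
  have : `|sdiff psi x z| <= `|psi (x + z)| + `|psi (x - z)| + 2 * `|psi x|.
    by rewrite (le_trans (ler_normB _ _))// lerD ?ler_normD// normrM ger0_norm.
  by have := tame_bounded (x + z); have := tame_bounded (x - z); have := tame_bounded x; lra.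
have mchi : measurable_fun setT (\1_(@cube R N r) : V -> R).
  by apply: measurable_indic; exact: measurable_cube.
have chi1 (y : V) : `|\1_(@cube R N r) y : R| <= 1.
  by rewrite indicE; case: (_ \in _); rewrite ?normr1 ?normr0.
pose p (z : V) : R := C0 * (\1_(cube r) (x + z) + \1_(cube r) (x - z) + 2 * \1_(cube r) x).
have mp : measurable_fun setT p.
  apply: measurable_funM => //; apply: measurable_funD => //; apply: measurable_funD.
    exact: measurable_shiftl.
  apply: (measurableT_comp mchi); apply: measurable_fun_addrV => //.
  by apply: measurable_fun_opprV; exact: measurable_id.
have p0 z : 0 <= p z by rewrite mulr_ge0// !addr_ge0// mulr_ge0.
pose c := C * \1_(cube (r + 1)) x.
have c0 : 0 <= c by rewrite mulr_ge0.
have ip : (trunc 0).-integrable setT (EFin \o p).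
  apply: (@bounded_integrable _ _ R (trunc 0) _ (C0 * 4)) => // z.
  rewrite ger0_norm// ler_wpM2l//.
  have := chi1 (x + z); have := chi1 (x - z); have := chi1 x.
  by rewrite !ger0_norm//; lra.
have E1 : (\int[mu]_z (c * levy_weight z + p z * \1_(far 0) z)%:E =
    (c * (\int[mu]_z levy_weight z) + \int[trunc 0]_z p z)%:E)%E.
  have mw := @measurable_levy_weight R N.
  have mf : measurable_fun setT (\1_(@far R N 0) : V -> R).
    by apply: measurable_indic; exact: measurable_far.
  under eq_integral do rewrite EFinD.
  rewrite ge0_integralD//; last 4 first.
  - by move=> z _; rewrite lee_fin mulr_ge0// levy_weight_ge0.
  - by apply/measurable_EFinP; exact: measurable_funM.
  - by move=> z _; rewrite lee_fin mulr_ge0.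
  - by apply/measurable_EFinP; exact: measurable_funM.
  rewrite EFinD; congr (_ + _)%E.
    under eq_integral do rewrite EFinM.
    rewrite integralZl//; last exact: integrable_levy_weight.
    rewrite [RHS]EFinM /Rintegral fineK//; exact: (integrable_fin_num measurableT (integrable_levy_weight mu_levy)).
  rewrite /Rintegral fineK; last exact: (integrable_fin_num measurableT ip).
  rewrite ge0_integral_mfrestr//; last exact/measurable_EFinP.
  rewrite [RHS]integral_mkcond; apply: eq_integral => z _; rewrite /patch indicE.
  by case: ifP => _; rewrite ?mulr1 ?mulr0.
have E2 : \int[trunc 0]_z p z = 2 * (C0 * (avg (trunc 0) \1_(cube r) x + mass (trunc 0) * \1_(cube r) x)).
  have i1 := integrable_shift (trunc 0) x mchi chi1.
  have i2 : (trunc 0).-integrable setT (EFin \o (fun z => (\1_(cube r) (x - z) : R))).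
    apply: (@bounded_integrable _ _ R (trunc 0) _ 1) => //.
    apply: (measurableT_comp mchi); apply: measurable_fun_addrV => //.
    by apply: measurable_fun_opprV; exact: measurable_id.
  have i12 := integrableD measurableT i1 i2.
  rewrite /p RintegralZl//; last first.
    have := integrableD measurableT i12 (finite_measure_integrable_cst (trunc 0) (2 * \1_(cube r) x) measurableT).
    by apply: eq_integrable.
  rewrite RintegralD//; last exact: finite_measure_integrable_cst.
  rewrite RintegralD// (avg_opp (trunc_even mu_even mu_levy 0) x mchi) Rintegral_cst//.
  rewrite -/(mass (trunc 0)) -/(avg (trunc 0) _ x); ring.
(* Restricting to [far k] only discards part of a nonnegative majorant, whence the uniformity in
   k. *)
have key : \int[trunc k]_z `|sdiff psi x z| <= c * (\int[mu]_z levy_weight z) + \int[trunc 0]_z p z.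
  rewrite -lee_fin -E1 /Rintegral fineK; last first.
    exact: (integrable_fin_num measurableT (integrable_norm (msk k))).
  rewrite ge0_integral_mfrestr//; last by apply/measurable_EFinP; exact: measurableT_comp.
  rewrite integral_mkcond; apply: ge0_le_integral => //.
  - by move=> z _; apply: erestrict_ge0 => // w _; rewrite lee_fin.
  - apply/(measurable_restrictT _ _).1; first exact: measurable_far.
    by apply: measurable_funTS; apply/measurable_EFinP; exact: measurableT_comp.
  - apply/measurable_EFinP; apply: measurable_funD; apply: measurable_funM => //.
      exact: measurable_levy_weight.
    by apply: measurable_indic; exact: measurable_far.
  - move=> z _; rewrite /patch; case: ifPn => _; first by rewrite lee_fin sdiff_le.
    by rewrite lee_fin addr_ge0 ?mulr_ge0 ?levy_weight_ge0.
rewrite levyf_half normrM ger0_norm// ler_pdivrMl//.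
apply: (le_trans (le_normr_Rintegral measurableT (msk k))); apply: (le_trans key).
have cW : 0 <= c * (\int[mu]_z levy_weight z).
  by rewrite mulr_ge0// Rintegral_ge0// => z _; exact: levy_weight_ge0.
rewrite E2 /levy_dom [C * _ * _]mulrAC -/c; lra.
Qed.

End tame_fun.

Lemma integrable_levy_dom C C0 r : leb.-integrable setT (EFin \o levy_dom C C0 r).
Proof.
have chi1 (y : V) : `|\1_(@cube R N r) y : R| <= 1.
  by rewrite indicE; case: (_ \in _); rewrite ?normr1 ?normr0.
have i1 := integrableZl measurableT (C * (\int[mu]_z levy_weight z)) (integrable_cube_indic (r + 1)).
have i2 := integrableZl measurableT (mass (trunc 0)) (integrable_cube_indic r).
have i3 := integrableD measurableT (integrable_avg (trunc 0) (integrable_cube_indic r) chi1) i2.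
have := integrableD measurableT i1 (integrableZl measurableT C0 i3).
by apply: eq_integrable.
Qed.

(** Adding the integrands at z and -z cancels the compensator, by evenness. The Taylor hypothesis
    makes the compensated integrand integrable, so that its integral may be reflected and the two
    added. *)
Lemma levy_op_half C C0 r C1 psi x : tame C C0 r psi ->
  (forall z, `|psi (x + z) - psi x - dotv z (gradient psi x)| <= C1 * enorm z ^+ 2) ->
  levy_op mu psi x = 2^-1 * \int[mu]_z sdiff psi x z.
Proof.
move=> tpsi h; have mpsi := tame_measurable tpsi.
pose f z := psi (x + z) - psi x - dotv z (gradient psi x) * \1_[set z : V | enorm z <= 1] z.
have m1 : measurable [set z : V | enorm z <= 1].
  rewrite (_ : [set _ | _] = ~` [set z | 1 < enorm z]).
    by apply: measurableC; exact: measurable_ball_enorm.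
  by apply/seteqP; split => z /=; rewrite leNgt => /negP.
have mf : measurable_fun setT f.
  apply: measurable_funB; first by apply: measurable_funB => //; exact: measurable_shiftl.
  apply: measurable_funM; last exact: measurable_indic.
  by apply: measurable_sum => i; apply: measurable_funM => //; exact: measurable_coord.
have f0 : f 0 = 0.
  by rewrite /f addr0 subrr /dotv big1 ?mul0r ?subr0// => i _; rewrite mxE mul0r.
have fw z : `|f z| <= (`|C1| + 2 * C0) * levy_weight z.
  have [[_ C00 _] _ _ _] := tpsi.
  rewrite /f indicE /levy_weight; case: ifPn => z1.
    rewrite mem_set// mulr1 (le_trans (h z))// ler_wpM2r ?sqr_ge0//.
    by rewrite (le_trans (ler_norm _))// lerDl mulr_ge0.
  rewrite memNset/=; last exact/negP.
  rewrite mulr0 subr0 mulr1 (le_trans (ler_normB _ _))//.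
  by have := tame_bounded tpsi (x + z); have := tame_bounded tpsi x; have := normr_ge0 C1; lra.
have intf : mu.-integrable setT (EFin \o f).
  have := integrableZl measurableT (`|C1| + 2 * C0) (integrable_levy_weight mu_levy).
  apply: le_integrable => //; first exact/measurable_EFinP.
  by move=> z _; rewrite /= lee_fin (le_trans (fw z))// ler_norm.
(* The excluded origin can be restored because the integrand is 0 there. *)
rewrite /levy_op Rintegral_mkcond -/f (_ : f \_ _ = f); last first.
  apply/funext => z; rewrite /patch; case: ifPn => // /negP; rewrite inE/= => hz.
  by have -> : z = 0 by apply: contrapT.
have mo : measurable_fun setT (-%R : V -> V) by apply: measurable_fun_opprV; exact: measurable_id.
have fN : \int[mu]_z f (- z) = \int[mu]_z f z.
  rewrite /Rintegral; congr fine.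
  apply: (integral_preserving mo (mu_preimage_opp mu_even) (f := EFin \o f)).
  exact/measurable_EFinP.
have intfN : mu.-integrable setT (EFin \o (fun z => f (- z))).
  apply/integrableP; split; first by apply/measurable_EFinP; exact: measurableT_comp.
  have /integrableP[_] := intf; apply: le_lt_trans; rewrite le_eqVlt; apply/orP; left; apply/eqP.
  apply: (integral_preserving mo (mu_preimage_opp mu_even) (f := fun z => `|(f z)%:E|%E)).
  by apply: measurableT_comp => //; exact/measurable_EFinP.
have -> : \int[mu]_z sdiff psi x z = \int[mu]_z (f z + f (- z)).
  apply: eq_Rintegral => z _; rewrite /sdiff /f !indicE.
  rewrite (_ : (- z \in _) = (z \in [set z : V | enorm z <= 1])); last first.
    by apply/idP/idP; rewrite !inE/= enormN.
  rewrite (_ : dotv (- z) _ = - dotv z (gradient psi x)); last first.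
    by rewrite /dotv -sumrN; apply: eq_bigr => i _; rewrite mxE mulNr.
  ring.
rewrite RintegralD// fN; by field.
Qed.

(** The function varies together with the truncation because, in the scheme, the test function is
    taken at a grid time that depends on the index. The common [tame] constants give a majorant by a
    multiple of [levy_weight]. *)
Lemma levy_op_cvg C C0 r C1 (psi_ : nat -> V -> R) psi (k : nat -> nat) x :
  (forall n, tame C C0 r (psi_ n)) -> tame C C0 r psi ->
  (forall y, psi_ ^~ y @ \oo --> psi y) -> (forall n, (n <= k n)%N) ->
  (forall z, `|psi (x + z) - psi x - dotv z (gradient psi x)| <= C1 * enorm z ^+ 2) ->
  levyf (trunc (k n)) (psi_ n) x @[n --> \oo] --> levy_op mu psi x.
Proof.
move=> t_ t cpsi kn h; rewrite (levy_op_half t h).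
under eq_fun do rewrite (levyf_half (t_ _)).
apply: cvgM; first exact: cvg_cst.
have E n : \int[trunc (k n)]_z sdiff (psi_ n) x z = \int[mu]_z (sdiff (psi_ n) x \_ (far (k n))) z.
  by rewrite (Rintegral_trunc mu_levy (k n) (measurable_sdiff (t_ n) x)) Rintegral_mkcond.
under eq_fun do rewrite E.
apply: (Rintegral_dominated measurableT _ _ _ (g := fun z => (C + 4 * C0) * levy_weight z) _ _).2.
- move=> n; apply/(measurable_restrictT _ _).1; first exact: measurable_far.
  by apply: measurable_funTS; exact: measurable_sdiff (t_ n) x.
- exact: measurable_sdiff t x.
- apply: aeW => z _.
  (* The origin lies in no [far k], but the second difference vanishes there; any other z is
     eventually in [far (k n)]. *)
  have [->|z0] := eqVneq z 0.
    rewrite (_ : sdiff psi x 0 = 0); last by rewrite /sdiff subr0 addr0; ring.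
    apply: cvg_near_cst; apply: nearW => n; rewrite /patch; case: ifP => // _.
    by rewrite /sdiff subr0 addr0; ring.
  apply: cvg_trans (_ : sdiff (psi_ n) x z @[n --> \oo] --> sdiff psi x z); last first.
    by apply: cvgB; [apply: cvgD; exact: cpsi|apply: cvgM; [exact: cvg_cst|exact: cpsi]].
  apply: near_eq_cvg; have e0 : 0 < enorm z by rewrite enorm_gt0.
  have := @near_infty_natSinv_lt R (PosNum e0); apply: filterS => n /= nz.
  rewrite /patch mem_set// /far/=; apply: le_lt_trans nz.
  by rewrite lef_pV2 ?posrE// ler_nat ltnS.
- have := integrableZl measurableT (C + 4 * C0) (integrable_levy_weight mu_levy).
  by apply: eq_integrable.
- move=> n z _; rewrite /patch; case: ifP => _; first exact: sdiff_le_weight (t_ n) x z.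
  have [[C2 C00 _] _ _ _] := t.
  by rewrite normr0 mulr_ge0 ?levy_weight_ge0// addr_ge0// mulr_ge0.
Qed.

End test_functions.

(** * Smooth test functions *)

Section directional_derivatives.
Context (R : realType) (W : normedModType R).
Implicit Types (f : W -> R) (x y v w : W).

Lemma is_derive_line f x w (s : R) : derivable f (x + s *: w) w ->
  is_derive s 1 (fun t : R => f (x + t *: w)) ('D_w f (x + s *: w)).
Proof.
move=> df; have E : (fun h : R => h^-1 *: (((fun t : R => f (x + t *: w)) \o shift s) (h *: 1) - f (x + s *: w)))
   = (fun h => h^-1 *: ((f \o shift (x + s *: w)) (h *: w) - f (x + s *: w))).
  apply/funext => h /=; congr (h^-1 *: (f _ - _)).
  by rewrite [h *: 1]mulr1 scalerDl addrCA.
apply: DeriveDef; first by rewrite /derivable E.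
by rewrite /derive E.
Qed.

Lemma mvt_line f x w : (forall y, derivable f y w) ->
  exists2 s : R, 0 < s < 1 & f (x + w) - f x = 'D_w f (x + s *: w).
Proof.
move=> df; have fd (s : R) := is_derive_line (df (x + s *: w)).
have fc : {within `[0, 1], continuous (fun t : R => f (x + t *: w))}.
  by apply: derivable_within_continuous => s _; apply: ex_derive.
have [s s01] := @MVT R _ (fun t : R => 'D_w f (x + t *: w)) 0 1 ltr01 (fun s _ => fd s) fc.
rewrite scale1r scale0r addr0 subr0 mulr1 => ->.
by exists s => //; move: s01; rewrite in_itv.
Qed.

Lemma derive_scale f x (c : R) w : derivable f x w -> derivable f x (c *: w) ->
  'D_(c *: w) f x = c * 'D_w f x.
Proof.
move=> df dcf.
have d1 : is_derive (0 : R) 1 (fun t : R => f (x + t *: (c *: w))) ('D_(c *: w) f x).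
  by have := @is_derive_line f x (c *: w) 0; rewrite scale0r addr0; exact.
have d2 : is_derive (c * 0) (1 : R) (fun t : R => f (x + t *: w)) ('D_w f x).
  by have := @is_derive_line f x w 0; rewrite mulr0 scale0r addr0; exact.
have d3 : is_derive (0 : R) (1 : R) (fun t : R => c * t) c.
  by apply: is_derive_eq; rewrite [c *: 1]mulr1.
have := @is_derive1_comp R (fun t : R => f (x + t *: w)) (fun t : R => c * t) 0 _ _ d2 d3.
rewrite (_ : _ \o _ = (fun t : R => f (x + t *: (c *: w)))); last first.
  by apply/funext => t /=; rewrite scalerA mulrC.
by move=> d4; rewrite -(@derive_val _ _ _ _ _ _ _ d1) (@derive_val _ _ _ _ _ _ _ d4) mulrC.
Qed.

(** [smooth] speaks of directional derivatives only, so linearity in the direction has to be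
    derived; continuity of the derivatives is what makes it true. *)
Lemma derive_add f x v w : (forall u y, derivable f y u) -> (forall u, continuous ('D_u f)) ->
  'D_(v + w) f x = 'D_v f x + 'D_w f x.
Proof.
move=> df cf; rewrite {1}/derive; apply: cvg_lim => //.
pose q u (h : R) := h^-1 *: ((f \o shift x) (h *: u) - f x).
have qv : q v h @[h --> 0^'] --> 'D_v f x by exact: df.
(* The increment goes along v from x, then along w from [h *: v + x]; the second leg is a derivative
   in direction w at a point close to x, by the mean value theorem. *)
rewrite (_ : (fun h => _) = (fun h => q v h + h^-1 *: (f ((h *: v + x) + h *: w) - f (h *: v + x)))); last first.
  apply/funext => h; rewrite /q /= -scalerDr; congr (_ *: _).
  by rewrite scalerDr [in LHS]addrAC; ring.
apply: cvgD => //; apply/cvgrPdist_lt => e e0.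
have /cvgrPdist_lt/(_ _ e0)/nbhs_ballP[d /= d0 hd] := cf w x.
have vw0 : 0 < `|v| + `|w| + 1 by rewrite ltr_wpDl// addr_ge0.
near=> h.
have h0 : h != 0 by near: h; exact: nbhs_dnbhs_neq.
have [s /andP[s0 s1] ->] := mvt_line (h *: v + x) (df (h *: w)).
rewrite derive_scale// [h^-1 *: _]mulrA mulVf// mul1r; apply: hd.
rewrite -ball_normE/= (addrC (h *: v)) -addrA opprD addNKr normrN scalerA.
rewrite (le_lt_trans (ler_normD _ _))// !normrZ.
have hs : `|s| * `|h| * `|w| <= `|h| * `|w|.
  by rewrite ler_wpM2r// ler_piMl// ger0_norm ltW.
apply: (@le_lt_trans _ _ (`|h| * (`|v| + `|w| + 1))).
  rewrite !mulrDr mulr1; move: hs (normr_ge0 h). lra.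
rewrite -ltr_pdivlMr//; near: h; apply: dnbhs0_lt.
by rewrite divr_gt0.
Unshelve. all: by end_near. Qed.

Lemma derive_lincomb n f x (c : 'I_n -> R) (v : 'I_n -> W) :
  (forall u y, derivable f y u) -> (forall u, continuous ('D_u f)) ->
  'D_(\sum_i c i *: v i) f x = \sum_i c i * 'D_(v i) f x.
Proof.
move=> df cf; apply: (big_rec2 (fun a b => 'D_a f x = b)) => [|i a b _ ih].
  by rewrite -(scale0r (0 : W)) derive_scale ?mul0r.
by rewrite derive_add// derive_scale// ih.
Qed.

Lemma taylor2 f x w B : (forall u y, derivable f y u) ->
  (forall u y, derivable ('D_w f) y u) ->
  (forall y, `|'D_w ('D_w f) y| <= B) -> `|f (x + w) - f x - 'D_w f x| <= B.
Proof.
move=> df ddf fB; have [s /andP[s0 s1] ->] := mvt_line x (df w).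
have [r _ ->] := mvt_line x (ddf (s *: w)).
rewrite derive_scale// normrM (ger0_norm (ltW s0)).
apply: (le_trans _ (fB (x + r *: (s *: w)))).
by rewrite ler_piMl// ltW.
Qed.

End directional_derivatives.

(** * Uniform bounds for test functions and their derivatives *)

Section test_function_bounds.
Context (R : realType) (N : nat) (T : R).
Local Notation V := 'rV[R]_N.
Variable psi : V * R -> R.
Hypothesis psi_test : test_function T psi.

Let psi_smooth : smooth psi. Proof. by case: psi_test. Qed.

Lemma test_derivable u p : derivable psi p u.
Proof. by have [_ /(_ u)[h _]] := psi_smooth 1; exact: h. Qed.

Lemma test_continuous : continuous psi.
Proof. exact: psi_smooth 0%N. Qed.

Lemma test_derive_continuous u : continuous ('D_u psi).
Proof. by have [_ /(_ u)[_ h]] := psi_smooth 1; exact: h. Qed.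

Lemma test_derive_derivable v u p : derivable ('D_v psi) p u.
Proof. by have [_ /(_ v)[_ [_ /(_ u)[h _]]]] := psi_smooth 2; exact: h. Qed.

Lemma test_derive2_continuous v u : continuous ('D_u ('D_v psi)).
Proof. by have [_ /(_ v)[_ [_ /(_ u)[_ h]]]] := psi_smooth 2; exact: h. Qed.

Lemma derive_support (f : V * R -> R) (K : set (V * R)) u : closed K ->
  (forall p, ~ K p -> f p = 0) -> forall p, ~ K p -> 'D_u f p = 0.
Proof.
move=> cK f0 p Kp; rewrite /derive; apply: cvg_lim => //.
apply: cvg_near_cst.
have : \forall h \near (0 : R), ~ K (h *: u + p).
  have cu : h *: u + p @[h --> (0 : R)] --> 0 *: u + p.
    by apply: cvgD; [apply: cvgZl; exact: cvg_id|exact: cvg_cst].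
  rewrite scale0r add0r in cu.
  have oK : open (~` K) by exact: closed_openC.
  exact: (cu (~` K) (open_nbhs_nbhs (conj oK Kp))).
move=> /nbhs_dnbhs; apply: filterS => h hK /=.
by rewrite !f0// subrr scaler0.
Qed.

Lemma compact_support_bounded (f : V * R -> R) (K : set (V * R)) : compact K -> continuous f ->
  (forall p, ~ K p -> f p = 0) -> exists2 B, 0 <= B & forall p, `|f p| <= B.
Proof.
move=> cK cf f0.
have /compact_bounded[B [_ hB]] := @continuous_compact _ _ f K (continuous_subspaceT cf) cK.
have Bp : B < `|B| + 1 by rewrite (le_lt_trans (ler_norm B))// ltrDl.
exists (`|B| + 1); first by rewrite addr_ge0.
move=> p; have [Kp|Kp] := pselect (K p).
  by apply: (hB _ Bp); exists p.
by rewrite f0// normr0 addr_ge0.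
Qed.

Lemma test_support : exists2 r : R, 0 <= r & forall (x : V) t, ~ cube r x ->
  psi (x, t) = 0 /\ forall u, 'D_u psi (x, t) = 0.
Proof.
have [_ [K [cK _ K0]]] := psi_test.
have cK1 : compact (fst @` K).
  by apply: continuous_compact => //; apply: continuous_subspaceT => p; exact: cvg_fst.
have [j hj] := compact_sub_cube cK1.
exists j%:R => // x t xj; have Kx : ~ K (x, t) by move=> Kx; apply: xj; apply: hj; exists (x, t).
split; first exact: K0.
have clK : closed K by apply: compact_closed => //; exact: norm_hausdorff.
by move=> u; exact: (derive_support u clK K0 Kx).
Qed.

Lemma test_bounded : exists2 B, 0 <= B & forall p, `|psi p| <= B.
Proof.
by have [_ [K [cK _ K0]]] := psi_test; exact: (compact_support_bounded cK test_continuous K0).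
Qed.

Lemma test_derive_bounded u : exists2 B, 0 <= B & forall p, `|'D_u psi p| <= B.
Proof.
have [_ [K [cK _ K0]]] := psi_test.
apply: (compact_support_bounded cK); first exact: test_derive_continuous.
have clK : closed K by apply: compact_closed => //; exact: norm_hausdorff.
exact: (derive_support u clK K0).
Qed.

Lemma test_derive2_bounded v u : exists2 B, 0 <= B & forall p, `|'D_u ('D_v psi) p| <= B.
Proof.
have [_ [K [cK _ K0]]] := psi_test.
apply: (compact_support_bounded cK); first exact: test_derive2_continuous.
have clK : closed K by apply: compact_closed => //; exact: norm_hausdorff.
exact: (derive_support u clK (derive_support v clK K0)).
Qed.

Lemma pair_row_sum (z : V) : (z, 0 : R) = \sum_i z ord0 i *: (delta_mx ord0 i : V, 0 : R).
Proof.
have h (s : seq 'I_N) : \sum_(i <- s) z ord0 i *: (delta_mx ord0 i : V, 0 : R) =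
    (\sum_(i <- s) z ord0 i *: (delta_mx ord0 i : V), 0).
  elim: s => [|i s ih]; first by rewrite !big_nil.
  rewrite !big_cons ih; congr pair; exact: (etrans (addr0 _) (mulr0 _)).
by rewrite h -row_sum_delta.
Qed.

Lemma gradient_slice (x : V) t : gradient (fun x => psi (x, t)) x =
  \row_i 'D_(delta_mx ord0 i, 0 : R) psi (x, t).
Proof.
apply/rowP => i; rewrite !mxE /derive.
set d := (fun _ : R => _); set d' := (fun _ : R => _).
suff -> : d = d' by [].
rewrite {}/d {}/d'; apply/funext => h /=.
have -> // : h *: (delta_mx ord0 i, 0) + (x, t) = (h *: delta_mx ord0 i + x, t) :> V * R.
by congr pair; exact: (etrans (congr1 (+%R^~ t) (mulr0 h)) (add0r t)).
Qed.

(** A spatial increment is the direction (z, 0) in space-time. Expanding the second derivative in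
    coordinates gives as constant the sum of the global bounds of the mixed second derivatives,
    hence no dependence on x or t. *)
Lemma test_taylor : exists2 C, 0 <= C & forall (x z : V) t,
  `|psi (x + z, t) - psi (x, t) - dotv z (gradient (fun x => psi (x, t)) x)| <= C * enorm z ^+ 2.
Proof.
pose e i : V * R := (delta_mx ord0 i, 0).
have hB ij : exists B, 0 <= B /\ forall p, `|'D_(e ij.1) ('D_(e ij.2) psi) p| <= B.
  by have [B B0 hB] := test_derive2_bounded (e ij.2) (e ij.1); exists B.
have [B {}hB] := choice hB.
exists (\sum_i \sum_j B (i, j)).
  by apply: sumr_ge0 => i _; apply: sumr_ge0 => j _; have [] := hB (i, j).
move=> x z t.
have -> : dotv z (gradient (fun x => psi (x, t)) x) = 'D_(z, 0) psi (x, t).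
  rewrite pair_row_sum (derive_lincomb _ (fun i => z ord0 i) e test_derivable test_derive_continuous).
  by rewrite gradient_slice /dotv; apply: eq_bigr => i _; rewrite mxE.
have -> : (x + z, t) = (x, t) + (z, 0) by congr pair; rewrite /= addr0.
apply: taylor2.
- exact: test_derivable.
- by move=> u y; exact: test_derive_derivable.
move=> y; rewrite [in X in 'D_X _ _]pair_row_sum.
rewrite (derive_lincomb _ (fun i => z ord0 i) e (@test_derive_derivable (z, 0)) (@test_derive2_continuous (z, 0))).
have D1 : 'D_(z, 0) psi = \sum_(j < N) (z ord0 j \*: 'D_(e j) psi).
  apply/funext => p; rewrite pair_row_sum fct_sumE.
  exact: (derive_lincomb _ (fun i => z ord0 i) e test_derivable test_derive_continuous).
rewrite D1 mulr_suml (le_trans (ler_norm_sum _ _ _))//; apply: ler_sum => i _.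
rewrite derive_sum; last by move=> j; apply: derivableZ; exact: test_derive_derivable.
rewrite mulr_sumr mulr_suml (le_trans (ler_norm_sum _ _ _))//; apply: ler_sum => j _.
rewrite deriveZ; last exact: test_derive_derivable.
have [B0 /(_ y) hb] := hB (i, j).
rewrite [_ *: _]/GRing.scale/= mulrA normrM mulrC ler_pM// normrM expr2.
by rewrite ler_pM// coord_le_enorm.
Qed.

Lemma test_tame : exists C C0 r, (forall t, tame C C0 r (fun x => psi (x, t))) /\
  (forall (x z : V) t, `|psi (x + z, t) - psi (x, t) -
     dotv z (gradient (fun x => psi (x, t)) x)| <= C * enorm z ^+ 2).
Proof.
have [C C_ge0 hC] := test_taylor.
have [B B0 hB] := test_bounded.
have [r r0 hr] := test_support.
(* The second difference is the sum of the Taylor remainders at z and -z. *)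
exists (C + C), B, r; split; last first.
  by move=> x z t; rewrite (le_trans (hC x z t))// ler_wpM2r ?sqr_ge0// lerDl.
move=> t; split.
- by rewrite addr_ge0.
- apply: continuous_measurable_rV => x; apply: (@continuous_comp _ _ _ (fun y : V => (y, t)) psi).
    by apply: (@cvg_pair _ _ _ (nbhs x) (nbhs x) (nbhs t) _ _ _ id (cst t)); [exact: cvg_id|exact: cvg_cst].
  exact: test_continuous.
- move=> x; rewrite indicE; have [xr|xr] := pselect (cube r x); first by rewrite mem_set// mulr1.
  by rewrite memNset// mulr0 (hr x t xr).1 normr0.
- move=> x z; rewrite /sdiff.
  have := hC x z t; have := hC x (- z) t; rewrite enormN.
  have -> : dotv (- z) (gradient (fun x => psi (x, t)) x) = - dotv z (gradient (fun x => psi (x, t)) x).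
    by rewrite /dotv -sumrN; apply: eq_bigr => i _; rewrite mxE mulNr.
  set g := dotv _ _ => h1 h2.
  rewrite (_ : _ - _ = (psi (x + z, t) - psi (x, t) - g) + (psi (x - z, t) - psi (x, t) - - g)); last by ring.
  by rewrite mulrDl (le_trans (ler_normD _ _))// lerD.
Qed.

Lemma time_derivativeE (x : V) t : derive1 (fun s => psi (x, s)) t = 'D_(0, 1) psi (x, t).
Proof.
rewrite derive1E /derive.
set d := (fun _ : R => _); set d' := (fun _ : R => _).
suff -> : d = d' by [].
rewrite {}/d {}/d'; apply/funext => h /=.
have -> // : h *: (0, 1) + (x, t) = (x, h *: (1 : R) + t) :> V * R.
by congr pair; exact: (etrans (congr1 (+%R^~ x) (scaler0 _ h)) (add0r x)).
Qed.

Lemma time_derivative_continuous :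
  continuous (fun p : V * R => derive1 (fun s => psi (p.1, s)) p.2).
Proof.
rewrite (_ : (fun p => _) = 'D_(0, 1) psi); first exact: test_derive_continuous.
by apply/funext => -[x t]; rewrite time_derivativeE.
Qed.

Lemma time_derivative_bounded : exists B r, [/\ 0 <= B, 0 <= r &
  forall (x : V) t, `|derive1 (fun s => psi (x, s)) t| <= B * \1_(cube r) x].
Proof.
have [B B0 hB] := test_derive_bounded (0, 1).
have [r r0 hr] := test_support.
exists B, r; split => // x t; rewrite time_derivativeE indicE.
have [xr|xr] := pselect (cube r x); first by rewrite mem_set// mulr1.
by rewrite memNset// mulr0 (hr x t xr).2 normr0.
Qed.

Lemma time_mvt (x : V) (a b : R) : a < b -> exists2 c, a < c < b &
  psi (x, b) - psi (x, a) = derive1 (fun s => psi (x, s)) c * (b - a).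
Proof.
move=> ab.
have dp (s : R) : is_derive s (1 : R) (fun s : R => psi (x, s)) (derive1 (fun s => psi (x, s)) s).
  have := @is_derive_line _ _ psi (x, 0) (0, 1) s.
  have E (r : R) : (x, 0) + r *: (0, 1) = (x, r) :> V * R.
    congr pair; first by rewrite /= scaler0 addr0.
    exact: (etrans (add0r _) (mulr1 r)).
  rewrite E (_ : (fun t : R => psi ((x, 0) + t *: (0, 1))) = fun s => psi (x, s)); last first.
    by apply/funext => r; rewrite E.
  by rewrite time_derivativeE; apply; exact: test_derivable.
have fc : {within `[a, b], continuous (fun s => psi (x, s))}.
  by apply: derivable_within_continuous => s _; apply: ex_derive.
have [c] := MVT ab (fun s _ => dp s) fc.
by rewrite in_itv/= => cab ->; exists c.
Qed.

(** Removes the boundary term at the final time from the summation by parts. *)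
Lemma test_final (x : V) : psi (x, T) = 0.
Proof.
have [_ [K [_ KT K0]]] := psi_test; apply: K0 => /KT[_ /=].
by rewrite in_itv/= ltxx.
Qed.

End test_function_bounds.

(** * Mollifiers *)

Section mollifier.
Context (R : realType) (N : nat).
Local Notation V := 'rV[R]_N.
Local Notation leb := (@lebesgue_rV R N).

(** A profile with Lipschitz derivative that vanishes on the negative axis, which suffices for
    bounded second differences. *)
Definition pos_sqr (q : R) := (Num.max q 0) ^+ 2.

Lemma pos_sqr_ge0 q : 0 <= pos_sqr q. Proof. exact: sqr_ge0. Qed.

Lemma pos_sqr_le1 q : q <= 1 -> pos_sqr q <= 1.
Proof. by move=> q1; rewrite /pos_sqr exprn_ile1// ?le_max ?lexx ?orbT// ge_max q1/=. Qed.

(** Convexity on the left; on the right, the derivative 2 max(q, 0) has Lipschitz constant 2. *)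
Lemma pos_sqr_taylor q q' : 0 <= pos_sqr q' - pos_sqr q - 2 * Num.max q 0 * (q' - q) <= (q' - q) ^+ 2.
Proof.
have h1 := sqr_ge0 q; have h2 := sqr_ge0 q'; have h3 := sqr_ge0 (q' - q).
rewrite /pos_sqr; case: (leP q 0) => q0; case: (leP q' 0) => q0'.
- by rewrite expr0n/= mulr0 mul0r !subr0 lexx.
- have qq : q * q' <= 0 by nra.
  by rewrite expr0n/= mulr0 mul0r !subr0 h2/= sqrrB; nra.
- have qq : q * q' <= 0 by nra.
  by rewrite expr0n/=; apply/andP; split; nra.
- by apply/andP; split; nra.
Qed.

Variable dlt : R.
Hypothesis dlt0 : 0 < dlt.

Definition bump (x : V) := pos_sqr (1 - dotv x x / dlt ^+ 2).

Lemma bump_ge0 x : 0 <= bump x. Proof. exact: pos_sqr_ge0. Qed.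

Lemma bump_le1 x : bump x <= 1.
Proof. by apply: pos_sqr_le1; rewrite gerBl divr_ge0 ?dotv_ge0 ?sqr_ge0. Qed.

Lemma bump_support x : ~ cube dlt x -> bump x = 0.
Proof.
move=> h; rewrite /bump /pos_sqr (_ : Num.max _ _ = 0) ?expr0n//.
apply/max_idPr; rewrite subr_le0 ler_pdivlMr ?exprn_gt0// mul1r.
rewrite -enorm_sqr lerXn2r ?nnegrE ?enorm_ge0 ?ltW//.
rewrite ltNge; apply/negP => xd; apply: h => i; exact: le_trans (coord_le_enorm x i) xd.
Qed.

Lemma measurable_dotv : measurable_fun setT (fun x : V => dotv x x).
Proof.
by apply: measurable_sum => i; apply: measurable_funM; exact: measurable_coord.
Qed.

Lemma measurable_bump : measurable_fun setT bump.
Proof.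
apply: measurable_funX.
apply: (measurable_maxr (f := fun x : V => 1 - dotv x x / dlt ^+ 2) (g := cst 0)) => //.
by apply: measurable_funB => //; apply: measurable_funM => //; exact: measurable_dotv.
Qed.

Lemma dotvDD (x z : V) : dotv (x + z) (x + z) = dotv x x + 2 * dotv x z + dotv z z.
Proof.
rewrite /dotv mulr_sumr -!big_split/=; apply: eq_bigr => i _; rewrite mxE; ring.
Qed.

Lemma dotvN (x z : V) : dotv x (- z) = - dotv x z.
Proof. by rewrite /dotv -sumrN; apply: eq_bigr => i _; rewrite mxE mulrN. Qed.

Lemma dotvNN (z : V) : dotv (- z) (- z) = dotv z z.
Proof. by apply: eq_bigr => i _; rewrite mxE mulrNN. Qed.

Lemma dotv_cube_le (x z : V) s : cube s x -> `|dotv x z| <= N%:R * s * enorm z.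
Proof.
move=> xs; rewrite (le_trans (ler_norm_sum _ _ _))//.
apply: (@le_trans _ _ (\sum_(i < N) s * enorm z)); last first.
  by rewrite sumr_const card_ord -[leLHS]mulr_natl mulrA.
by apply: ler_sum => i _; rewrite normrM ler_pM// coord_le_enorm.
Qed.

(** Three regimes: |z| > dlt, where boundedness suffices; |z| <= dlt with x far from the support,
    where the difference is 0; and the rest, where [pos_sqr_taylor] is applied to the quadratic
    polynomial inside the bump. *)
Lemma sdiff_bump_le : exists2 C, 0 <= C & forall x z, `|sdiff bump x z| <= C * enorm z ^+ 2.
Proof.
pose d2 := (dlt ^+ 2)^-1.
have d20 : 0 < d2 by rewrite invr_gt0 exprn_gt0.
pose A : R := N%:R * (dlt + dlt).
have A0 : 0 <= A by rewrite mulr_ge0// addr_ge0// ltW.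
(* The square bounds the two Taylor remainders, as the inner increments are at most d2 (2 A + dlt)
   |z|. The term 4 d2 comes from the first-order parts, which add up to a multiple of |z|^2; it also
   covers |z| > dlt, since then 4 <= 4 d2 |z|^2. *)
exists (2 * (d2 * (2 * A + dlt)) ^+ 2 + 4 * d2).
  by rewrite addr_ge0// mulr_ge0 ?sqr_ge0// ltW.
move=> x z; set C := 2 * _ ^+ 2.
have C0 : 0 <= C by rewrite mulr_ge0// sqr_ge0.
have e0 := enorm_ge0 z.
have [zd|zd] := leP (enorm z) dlt; last first.
  apply: (@le_trans _ _ 4).
    have := bump_ge0 (x + z); have := bump_ge0 (x - z); have := bump_ge0 x.
    have := bump_le1 (x + z); have := bump_le1 (x - z); have := bump_le1 x.
    by rewrite /sdiff ler_norml => *; apply/andP; split; lra.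
  rewrite mulrDl (le_trans _ (_ : 4 * d2 * enorm z ^+ 2 <= _))//; last by rewrite lerDr mulr_ge0// sqr_ge0.
  rewrite -mulrA ler_peMr// mulrC ler_pdivlMr ?exprn_gt0// mul1r.
  by rewrite lerXn2r ?nnegrE// ltW.
have [xs|xs] := pselect (cube (dlt + dlt) x); last first.
  rewrite (_ : sdiff bump x z = 0).
    by rewrite normr0 mulr_ge0 ?sqr_ge0// addr_ge0// mulr_ge0// ltW.
  have zc i : `|z ord0 i| <= dlt by exact: le_trans (coord_le_enorm z i) zd.
  rewrite /sdiff !bump_support ?mulr0 ?subr0 ?addr0//.
  - by move=> xd; apply: xs => i; rewrite (le_trans (xd i))// lerDl ltW.
  - move=> xd; apply: xs => i; rewrite -[x ord0 i](subrK (z ord0 i)) (le_trans (ler_normD _ _))// lerD//.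
    by have := xd i; rewrite !mxE.
  - move=> xd; apply: xs => i; rewrite -[x ord0 i](addrK (z ord0 i)) (le_trans (ler_normB _ _))// lerD//.
    by have := xd i; rewrite !mxE.
have xz : `|dotv x z| <= A * enorm z by exact: dotv_cube_le.
rewrite /sdiff /bump.
have -> : 1 - dotv (x + z) (x + z) / dlt ^+ 2 =
  (1 - dotv x x / dlt ^+ 2) + (- d2 * (2 * dotv x z + enorm z ^+ 2)).
  by rewrite dotvDD enorm_sqr /d2; ring.
have -> : 1 - dotv (x - z) (x - z) / dlt ^+ 2 =
  (1 - dotv x x / dlt ^+ 2) + (- d2 * (2 * (- dotv x z) + enorm z ^+ 2)).
  by rewrite dotvDD dotvN dotvNN enorm_sqr /d2; ring.
set q := 1 - _; set a := - d2 * _; set b := - d2 * _.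
have q1 : Num.max q 0 <= 1.
  by rewrite ge_max ler01 andbT gerBl divr_ge0 ?dotv_ge0 ?sqr_ge0.
have q0 : 0 <= Num.max q 0 by rewrite le_max lexx orbT.
have := pos_sqr_taylor q (q + a); have := pos_sqr_taylor q (q + b).
rewrite ![q + _ - q]addrAC !subrr !add0r.
have ez : enorm z ^+ 2 <= dlt * enorm z by rewrite expr2 ler_wpM2r.
have sq (s : R) : `|s| <= d2 * (2 * A + dlt) * enorm z -> s ^+ 2 <= (d2 * (2 * A + dlt)) ^+ 2 * enorm z ^+ 2.
  move=> h; rewrite -exprMn -(ger0_norm (sqr_ge0 s)) normrX lerXn2r ?nnegrE//.
  exact: le_trans h.
have aux (s : R) : `|s| <= A * enorm z ->
    `|- d2 * (2 * s + enorm z ^+ 2)| <= d2 * (2 * A + dlt) * enorm z.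
  move=> sA; rewrite normrM normrN (ger0_norm (ltW d20)) -[leRHS]mulrA.
  apply: ler_wpM2l; first exact: ltW.
  apply: (le_trans (ler_normD _ _)).
  rewrite normrM (ger0_norm (sqr_ge0 _)) (@ger0_norm _ 2)// mulrDl; lra.
have a2 : a ^+ 2 <= (d2 * (2 * A + dlt)) ^+ 2 * enorm z ^+ 2 by exact/sq/aux.
have b2 : b ^+ 2 <= (d2 * (2 * A + dlt)) ^+ 2 * enorm z ^+ 2.
  by apply/sq/aux; rewrite normrN.
have ab : a + b = - (2 * d2 * enorm z ^+ 2) by rewrite /a /b; ring.
set m := Num.max q 0 in q0 q1 *.
move=> /andP[b3 b4] /andP[a3 a4].
have E : pos_sqr (q + a) + pos_sqr (q + b) - 2 * pos_sqr q =
  (pos_sqr (q + a) - pos_sqr q - 2 * m * a) + (pos_sqr (q + b) - pos_sqr q - 2 * m * b)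
   - m * (4 * d2 * enorm z ^+ 2).
  have -> : m * (4 * d2 * enorm z ^+ 2) = - (2 * m * (a + b)) by rewrite ab; ring.
  ring.
have p0 : 0 <= 4 * d2 * enorm z ^+ 2 by rewrite mulr_ge0 ?sqr_ge0// mulr_ge0// ltW.
have p1 : m * (4 * d2 * enorm z ^+ 2) <= 4 * d2 * enorm z ^+ 2 by rewrite ler_piMl.
have p2 : 0 <= m * (4 * d2 * enorm z ^+ 2) by rewrite mulr_ge0.
have p3 : C * enorm z ^+ 2 = 2 * ((d2 * (2 * A + dlt)) ^+ 2 * enorm z ^+ 2) by rewrite /C mulrA.
have p4 : 0 <= (d2 * (2 * A + dlt)) ^+ 2 * enorm z ^+ 2 by rewrite mulr_ge0// sqr_ge0.
rewrite E [leRHS]mulrDl p3 ler_norml; apply/andP; split; lra.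
Qed.

Lemma bump_tame : exists2 C, 0 <= C & tame C 1 dlt bump.
Proof.
have [C C0 hC] := sdiff_bump_le; exists C => //; split => //.
- by split=> //; exact: ltW.
- exact: measurable_bump.
- move=> x; rewrite ger0_norm ?bump_ge0// mul1r indicE.
  have [xd|xd] := pselect (cube dlt x); first by rewrite mem_set// bump_le1.
  by rewrite memNset// bump_support.
Qed.

Lemma bump_integral_gt0 : 0 < \int[leb]_x bump x.
Proof.
have [C C0 tb] := bump_tame.
(* Small enough that |x|^2 <= dlt^2 / 2 on the cube, where the bump is then at least 1/4; N + 1
   keeps the denominator nonzero. *)
pose s : R := dlt / (2 * N.+1%:R).
have s0 : 0 < s by rewrite divr_gt0// mulr_gt0.
have key x : cube s x -> 1 / 4 <= bump x.
  move=> xs.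
  have h : dotv x x / dlt ^+ 2 <= 1 / 2.
    rewrite ler_pdivrMr ?exprn_gt0//.
    apply: (@le_trans _ _ (\sum_(i < N) s ^+ 2)).
      apply: ler_sum => i _; rewrite -expr2 -(ger0_norm (sqr_ge0 (x ord0 i)))
        normrX lerXn2r ?nnegrE ?(ltW s0)//.
    rewrite sumr_const card_ord -[leLHS]mulr_natl /s expr_div_n mulrA mulrAC.
    rewrite ler_wpM2r ?sqr_ge0// ler_pdivrMr ?exprn_gt0 ?mulr_gt0// exprMn.
    have : (0 : R) <= N%:R by [].
    have -> : N.+1%:R = N%:R + 1 :> R by rewrite natr1.
    set n : R := N%:R => n0; nra.
  rewrite /bump /pos_sqr; set q := 1 - _; have q2 : 1 / 2 <= q by rewrite /q; lra.
  have -> : Num.max q 0 = q by apply/max_idPl; lra.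
  nra.
have mc := @measurable_cube R N s.
apply: (@lt_le_trans _ _ (\int[leb]_x (4^-1 * \1_(cube s) x))).
  rewrite RintegralZl//; last exact: integrable_cube_indic.
  rewrite mulr_gt0// /Rintegral (_ : (\int[leb]_x _)%E = (\prod_(i < N) (s + s))%:E); last first.
    by rewrite integral_indic// setIT; apply: lebesgue_cube; exact: ltW.
  by rewrite prodr_gt0// => i _; rewrite addr_gt0.
apply: le_Rintegral => //.
- by have := integrableZl measurableT 4^-1 (@integrable_cube_indic R N s); apply: eq_integrable.
- exact: tame_integrable tb.
- move=> x _; rewrite indicE; have [xs|xs] := pselect (cube s x).
    by rewrite mem_set// mulr1 -div1r key.
  by rewrite memNset// mulr0 bump_ge0.
Qed.

Lemma tameZ C C0 r c (psi : V -> R) : 0 <= c -> tame C C0 r psi ->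
  tame (c * C) (c * C0) r (fun x => c * psi x).
Proof.
move=> c0 [[? ? ?] mpsi h1 h2]; split=> //.
- by split=> //; rewrite mulr_ge0.
- exact: measurable_funM.
- by move=> x; rewrite normrM ger0_norm// -mulrA ler_wpM2l.
- move=> x z; rewrite (_ : sdiff _ _ _ = c * sdiff psi x z); last by rewrite /sdiff; ring.
  by rewrite normrM ger0_norm// -mulrA ler_wpM2l.
Qed.

Lemma mollifier_exists : exists omega C C0, [/\ tame C C0 dlt omega,
  forall x, 0 <= omega x & \int[leb]_x omega x = 1].
Proof.
have [C C_ge0 tb] := bump_tame; have I0 := bump_integral_gt0.
pose c := (\int[leb]_x bump x)^-1.
have c0 : 0 < c by rewrite invr_gt0.
exists (fun x => c * bump x), (c * C), (c * 1); split.
- exact: tameZ (ltW c0) tb.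
- by move=> x; rewrite mulr_ge0 ?bump_ge0// ltW.
- by rewrite RintegralZl//; [rewrite mulVf// gt_eqF|exact: tame_integrable tb].
Qed.

End mollifier.

(** * Compactness *)

Section compactness.
Context (R : realType) (N : nat).
Local Notation V := 'rV[R]_N.
Local Notation leb := (@lebesgue_rV R N).
Variables (w : nat -> R -> V -> R) (M T : R) (h : nat -> R).
Hypothesis mw : forall k t, measurable_fun setT (w k t).
Hypothesis wM : forall k t x, `|w k t x| <= M.

(** A correlation, that is, convolution with the reflected kernel; as a pairing of a translate of
    [w] with [omega] it is directly accessible to the weak form of the scheme. *)
Definition smear (omega : V -> R) k t x := \int[leb]_y (w k t (x + y) * omega y).

Hypothesis w_shift : forall e : R, 0 < e -> exists2 r : R, 0 < r & forall y : V, `|y| <= r ->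
  forall k t, (L1dist leb (fun x : V => w k t (x + y)%R) (w k t) <= e%:E)%E.
Hypothesis w_time : forall C C0 r omega, tame C C0 r omega -> exists2 B, 0 <= B &
  forall k s t x, 0 <= s -> 0 <= t -> `|smear omega k t x - smear omega k s x| <= B * (`|t - s| + h k).
Hypothesis h_cvg : h @ \oo --> (0 : R).

Section fixed_mollifier.
Variables (C C0 r : R) (omega : V -> R).
Hypothesis om_tame : tame C C0 r omega.

Lemma integrable_smear k t x : leb.-integrable setT (EFin \o (fun y => w k t (x + y) * omega y)).
Proof.
apply: (@integrable_boundedM R N (fun y => w k t (x + y)) omega M) => //.
  exact: measurable_shiftl.
exact: tame_integrable om_tame.
Qed.

Lemma measurable_smear k t : measurable_fun setT (smear omega k t).
Proof.
apply: (@measurable_fun_Rintegral _ _ _ _ R leb (fun p : V * V => w k t (p.1 + p.2) * omega p.2)).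
apply: measurable_funM; first exact: measurable_shift2.
exact: (measurableT_comp (tame_measurable om_tame) measurable_snd).
Qed.

(** Pairing against a kernel bounded by [C0] turns L^1 control of translations into a pointwise
    modulus of continuity. *)
Lemma smear_shift k t x x' e : 0 <= e ->
  (L1dist leb (fun y : V => w k t (y + (x - x'))%R) (w k t) <= e%:E)%E ->
  `|smear omega k t x - smear omega k t x'| <= C0 * e.
Proof.
move=> e0 he; have [[_ C00 _] mom _ _] := om_tame; have omb := tame_bounded om_tame.
have i1 := integrable_smear k t x; have i2 := integrable_smear k t x'.
have i3 : leb.-integrable setT (EFin \o (fun y => w k t (x + y) * omega y - w k t (x' + y) * omega y)).
  by have := integrableB measurableT i1 i2; apply: eq_integrable.
rewrite /smear -RintegralB// -lee_fin EFin_normr_Rintegral//.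
have mB : measurable_fun setT (fun y : V => `|w k t (x + y) - w k t (x' + y)|%:E).
  by apply: measurable_normB; exact: measurable_shiftl.
apply: (le_trans (le_abse_integral leb measurableT (measurable_int _ i3))).
apply: (@le_trans _ _ (\int[leb]_y (C0%:E * `|w k t (x + y) - w k t (x' + y)|%:E))%E).
  apply: ge0_le_integral => //.
  - by apply: measurableT_comp => //; exact: measurable_int i3.
  - exact: measurable_funeM.
  - move=> y _; rewrite -EFinM /= lee_fin -mulrBl normrM mulrC ler_wpM2r//.
rewrite ge0_integralZl// EFinM lee_wpmul2l ?lee_fin//.
rewrite -(@L1dist_shift R N _ _ x') in he => //; last exact: measurable_shift.
apply: le_trans he; rewrite le_eqVlt; apply/orP; left; apply/eqP.
apply: eq_integral => y _; congr (`|w k t _ - w k t _|%:E); last exact: addrC.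
by rewrite -addrA (addrC x') subrK addrC.
Qed.

Lemma smear_bounded k t x : `|smear omega k t x| <= M * \int[leb]_y `|omega y|.
Proof.
have io := tame_integrable om_tame; have iN := integrable_norm io.
rewrite (le_trans (le_normr_Rintegral measurableT (integrable_smear k t x)))//.
rewrite -RintegralZl//; apply: le_Rintegral => //.
- exact: (integrable_norm (integrable_smear k t x)).
- by have := integrableZl measurableT M iN; apply: eq_integrable.
- by move=> y _; rewrite normrM ler_wpM2r.
Qed.

Variable F : set_system nat.
Hypothesis FU : UltraFilter F.
Hypothesis Foo : \oo `<=` F.

(** The values stay in a compact interval, where an ultrafilter always has a limit. *)
Lemma smear_cauchy_pointwise t x e : 0 < e ->
  \forall kl \near (F, F), `|smear omega kl.1 t x - smear omega kl.2 t x| <= e.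
Proof.
move=> e0; pose s k := smear omega k t x; pose B := M * \int[leb]_y `|omega y|.
have FF : ProperFilter F by exact: ultra_proper.
(* The image of an ultrafilter is one: of a set and its complement, one has its preimage in [F]. *)
have UI : UltraFilter (s @ F).
  split; first exact: fmap_proper_filter.
  move=> G PG sG; apply/seteqP; split=> A; last exact: sG.
  move=> GA; have [//|FA] := in_ultra_setVsetC (s @^-1` A) FU.
  have GnA : G (~` A) by exact: sG.
  have GAA : G (A `&` ~` A) by exact: filterI.
  by exfalso; move: GAA; rewrite setICr; case: (PG) => + _; exact.
have cB : compact (`[- B, B]%classic : set R) by exact: segment_compact.
move: cB; rewrite compact_ultra => /(_ (s @ F) UI).
have FB : F (s @^-1` `[- B, B]%classic).
  have FT : F setT by exact: filterT.
  by apply: filterS FT => k _ /=; rewrite in_itv/= -ler_norml; exact: smear_bounded.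
move=> /(_ FB)[l [_ sl]].
have e2 : 0 < e / 2 by rewrite divr_gt0.
have : \forall k \near F, `|l - s k| <= e / 2 by exact: (@cvgr_dist_le _ _ _ F _ s l sl _ e2).
move=> hk; exists ([set k | `|l - s k| <= e / 2], [set k | `|l - s k| <= e / 2]) => //.
move=> [k k'] [/= h1 h2]; rewrite -/(s k) -/(s k').
rewrite (_ : s k - s k' = (l - s k') - (l - s k)); last by ring.
by rewrite (le_trans (ler_normB _ _))// [leRHS]splitr lerD.
Qed.

(** Pointwise convergence plus equicontinuity gives uniformity on a compact set, through its
    near-covering property. Equicontinuity in time holds up to [h k], which is small on a set of [F]
    because [F] refines the filter at infinity. *)
Lemma smear_cauchy j e : 0 < e ->
  \forall kl \near (F, F), forall x t, cube j%:R x -> 0 <= t <= T ->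
    `|smear omega kl.1 t x - smear omega kl.2 t x| <= e.
Proof.
move=> e0; have FF : ProperFilter F by exact: ultra_proper.
have [[_ C00 _] _ _ _] := om_tame.
have [B B0 hB] := w_time om_tame.
pose K : set (V * R) := cube j%:R `*` `[0, T].
have cK : compact K by apply: compact_setX; [exact: compact_cube|exact: segment_compact].
pose P (kl : nat * nat) (p : V * R) := 0 <= p.2 <= T ->
  `|smear omega kl.1 p.2 p.1 - smear omega kl.2 p.2 p.1| <= e.
suff : \forall kl \near (F, F), K `<=` P kl.
  apply: filterS => kl hP x t xj tT.
  by apply: (hP (x, t)) => //; split => //=; rewrite in_itv.
have [+ _] := compact_near_coveringP K => /(_ cK (nat * nat)%type (filter_prod F F) P); apply.
move=> -[x t] [/= xj]; rewrite in_itv/= => /andP[t0 tT].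
(* Budget: e/4 for each of two moves in space, e/6 for each of two moves in time and e/6 for the
   pointwise comparison. The added ones protect against [C0 = 0] and [B = 0]. *)
pose d := e / (4 * (C0 + 1)); pose d' := e / (12 * (B + 1)).
have C01 : 0 < C0 + 1 by rewrite ltr_wpDl.
have B1 : 0 < B + 1 by rewrite ltr_wpDl.
have d0 : 0 < d by rewrite divr_gt0// mulr_gt0.
have d'0 : 0 < d' by rewrite divr_gt0// mulr_gt0.
have [rho rho0 hrho] := w_shift d0.
have hh : \forall k \near F, `|h k| <= d'.
  have : \forall k \near \oo, `|0 - h k| <= d' by exact: (@cvgr_dist_le _ _ _ \oo _ h 0 h_cvg _ d'0).
  by move=> /Foo; apply: filterS => k; rewrite sub0r normrN.
have e6 : 0 < e / 6 by rewrite divr_gt0.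
have hp := smear_cauchy_pointwise t x e6.
have hkl : \forall kl \near (F, F), [/\ `|h kl.1| <= d', `|h kl.2| <= d' &
    `|smear omega kl.1 t x - smear omega kl.2 t x| <= e / 6].
  have hh2 : \forall kl \near (F, F), `|h kl.1| <= d' /\ `|h kl.2| <= d'.
    by exists ([set k | `|h k| <= d'], [set k | `|h k| <= d']).
  by move: hh2 hp; apply: filterS2 => kl [].
have hx : \forall p \near (x, t), `|p.1 - x| <= rho /\ `|p.2 - t| <= d'.
  exists ([set y : V | `|y - x| <= rho], [set s : R | `|s - t| <= d']) => /=.
    split.
      have : \forall y \near x, `|x - y| <= rho by exact: (@cvgr_dist_le _ _ _ (nbhs x) _ id x cvg_id _ rho0).
      by apply: filterS => y /=; rewrite distrC.
    have : \forall y \near t, `|t - y| <= d' by exact: (@cvgr_dist_le _ _ _ (nbhs t) _ id t cvg_id _ d'0).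
    by apply: filterS => y /=; rewrite distrC.
  by move=> [y s].
exists ([set p : V * R | `|p.1 - x| <= rho /\ `|p.2 - t| <= d'],
  [set kl : nat * nat | [/\ `|h kl.1| <= d', `|h kl.2| <= d' &
    `|smear omega kl.1 t x - smear omega kl.2 t x| <= e / 6]]) => //.
move=> [[y s] [k l]] [/= [yx st] [hk hl hkl']] /andP[/= s0 sT].
have sx k' : `|smear omega k' s y - smear omega k' s x| <= e / 4.
  apply: (le_trans (smear_shift (ltW d0) (hrho _ yx k' s))).
  rewrite /d; rewrite (_ : C0 * _ = (C0 / (C0 + 1)) * (e / 4)); last by field; rewrite gt_eqF.
  by rewrite ler_piMl// ?divr_ge0 ?(ltW e0)// ler_pdivrMr// mul1r lerDl.
have tx k' : `|h k'| <= d' -> `|smear omega k' s x - smear omega k' t x| <= e / 6.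
  move=> hk'; apply: (le_trans (hB _ _ _ _ t0 s0)).
  apply: (@le_trans _ _ (B * (d' + d'))).
    by rewrite ler_wpM2l// lerD// (le_trans (ler_norm _)).
  rewrite /d' (_ : B * _ = (B / (B + 1)) * (e / 6)); last by field; rewrite gt_eqF.
  by rewrite ler_piMl// ?divr_ge0 ?(ltW e0)// ler_pdivrMr// mul1r lerDl.
have := sx k; have := sx l; have := tx _ hk; have := tx _ hl; move: hkl'.
rewrite !ler_norml => /andP[? ?] /andP[? ?] /andP[? ?] /andP[? ?] /andP[? ?].
by apply/andP; split; lra.
Qed.

End fixed_mollifier.

(** Since [omega] has mass 1, the error is an average of increments over shifts in its support;
    Tonelli bounds it by the worst L^1 modulus of translation there. *)
Lemma mollification_error C C0 r omega e k t : tame C C0 r omega ->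
  (forall x, 0 <= omega x) -> \int[leb]_x omega x = 1 -> 0 <= e ->
  (forall y : V, cube r y -> (L1dist leb (fun x : V => w k t (x + y)%R) (w k t) <= e%:E)%E) ->
  (L1dist leb (w k t) (smear omega k t) <= e%:E)%E.
Proof.
move=> to o0 o1 e0 he; have io := tame_integrable to; have mo := tame_measurable to.
have [_ _ os _] := to.
pose G (p : V * V) := (`|w k t (p.1 + p.2) - w k t p.1| * omega p.2)%:E.
have mG : measurable_fun setT G.
  apply/measurable_EFinP; apply: measurable_funM; last exact: (measurableT_comp mo measurable_snd).
  apply: measurableT_comp => //; apply: measurable_funB; first exact: measurable_shift2.
  exact: (measurableT_comp (mw k t) measurable_fst).
have G0 p : (0 <= G p)%E by rewrite lee_fin mulr_ge0.
apply: (@le_trans _ _ (\int[leb]_x \int[leb]_y G (x, y))%E).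
  apply: ge0_le_integral => //.
  - by apply: measurable_normB => //; exact: measurable_smear to k t.
  - exact: measurable_fun_fubini_tonelli_F.
  - move=> x _; have is_ := integrable_smear to k t x.
    have ic : leb.-integrable setT (EFin \o (fun y => w k t x * omega y)).
      by have := integrableZl measurableT (w k t x) io; apply: eq_integrable.
    have iB : leb.-integrable setT (EFin \o (fun y => w k t (x + y) * omega y - w k t x * omega y)).
      by have := integrableB measurableT is_ ic; apply: eq_integrable.
    rewrite distrC /smear -[w k t x]mulr1 -o1 -RintegralZl// -RintegralB//.
    rewrite EFin_normr_Rintegral//.
    apply: (le_trans (le_abse_integral leb measurableT (measurable_int _ iB))).
    apply: ge0_le_integral => //.
    + by apply: measurableT_comp => //; exact: measurable_int iB.
    + exact: measurableT_comp mG (measurable_pair1 x).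
    + by move=> y _; rewrite /= lee_fin -mulrBl normrM [`|omega y|]ger0_norm.
rewrite (@fubini_tonelli _ _ _ _ _ leb leb G mG G0).
apply: (@le_trans _ _ (\int[leb]_y (e * omega y)%:E)%E); last first.
  under eq_integral do rewrite EFinM.
  rewrite integralZl// -[leRHS]mule1 lee_wpmul2l ?lee_fin//.
  by rewrite -[X in (_ <= X)%E]/(1%:E) -o1 /Rintegral fineK// integrable_fin_num.
apply: ge0_le_integral => //.
- by move=> y _; apply: integral_ge0.
- exact: (@measurable_fun_fubini_tonelli_G _ _ _ _ _ leb G).
- by apply/measurable_EFinP; exact: measurable_funM.
- move=> y _; rewrite /G /=.
  under eq_integral do rewrite EFinM.
  rewrite ge0_integralZr//; last 2 first.
  - by apply: measurable_normB => //; exact: measurable_shift.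
  - by rewrite lee_fin.
  rewrite EFinM; have [yr|yr] := pselect (cube r y).
    by rewrite lee_wpmul2r ?lee_fin//; exact: he.
  have -> : omega y = 0.
    by apply/normr0_eq0/le_anti; rewrite normr_ge0 (le_trans (os y))// indicE memNset// mulr0.
  by rewrite !mule0.
Qed.

(** The passage from weak to strong: the mollifier is chosen from the translation modulus alone, so
    it serves all indices and times at once. Letting both indices and times differ makes the lemma
    usable for the Cauchy property and for time continuity. *)
Lemma mollified_comparison j e : 0 < e -> exists C C0 r omega, tame C C0 r omega /\
  exists2 d, 0 < d & forall k l s t,
    (forall x, cube j%:R x -> `|smear omega k t x - smear omega l s x| <= d) ->
    (\int[leb]_(x in cube j%:R) `|w k t x - w l s x|%:E <= e%:E)%E.
Proof.
move=> e0.
have e3 : 0 < e / 3 by rewrite divr_gt0.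
have [r r0 hr] := w_shift e3.
have [om [C [C0 [to o0 o1]]]] := @mollifier_exists R N r r0.
exists C, C0, r, om; split=> //.
have mc := @measurable_cube R N j%:R.
have [c c0 hc] : exists2 c, 0 <= c & leb (cube j%:R) = c%:E.
  exists (fine (leb (cube j%:R))); first exact: fine_ge0.
  by rewrite fineK// ge0_fin_numE// lebesgue_cube_lty.
have e' : 0 < e / (3 * (c + 1)) by rewrite divr_gt0// mulr_gt0// ltr_wpDl.
exists (e / (3 * (c + 1))) => // k l s t hkl.
have ms k' t' : measurable_fun setT (smear om k' t') by exact: measurable_smear to k' t'.
have err k' t' : (\int[leb]_(x in cube j%:R) `|w k' t' x - smear om k' t' x|%:E <= (e / 3)%:E)%E.
  apply: (@le_trans _ _ (L1dist leb (w k' t') (smear om k' t'))).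
    apply: ge0_subset_integral => //; exact: measurable_normB.
  apply: (mollification_error to) => //; first exact: ltW.
  move=> y yr; apply: hr.
  rewrite /Num.norm/= mx_normrE; apply/bigmax_leP; split => [|[a b] _ /=]; first exact: ltW.
  by rewrite ord1.
have mn (f g : V -> R) : measurable_fun setT f -> measurable_fun setT g ->
    measurable_fun (cube j%:R) (fun x : V => `|f x - g x|%:E).
  by move=> mf mg; apply: measurable_funTS; exact: measurable_normB.
apply: (@le_trans _ _ (\int[leb]_(x in cube j%:R) (`|w k t x - smear om k t x|%:E +
   (`|smear om k t x - smear om l s x|%:E + `|w l s x - smear om l s x|%:E)))%E).
  apply: ge0_le_integral => //.
  - exact: mn.
  - by apply: emeasurable_funD; [exact: mn|apply: emeasurable_funD; exact: mn].
  - move=> x _; rewrite -!EFinD lee_fin (distrC (w l s x)).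
    apply: (le_trans (ler_distD (smear om k t x) _ _)); rewrite lerD2l.
    exact: ler_distD.
rewrite ge0_integralD//; last 3 first.
- exact: mn.
- by move=> x _; rewrite adde_ge0// lee_fin.
- by apply: emeasurable_funD; exact: mn.
rewrite ge0_integralD//; [|exact: mn|exact: mn].
rewrite [e in X in (_ <= X)%E](_ : e = e / 3 + (e / 3 + e / 3)); last by field.
rewrite !EFinD; apply: leeD; first exact: err.
apply: leeD; last exact: err.
apply: (@le_trans _ _ (\int[leb]_(x in cube j%:R) (e / (3 * (c + 1)))%:E)%E).
  by apply: ge0_le_integral => //; exact: mn.
have -> : (\int[leb]_(x in cube j%:R) (e / (3 * (c + 1)))%:E = (e / (3 * (c + 1)) * c)%:E)%E.
  by rewrite integral_cst// [RHS]EFinM; congr (_ * _)%E; exact: hc.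
rewrite lee_fin.
rewrite (_ : _ * c = (c / (c + 1)) * (e / 3)); last by field; rewrite gt_eqF// ltr_wpDl.
by rewrite ler_piMl ?(ltW e3)// ler_pdivrMr ?ltr_wpDl// mul1r lerDl.
Qed.

Lemma sequence_cauchy (F : set_system nat) j e : UltraFilter F -> \oo `<=` F -> 0 < e ->
  \forall kl \near (F, F), forall t, 0 <= t <= T ->
    (\int[leb]_(x in cube j%:R) `|w kl.1 t x - w kl.2 t x|%:E <= e%:E)%E.
Proof.
move=> FU Foo e0; have [C [C0 [r [om [to [d d0 hd]]]]]] := mollified_comparison j e0.
have FF : ProperFilter F by exact: ultra_proper.
have := smear_cauchy to FU Foo j d0; apply: filterS => -[k l] /= hkl t tT.
by apply: hd => x xj; exact: hkl.
Qed.

(** The mesh must be small as well as |t - s|, because the functions jump in time at the scale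
    [h k]. *)
Lemma time_equicontinuity j e : 0 < e -> exists2 d, 0 < d &
  forall k s t, 0 <= s -> 0 <= t -> `|t - s| <= d -> h k <= d ->
    (\int[leb]_(x in cube j%:R) `|w k t x - w k s x|%:E <= e%:E)%E.
Proof.
move=> e0; have [C [C0 [r [om [to [d d0 hd]]]]]] := mollified_comparison j e0.
have [B B0 hB] := w_time to.
have B1 : 0 < B + 1 by rewrite ltr_wpDl.
exists (d / (2 * (B + 1))) => [|k s t s0 t0 ts hk]; first by rewrite divr_gt0// mulr_gt0.
apply: hd => x _; apply: (le_trans (hB k s t x s0 t0)).
apply: (le_trans (ler_wpM2l B0 (lerD ts hk))).
rewrite (_ : B * _ = B / (B + 1) * d); last by field; rewrite gt_eqF.
by rewrite ler_piMl ?(ltW d0)// ler_pdivrMr// mul1r lerDl.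
Qed.

(** The same ultrafilter gives for each j a set [A j] of mutually close indices, and finite
    intersections of these sets contain arbitrarily large indices. *)
Lemma fast_subsequence : exists n : nat -> nat, (forall j, (j <= n j)%N) /\
  forall j t, 0 <= t <= T ->
    (\int[leb]_(x in cube j%:R) `|w (n j) t x - w (n j.+1) t x|%:E <= (2^-1 ^+ j)%:E)%E.
Proof.
have [F [FU Foo]] := @ultraFilterLemma nat \oo _.
have FF : ProperFilter F by exact: ultra_proper.
have hA j : exists A : set nat, F A /\ forall k l t, A k -> A l -> 0 <= t <= T ->
    (\int[leb]_(x in cube j%:R) `|w k t x - w l t x|%:E <= (2^-1 ^+ j)%:E)%E.
  have ej : 0 < 2^-1 ^+ j :> R by rewrite exprn_gt0.
  have [[P Q] [/= FP FQ] PQ] := sequence_cauchy j FU Foo ej.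
  exists (P `&` Q); split; first exact: filterI.
  by move=> k l t [Pk _] [_ Ql] tT; exact: (PQ (k, l)).
have [A {}hA] := choice hA.
(* Membership in all earlier sets places both [n j] and [n j.+1] in [A j], which is what consecutive
   differences require. *)
have hn j : exists k, (j <= k)%N /\ forall i, (i <= j)%N -> A i k.
  have FJ : F [set k | (j <= k)%N] by apply: Foo; exists j.
  have FI : F [set k | forall i, (i <= j)%N -> A i k].
    elim: j {FJ} => [|j ih].
      by apply: filterS (hA 0%N).1 => k A0 i; rewrite leqn0 => /eqP ->.
    apply: filterS2 ih (hA j.+1).1 => k h1 h2 i.
    by rewrite leq_eqVlt => /orP[/eqP ->//|]; exact: h1.
  by have [k [? ?]] := filter_ex (filterI FJ FI); exists k.
have [n {}hn] := choice hn.
exists n; split => [j|j t tT]; first by have [] := hn j.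
apply: (hA j).2 => //; first by have [_] := hn j; exact.
by have [_] := hn j.+1; exact.
Qed.

End compactness.

(** * The limit of a rapidly Cauchy sequence *)

Section fatou_consequence.
Local Open Scope ereal_scope.
Context d (X : measurableType d) (R : realType).
Variables (m : {measure set X -> \bar R}) (D : set X).
Hypothesis mD : measurable D.

Lemma limn_einf_le_near (u : nat -> \bar R) (c : \bar R) :
  (\forall j \near \oo, u j <= c) -> limn_einf u <= c.
Proof.
move=> uc; rewrite limn_einf_lim; apply: lime_le; first exact: is_cvg_einfs.
apply: nearW => n; have [k _ hk] := uc.
apply: (@le_trans _ _ (u (maxn n k))); last by apply: hk; rewrite /= leq_maxr.
by apply: ereal_inf_lbound; exists (maxn n k) => //=; rewrite leq_maxl.
Qed.

Lemma fatou_ae (f_ : nat -> X -> R) (f : X -> R) :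
  (forall n, measurable_fun D (f_ n)) -> measurable_fun D f ->
  (forall n x, D x -> (0 <= f_ n x)%R) -> (forall x, D x -> (0 <= f x)%R) ->
  {ae m, forall x, D x -> f_ ^~ x @ \oo --> f x} ->
  \int[m]_(x in D) (f x)%:E <= limn_einf (fun j => \int[m]_(x in D) (f_ j x)%:E).
Proof.
move=> mf_ mf f_0 f0 cf.
have mF n : measurable_fun D (EFin \o f_ n) by exact/measurable_EFinP.
have F0 n x : D x -> 0 <= (f_ n x)%:E by move=> Dx; rewrite lee_fin f_0.
apply: le_trans (fatou m mD mF F0).
apply: ae_ge0_le_integral => //.
- exact/measurable_EFinP.
- move=> x Dx; rewrite limn_einf_lim; apply: lime_ge; first exact: is_cvg_einfs.
  by apply: nearW => n; apply: le_ereal_inf_tmp => _ [k _ <-]; exact: F0.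
- rewrite /limn_einf; apply: measurableT_comp => //.
  by apply: (measurable_fun_limn_esup (f := fun n x => - (f_ n x)%:E)) => n; exact: measurableT_comp (mF n).
- apply: filterS cf => x cx Dx.
  have cE : (f_ n x)%:E @[n --> \oo] --> (f x)%:E.
    by apply/cvg_EFin; [exact: nearW|exact: cx].
  by rewrite (cvg_limn_einf_sup cE).
Qed.

Lemma fatou_le (f_ : nat -> X -> R) (f : X -> R) c :
  (forall n, measurable_fun D (f_ n)) -> measurable_fun D f ->
  (forall n x, D x -> (0 <= f_ n x)%R) -> (forall x, D x -> (0 <= f x)%R) ->
  {ae m, forall x, D x -> f_ ^~ x @ \oo --> f x} ->
  (\forall j \near \oo, \int[m]_(x in D) (f_ j x)%:E <= c) ->
  \int[m]_(x in D) (f x)%:E <= c.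
Proof.
move=> mf_ mf f_0 f0 cf hc; apply: le_trans (limn_einf_le_near hc).
exact: fatou_ae.
Qed.

End fatou_consequence.

Section rapidly_cauchy.
Context (R : realType).

(** The weights stand for indicators of growing cubes at a fixed point: equal to 1 from some rank
    on, they do not affect convergence, and an absolutely convergent telescoping series remains. *)
Lemma rapidly_cauchy_cvg (a : nat -> R) (c : nat -> R) J :
  (forall i, 0 <= c i) -> (forall i, (J <= i)%N -> c i = 1) ->
  (\sum_(0 <= i <oo) (`|a i - a i.+1| * c i)%:E < +oo)%E -> cvgn a.
Proof.
move=> c0 cJ fin; pose b i := `|a i - a i.+1| * c i.
have b0 i : 0 <= b i by rewrite mulr_ge0.
have cb : cvgn (series b).
  apply: nondecreasing_is_cvgn.
    apply/nondecreasing_seqP => n; rewrite /series/= big_nat_recr//= lerDl; exact: b0.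
  exists (fine (\sum_(0 <= i <oo) (b i)%:E)%E) => _ [n _ <-].
  rewrite -lee_fin fineK; last first.
    by rewrite ge0_fin_numE// nneseries_ge0// => i _ _; rewrite lee_fin.
  rewrite /series/= -sumEFin; apply: nneseries_lim_ge => i _ _.
  by rewrite lee_fin.
have ct : cvgn (series (telescope a)).
  apply: normed_cvg; rewrite -(is_cvg_series_restrict J).
  rewrite -(is_cvg_series_restrict J) in cb.
  rewrite (_ : (fun n => _) = (fun n => \sum_(J <= k < n) b k)) => //.
  apply/funext => n; apply: eq_big_nat => i /andP[Ji _].
  by rewrite /b cJ// mulr1 distrC.
rewrite (_ : a = (fun n => a 0%N + series (telescope a) n)).
  by apply: is_cvgD => //; exact: is_cvg_cst.
by apply/funext => n; exact: eq_sum_telescope.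
Qed.

Lemma half_series_le n : \sum_(0 <= i < n) (2^-1 ^+ i) <= 2 :> R.
Proof.
have -> : \sum_(0 <= i < n) (2^-1 ^+ i) = 2 - 2 * 2^-1 ^+ n :> R.
  elim: n => [|n ih]; first by rewrite big_geq// expr0; ring.
  by rewrite big_nat_recr//= ih exprS; field.
by rewrite gerBl mulr_ge0// exprn_ge0.
Qed.

End rapidly_cauchy.

Section limit.
Context (R : realType) (N : nat).
Local Notation V := 'rV[R]_N.
Local Notation leb := (@lebesgue_rV R N).
Variables (w : nat -> R -> V -> R) (M T : R).
Hypothesis mw : forall k, measurable_fun setT (fun p : V * R => w k p.2 p.1).
Hypothesis wM : forall k t x, `|w k t x| <= M.
Hypothesis w_fast : forall j t, 0 <= t <= T ->
  (\int[leb]_(x in cube j%:R) `|w j t x - w j.+1 t x|%:E <= (2^-1 ^+ j)%:E)%E.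

(** An upper limit is taken at every point, convergent or not, so that a single function is jointly
    measurable in (x, t); the clamp makes the bound M hold everywhere. *)
Definition limit_fun (p : V * R) : R :=
  Num.max (- M) (Num.min M (fine (limn_esup (fun k => (w k p.2 p.1)%:E)))).

Lemma measurable_limit_fun : measurable_fun setT limit_fun.
Proof.
have m1 : measurable_fun setT (fun p : V * R => fine (limn_esup (fun k => (w k p.2 p.1)%:E))).
  apply: measurableT_comp => //.
  by apply: (@measurable_fun_limn_esup _ _ _ _ (fun k (p : V * R) => (w k p.2 p.1)%:E)) => k;
    exact/measurable_EFinP.
exact: (measurable_maxr (measurable_cst (- M)) (measurable_minr (measurable_cst M) m1)).
Qed.

Lemma limit_fun_bounded p : `|limit_fun p| <= M.
Proof.
have M0 : 0 <= M by exact: le_trans (wM 0 0 0).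
rewrite ler_norml /limit_fun le_max lexx/= ge_max ge_min lexx/= andbT.
by rewrite (le_trans _ M0)// oppr_le0.
Qed.

Lemma limit_fun_cvg t x : cvgn (fun k => w k t x) -> w ^~ t ^~ x @ \oo --> limit_fun (x, t).
Proof.
move=> /cvg_ex[/= l cl].
have cE : (w k t x)%:E @[k --> \oo] --> l%:E by apply/cvg_EFin; [exact: nearW|exact: cl].
have lE : limn (fun k => w k t x) = l by exact: cvg_lim.
have cw : cvgn (fun k => w k t x) by apply/cvg_ex; exists l.
have wb k : - M <= w k t x <= M by rewrite -ler_norml.
have lM : - M <= l by rewrite -lE; apply: limr_ge => //; apply: nearW => k; have /andP[] := wb k.
have Ml : l <= M by rewrite -lE; apply: limr_le => //; apply: nearW => k; have /andP[] := wb k.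
rewrite (_ : limit_fun (x, t) = l)//.
by rewrite /limit_fun/= (cvg_limn_einf_sup cE)/= (min_idPr Ml) (max_idPr lM).
Qed.

(** The total variation of the sequence, with the j-th increment counted on the j-th cube, where it
    is controlled. Its finiteness at a point forces convergence there. *)
Definition variation (p : V * R) : \bar R :=
  (\sum_(0 <= j <oo) (`|w j p.2 p.1 - w j.+1 p.2 p.1| * \1_(cube j%:R) p.1)%:E)%E.

Lemma variation_cvg x t : (variation (x, t) < +oo)%E -> w ^~ t ^~ x @ \oo --> limit_fun (x, t).
Proof.
move=> v; apply: limit_fun_cvg; have [J xJ] := cube_cover x.
apply: (@rapidly_cauchy_cvg R _ (fun j => \1_(cube j%:R) x) J) => //.
move=> i Ji; rewrite indicE mem_set// => a; rewrite (le_trans (xJ a))// ler_nat//.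
Qed.

Let term (j : nat) (p : V * R) : \bar R := (`|w j p.2 p.1 - w j.+1 p.2 p.1| * \1_(cube j%:R) p.1)%:E.

Let mterm j : measurable_fun setT (term j).
Proof.
apply/measurable_EFinP; apply: measurable_funM.
  by apply: measurableT_comp => //; apply: measurable_funB; exact: mw.
apply: (measurableT_comp (f := \1_(cube j%:R) : V -> R)); last exact: measurable_fst.
by apply: measurable_indic; exact: measurable_cube.
Qed.

Let term0 j p : (0 <= term j p)%E.
Proof. by rewrite lee_fin mulr_ge0. Qed.

Lemma measurable_variation : measurable_fun setT variation.
Proof. by apply: (ge0_emeasurable_sum (h := term)) => // j; exact: mterm. Qed.

Lemma variation_ge0 p : (0 <= variation p)%E.
Proof. by apply: nneseries_ge0 => j _ _; exact: term0. Qed.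

Lemma integral_variation_le t : 0 <= t <= T -> (\int[leb]_x variation (x, t) <= 2%:E)%E.
Proof.
move=> tT; rewrite (@integral_nneseries _ _ _ leb setT measurableT (fun j x => term j (x, t)))//; last first.
  by move=> j; exact: measurableT_comp (mterm j) (measurable_pair2 t).
apply: lime_le; first by apply: is_cvg_nneseries => j _ _; apply: integral_ge0.
apply: nearW => n.
apply: (@le_trans _ _ (\sum_(0 <= j < n) (2^-1 ^+ j)%:E)%E); last first.
  by rewrite sumEFin lee_fin half_series_le.
apply: lee_sum => j _; apply: le_trans (w_fast j tT).
rewrite [leRHS]integral_mkcond le_eqVlt; apply/orP; left; apply/eqP.
apply: eq_integral => x _; rewrite /patch /term indicE /=.
by case: ifP => _; rewrite ?mulr1 ?mulr0.
Qed.

(** The null set depends on t, the limit function does not; the series of increments has integral at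
    most 2 at each time. *)
Lemma limit_fun_ae t : 0 <= t <= T ->
  {ae leb, forall x, w ^~ t ^~ x @ \oo --> limit_fun (x, t)}.
Proof.
move=> tT.
have iv : leb.-integrable setT (fun x => variation (x, t)).
  apply/integrableP; split.
    exact: measurableT_comp measurable_variation (measurable_pair2 t).
  rewrite (eq_integral (fun x => variation (x, t))).
    exact: le_lt_trans (integral_variation_le tT) (ltry _).
  by move=> x _; rewrite gee0_abs// variation_ge0.
have := integrable_ae measurableT iv; apply: filterS => x /(_ I).
by rewrite ge0_fin_numE ?variation_ge0//; exact: variation_cvg.
Qed.

Lemma lebesgue_itv_lty (a b : R) : (lebesgue_measure (`]a, b[%classic : set R) < +oo)%E.
Proof. by rewrite lebesgue_measure_itv/=; case: ifP => _; rewrite ?ltry// -EFinB ltry. Qed.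

Lemma measurable_cylinder : measurable (@cylinder R N T).
Proof. by apply: measurableX => //; exact: measurable_itv. Qed.

(** The bound on the variation is uniform in t, so Tonelli makes it integrable over the cylinder. *)
Lemma limit_fun_ae_cylinder :
  {ae lebesgue_rVxR N, forall p, cylinder N T p -> w ^~ p.2 ^~ p.1 @ \oo --> limit_fun p}.
Proof.
have mc : measurable (cylinder N T : set (V * measurableTypeR R)) by exact: measurable_cylinder.
have iv : (lebesgue_rVxR N).-integrable (cylinder N T) variation.
  apply/integrableP; split; first exact: measurable_funTS measurable_variation.
  have -> : (\int[lebesgue_rVxR N]_(p in cylinder N T) `|variation p| =
      \int[lebesgue_rVxR N]_(p in cylinder N T) variation p)%E.
    by apply: eq_integral => p _; rewrite gee0_abs// variation_ge0.
  rewrite integral_mkcond.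
  have mr : measurable_fun setT (variation \_ (cylinder N T)).
    by apply/(measurable_restrictT _ _).1 => //; exact: measurable_funTS measurable_variation.
  rewrite (@fubini_tonelli2 _ _ _ _ _ leb lebesgue_measure _ mr); last first.
    by move=> p; apply: erestrict_ge0 => q _; exact: variation_ge0.
  apply: (@le_lt_trans _ _ (\int[lebesgue_measure]_(t in `]0%R, T[) 2%:E)%E); last first.
    by rewrite integral_cst//; apply: lte_mul_pinfty => //; exact: lebesgue_itv_lty.
  rewrite [leRHS]integral_mkcond; apply: ge0_le_integral => //.
  - move=> t _; apply: integral_ge0 => x _; apply: erestrict_ge0 => q _; exact: variation_ge0.
  - apply: measurable_fun_fubini_tonelli_G => // p.
    by apply: erestrict_ge0 => q _; exact: variation_ge0.
  - apply/(measurable_restrictT _ _).1 => //.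
  - move=> t _; rewrite /patch; case: ifPn => [|] tT; last first.
      rewrite /fubini_G integral0_eq// => x _; case: ifPn => //.
      by rewrite inE => -[_ /=] h; move/negP: tT; rewrite inE.
    apply: (@le_trans _ _ (\int[leb]_x variation (x, t))%E).
      apply: ge0_le_integral => //.
      + by move=> x _; case: ifP => // _; exact: variation_ge0.
      + exact: measurableT_comp mr (measurable_pair2 t).
      + exact: measurableT_comp measurable_variation (measurable_pair2 t).
      + by move=> x _; case: ifP => // _; exact: variation_ge0.
    apply: integral_variation_le; move: tT; rewrite inE/= in_itv/= => /andP[t0 tT].
    by rewrite !ltW.
have := integrable_ae mc iv; apply: filterS => -[x t] h /h.
by rewrite ge0_fin_numE ?variation_ge0//; exact: variation_cvg.
Qed.

End limit.

Section ae_shift.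
Context (R : realType) (N : nat).
Local Notation V := 'rV[R]_N.

(** Transfers almost everywhere convergence from x to x + z, for a fixed z, in the energy bound. *)
Lemma ae_shift (P : V -> Prop) (z : V) :
  {ae @lebesgue_rV R N, forall x, P x} -> {ae @lebesgue_rV R N, forall x, P (x + z)}.
Proof.
move=> [A [mA A0 PA]]; exists ((fun x => x + z) @^-1` A); split.
- rewrite -[X in measurable X]setTI; apply: measurable_fun_addrV => //; exact: measurable_id.
- by rewrite lebesgue_rV_shift.
- by move=> x /= Px; apply: PA.
Qed.

End ae_shift.

(** * Lipschitz approximation and convex primitive of the nonlinearity *)

Section monotone_functions.
Context (R : realType) (phi : R -> R).
Hypothesis phi_cont : continuous phi.
Hypothesis phi_homo : {homo phi : x y / x <= y}.

Lemma homo_bounded M s : `|s| <= M -> `|phi s| <= `|phi M| + `|phi (- M)|.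
Proof.
rewrite ler_norml => /andP[/phi_homo h1 /phi_homo h2].
rewrite ler_norml; apply/andP; split.
  by have := ler_norm (- phi (- M)); rewrite normrN; have := normr_ge0 (phi M); lra.
by have := ler_norm (phi M); have := normr_ge0 (phi (- M)); lra.
Qed.

Lemma uniformly_continuous_itv M e : 0 < e -> exists2 d, 0 < d &
  forall x y, `|x| <= M -> `|y - x| <= d -> `|phi y - phi x| <= e.
Proof.
move=> e0; have e2 : 0 < e / 2 by rewrite divr_gt0.
have cK : compact (`[- M, M]%classic : set R) by exact: segment_compact.
pose P (n : nat) (x : R) := forall y, `|y - x| <= n.+1%:R^-1 -> `|phi y - phi x| <= e.
have [+ _] := compact_near_coveringP (`[- M, M]%classic : set R).
move=> /(_ cK nat \oo P) [].
  move=> x _; have : \forall y \near x, `|phi x - phi y| <= e / 2.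
    by have /cvgrPdist_le/(_ _ e2) := @phi_cont x.
  move=> /nbhs_ballP[r /= r0 hr].
  have r2 : 0 < r / 2 by rewrite divr_gt0.
  have hn := @near_infty_natSinv_lt R (PosNum r2).
  exists (ball x (r / 2), [set n | n.+1%:R^-1 < r / 2]).
    by split=> //; exact: nbhsx_ballx.
  move=> [y n] [/= xy nr] z zy.
  have hy : `|phi x - phi y| <= e / 2.
    by apply: hr; apply: le_ball xy; rewrite ler_pdivrMr// mulr_natr mulr2n lerDl ltW.
  have hz : `|phi x - phi z| <= e / 2.
    apply: hr; rewrite -ball_normE/=.
    have := xy; rewrite -ball_normE/= => xy'.
    rewrite (le_lt_trans (ler_distD y _ _))// [ltRHS]splitr ltrD// distrC.
    exact: le_lt_trans nr.
  rewrite (_ : _ - _ = (phi x - phi y) - (phi x - phi z)); last by ring.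
  by rewrite (le_trans (ler_normB _ _))// [leRHS]splitr lerD.
move=> n _ /(_ n (leqnn n)) hn; exists n.+1%:R^-1; first by rewrite invr_gt0.
by move=> x y xM yx; apply: hn => //=; rewrite in_itv/= -ler_norml.
Qed.

(* The inf-convolution of [phi] on [-M, M] with [K * max(s, 0)]. *)
Lemma lipschitz_approximation M e : 0 <= M -> 0 < e -> exists (psi : R -> R) (K : R),
  [/\ {homo psi : x y / x <= y}, 0 <= K,
      forall a b, `|psi a - psi b| <= K * `|a - b| &
      forall s, `|s| <= M -> `|psi s - phi s| <= e].
Proof.
move=> M0 e0; have [d d0 hd] := uniformly_continuous_itv M e0.
(* Over a distance [d] the penalty K d equals the whole oscillation of [phi], so points r < s - d
   are not competitive in the infimum. Points r > s are free of penalty, but there phi(r) >=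
   phi(s). *)
pose K := (phi M - phi (- M)) / d.
have MM : - M <= M by rewrite (le_trans _ M0)// oppr_le0.
have K0 : 0 <= K by rewrite divr_ge0 ?(ltW d0)// subr_ge0 phi_homo.
pose c s r := phi r + K * Num.max (s - r) 0.
pose S s := [set c s r | r in `[- M, M]%classic].
have c_ge s r : r \in `[- M, M] -> phi (- M) <= c s r.
  rewrite in_itv/= => /andP[r1 r2]; rewrite -[leLHS]addr0 lerD ?phi_homo//.
  by rewrite mulr_ge0// le_max lexx orbT.
have Slb s : has_lbound (S s).
  by exists (phi (- M)) => _ [r rM <-]; exact: c_ge.
have Sinf s : has_inf (S s).
  split=> //; exists (c s 0), 0 => //=; rewrite in_itv/= M0 andbT oppr_le0//.
pose psi s := inf (S s).
have psi_le s r : r \in `[- M, M] -> psi s <= c s r.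
  by move=> rM; apply: ge_inf => //; exists r.
have le_psi s y : (forall r, r \in `[- M, M] -> y <= c s r) -> y <= psi s.
  move=> h; apply: lb_le_inf; first by have [] := Sinf s.
  by move=> _ [r rM <-]; exact: h.
have psi_lip1 a b : psi a <= psi b + K * `|a - b|.
  rewrite -lerBlDr; apply: le_psi => r rM; rewrite lerBlDr (le_trans (psi_le a r rM))//.
  rewrite /c -addrA lerD2l -mulrDr ler_wpM2l// ge_max; apply/andP; split.
    have : b - r <= Num.max (b - r) 0 by rewrite le_max lexx.
    by have := ler_norm (a - b); lra.
  by rewrite addr_ge0// le_max lexx orbT.
exists psi, K; split=> //.
- move=> a b ab; apply: le_psi => r rM; apply: (le_trans (psi_le a r rM)).
  rewrite /c lerD2l ler_wpM2l// ge_max le_max lerD2r ab/= le_max lexx orbT//.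
- move=> a b; rewrite ler_norml; have := psi_lip1 a b; have := psi_lip1 b a.
  by rewrite distrC => h1 h2; apply/andP; split; lra.
- move=> s sM.
  have sI : s \in `[- M, M] by rewrite in_itv/= -ler_norml.
  have h1 : psi s <= phi s.
    by have := psi_le s s sI; rewrite /c subrr maxxx mulr0 addr0.
  have h2 : phi s - e <= psi s.
    apply: le_psi => r; rewrite in_itv/= => /andP[r1 r2].
    have [sr|rs] := leP s r.
      rewrite /c -[leLHS]addr0 lerD//; last by rewrite mulr_ge0// le_max lexx orbT.
      by have := phi_homo sr; lra.
    have m0 : s - r <= Num.max (s - r) 0 by rewrite le_max lexx.
    have m1 : 0 <= Num.max (s - r) 0 by rewrite le_max lexx orbT.
    have [sd|sd] := leP (s - r) d.
      have : `|phi r - phi s| <= e by apply: hd => //; rewrite distrC ger0_norm// subr_ge0 ltW.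
      rewrite ler_norml => /andP[h _].
      by have := mulr_ge0 K0 m1; rewrite /c; lra.
    have : K * d <= K * Num.max (s - r) 0 by rewrite ler_wpM2l// (le_trans _ m0)// ltW.
    rewrite {1}/K divfK ?gt_eqF// /c => h.
    have := phi_homo r1; have : phi s <= phi M by apply: phi_homo; move: sM; rewrite ler_norml => /andP[].
    by move: h; lra.
  by rewrite ler_norml; apply/andP; split; lra.
Qed.

(** The primitive of phi - phi 0 vanishing at 0. The subgradient inequality follows from the mean
    value theorem and monotonicity, and its instance at the origin gives nonnegativity. *)
Lemma convex_primitive M : 0 <= M -> exists Phi : R -> R, [/\ measurable_fun setT Phi,
  forall a, `|a| <= M -> 0 <= Phi a,
  forall a b, `|a| <= M -> `|b| <= M -> Phi b - Phi a <= (phi b - phi 0) * (b - a) &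
  Phi 0 = 0].
Proof.
(* The margin 1 on both sides makes every point of [-M, M] interior, as the fundamental theorem of
   calculus requires. *)
move=> M0; pose a := - M - 1; pose u := M + 1.
have iphi : lebesgue_measure.-integrable `[a, u] (EFin \o phi).
  apply: continuous_compact_integrable; first exact: segment_compact.
  exact: continuous_subspaceT.
pose F y := \int[lebesgue_measure]_(t in [set` `[a, y]]) phi t.
have dF (x : R) : `|x| <= M -> is_derive x (1 : R) F (phi x).
  rewrite ler_norml => /andP[Mx xM].
  have xu : x < u by rewrite /u; lra.
  have ax : a < x by rewrite /a; lra.
  have [df fE] := continuous_FTC1_closed xu iphi ax (@phi_cont x).
  by apply: DeriveDef => //; rewrite -derive1E.
have Fc (x : R) : `|x| <= M -> {for x, continuous F}.
  by move=> xM; apply/differentiable_continuous/derivable1_diffP/ex_derive/dF.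
have sub s t : `|s| <= M -> `|t| <= M -> F t - F s <= phi t * (t - s).
  move=> sM tM; have MVT' x y : `|x| <= M -> `|y| <= M -> x < y ->
      exists2 c, x < c < y & F y - F x = phi c * (y - x).
    move=> xM yM xy; have inM z : x <= z -> z <= y -> `|z| <= M.
      move: xM yM; rewrite !ler_norml => /andP[? ?] /andP[? ?] ? ?; apply/andP; split; lra.
    have dz (z : R) : z \in `]x, y[ -> is_derive z (1 : R) F (phi z).
      by rewrite in_itv/= => /andP[xz zy]; apply/dF/inM; exact: ltW.
    have cz : {within `[x, y], continuous F}.
      apply: continuous_in_subspaceT => z; rewrite inE/= in_itv/= => /andP[xz zy].
      by apply/Fc/inM.
    have [c] := MVT xy dz cz; rewrite in_itv/= => cxy E.
    by exists c.
  have [st|ts|->] := ltgtP s t.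
  - have [c /andP[sc ct] ->] := MVT' _ _ sM tM st.
    by rewrite ler_wpM2r ?subr_ge0 ?phi_homo// ltW.
  - have [c /andP[tc cs] E] := MVT' _ _ tM sM ts.
    have : phi t * (s - t) <= phi c * (s - t) by rewrite ler_wpM2r ?subr_ge0 ?phi_homo// ltW.
    by rewrite -E; lra.
  by rewrite !subrr mulr0.
(* Precomposing with a 1-Lipschitz clamp yields a function continuous on the whole line, hence
   measurable, and unchanged on [-M, M]. *)
pose clip s := Num.max (- M) (Num.min M s).
have clipM s : `|clip s| <= M.
  rewrite ler_norml /clip le_max lexx/= ge_max ge_min lexx/= andbT.
  by rewrite (le_trans _ M0)// oppr_le0.
have clip_id s : `|s| <= M -> clip s = s.
  by rewrite ler_norml => /andP[h1 h2]; rewrite /clip (min_idPr h2) (max_idPr h1).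
have clip_lip s t : `|clip s - clip t| <= `|s - t|.
  have h1 := ler_norm (s - t); have h2 := ler_norm (t - s); rewrite distrC in h2.
  rewrite ler_norml /clip; apply/andP; case: (leP M s) => sM; case: (leP M t) => tM;
    case: (leP (- M) M) => MM; try case: (leP (- M) s) => sm; try case: (leP (- M) t) => tm;
    by split; lra.
have clip_cont : continuous clip.
  move=> s; apply/cvgrPdist_le => e e0; near=> t; apply: (le_trans (clip_lip s t)).
  near: t; have : \forall t \near s, `|id s - id t| <= e by exact: (@cvgr_dist_le _ _ _ (nbhs s) _ id s cvg_id _ e0).
  by [].
have z0 : `|0 : R| <= M by rewrite normr0.
pose Phi s := F (clip s) - F 0 - phi 0 * clip s.
have Phi_sub s t : `|s| <= M -> `|t| <= M -> Phi t - Phi s <= (phi t - phi 0) * (t - s).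
  by move=> sM tM; rewrite /Phi !clip_id//; have := sub s t sM tM; rewrite mulrBl mulrBr; lra.
have Phi0 : Phi 0 = 0 by rewrite /Phi clip_id// mulr0 subrr subr0.
exists Phi; split=> //.
- apply: continuous_measurable_fun => s; apply: cvgB; first apply: cvgB.
  + apply: (@continuous_comp _ _ _ clip F); [exact: clip_cont|exact: Fc].
  + exact: cvg_cst.
  + by apply: cvgM; [exact: cvg_cst|exact: clip_cont].
- by move=> s sM; have := Phi_sub s 0 sM z0; rewrite Phi0 subrr mul0r sub0r oppr_le0.
Unshelve. all: by end_near. Qed.

End monotone_functions.

(** * Functions on space-time *)

Section product_borel.
Context (R : realType) (N : nat).
Local Notation V := 'rV[R]_N.

Let g (v : 'rV[R]_N.+1) : V * R := (@rsubmx R 1 1 N v, v ord0 ord0).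

Let g_continuous : continuous g.
Proof.
move=> v A [[P Q] /= [/nbhs_ballP[e /= e0 eP] /nbhs_ballP[e' /= e'0 e'Q]] PQ].
apply/nbhs_ballP; exists (Num.min e e') => /=; first by rewrite lt_min e0.
move=> w [_ vw]; apply: PQ; split => /=.
  apply: eP; split => // i j; have := vw i (rshift 1 j); rewrite /rsubmx !mxE.
  by apply: le_ball; rewrite ge_min lexx.
by apply: e'Q; have := vw ord0 ord0; apply: le_ball; rewrite ge_min lexx orbT.
Qed.

(** Through R^(N+1): the pullback of [O] by the continuous splitting [g] is open, hence Borel there,
    and [rV_cons] brings it back measurably to the product sigma-algebra. *)
Lemma open_measurable_prod (O : set (V * R)) : open O -> measurable O.
Proof.
move=> oO; have mO : measurable (g @^-1` O).
  by apply: sub_sigma_algebra; apply: open_comp => // v _; exact: g_continuous.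
pose f (p : V * measurableTypeR R) : 'rV[R]_N.+1 := rV_cons (p.2, p.1).
have mf : measurable_fun setT f.
  apply: (measurableT_comp (@measurable_rV_cons R N)).
  by apply: measurable_fun_pair; [exact: measurable_snd|exact: measurable_fst].
have := mf measurableT _ mO; rewrite setTI -comp_preimage.
by rewrite (_ : g \o f = id)//; apply/funext => -[x t]; rewrite /g/=; congr pair;
  [exact: row_mxKr|exact: rV_cons0].
Qed.

Lemma compact_measurable_prod (K : set (V * R)) : compact K -> measurable K.
Proof.
move=> cK; rewrite -[K]setCK; apply: measurableC; apply: open_measurable_prod.
by rewrite openC; apply: compact_closed => //; exact: norm_hausdorff.
Qed.

Lemma continuous_measurable_prod (f : V * R -> R) : continuous f -> measurable_fun setT f.
Proof.
move=> cf; apply: (measurability (@RGenOpens.G R)); first exact: RGenOpens.measurableE.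
move=> _ [_ [a [b ->]] <-]; rewrite setTI; apply: open_measurable_prod.
by apply: open_comp => [x _|]; [exact: cf|exact: interval_open].
Qed.

End product_borel.

(** * Piecewise constant functions of time *)

Section step_function.
Context (R : realType) d (X : measurableType d).

Lemma measurable_truncn (n : nat) (h : R) : 0 < h -> measurable [set t : R | Num.truncn (t / h) = n].
Proof.
move=> h0; case: n => [|n].
  (* [Num.truncn] is 0 on negative numbers, so the cell of index 0 extends to minus infinity. *)
  rewrite (_ : [set _ | _] = `]-oo, h[%classic); first exact: measurable_itv.
  apply/seteqP; split=> t /=; rewrite in_itv/= => /= ht.
    have [t0|t0] := leP 0 (t / h).
      by have /andP[_] := truncn_itv t0; rewrite ht ltr_pdivrMr// mul1r.
    by move: t0; rewrite ltr_pdivrMr// mul0r => t0; exact: lt_trans h0.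
  by apply/eqP; rewrite -leqn0 leqNgt truncn_gt0 -ltNge ltr_pdivrMr// mul1r.
rewrite (_ : [set _ | _] = `[n.+1%:R * h, n.+2%:R * h[%classic); first exact: measurable_itv.
apply/seteqP; split=> t /=; rewrite in_itv/= -ler_pdivlMr// -ltr_pdivrMr//.
  move=> ht; have t0 : 0 <= t / h.
    by apply: contraT; rewrite -ltNge => t0; move: ht; rewrite truncn_floor leNgt t0.
  by rewrite -ht truncn_itv.
exact: truncn_def.
Qed.

Lemma measurable_step_function (U : nat -> X -> R) h : 0 < h ->
  (forall n, measurable_fun setT (U n)) ->
  measurable_fun setT (fun p : X * R => U (Num.truncn (p.2 / h)) p.1).
Proof.
move=> h0 mU _ A mA; rewrite setTI.
rewrite (_ : _ @^-1` A = \bigcup_n (U n @^-1` A `*` [set t : R | Num.truncn (t / h) = n])); last first.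
  by apply/seteqP; split=> [[x t] /= At|[x t] [n _ [/= Ax ht]]]; [exists (Num.truncn (t / h))|rewrite ht].
apply: bigcupT_measurable => n; apply: measurableX; last exact: measurable_truncn.
by rewrite -[X in measurable X]setTI; exact: mU.
Qed.

(** The two times are separated by at most |t - s| / h + 1 grid points; the extra one is the [h] in
    time estimates. *)
Lemma truncn_dist (h s t : R) : 0 < h -> 0 <= s -> s <= t ->
  h *+ (Num.truncn (t / h) - Num.truncn (s / h)) <= `|t - s| + h.
Proof.
move=> h0 s0 st; have t0 := le_trans s0 st.
have sh : 0 <= s / h by rewrite divr_ge0 // ltW.
have th : 0 <= t / h by rewrite divr_ge0 // ltW.
have le_st : (Num.truncn (s / h) <= Num.truncn (t / h))%N.
  by apply: le_truncn; rewrite ler_pM2r ?invr_gt0.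
have /andP[t1 t2] := truncn_itv th; have /andP[s1 s2] := truncn_itv sh.
rewrite ger0_norm ?subr_ge0// -mulr_natl natrB// mulrBl.
move: t1; rewrite ler_pdivlMr// => t1.
by move: s2; rewrite ltr_pdivrMr// -[_.+1]addn1 natrD mulrDl mul1r => s2; lra.
Qed.

End step_function.

Section step_integrals.
Context (R : realType) (N : nat).
Local Notation V := 'rV[R]_N.
Local Notation leb := (@lebesgue_rV R N).
Variables (T h : R) (L : nat).
Hypothesis h0 : 0 < h.
Hypothesis hL : h * L%:R = T.

(** The cells of constancy inside ]0, T[: the first one loses its left endpoint, and all of them
    have length h. *)
Let J n : set (measurableTypeR R) := if n is 0%N then `]0, h[ else `[n%:R * h, n.+1%:R * h[.

Let mJ n : measurable (J n).
Proof. by case: n => [|n]; exact: measurable_itv. Qed.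

Let lebJ n : lebesgue_measure (J n : set (measurableTypeR R)) = h%:E.
Proof.
case: n => [|n]; rewrite /J lebesgue_measure_itv/= lte_fin ?h0 ?sube0//.
rewrite ltr_pM2r// ltr_nat ltnSn -EFinB; congr EFin.
by rewrite -mulrBl -natrB// subSnn mul1r.
Qed.

Lemma step_integral (g : nat -> R) :
  (\int[lebesgue_measure]_(t in `]0%R, T[) (g (Num.truncn (t / h)))%:E =
   (\sum_(n < L) h * g n)%:E)%E.
Proof.
have nJ t n : 0 < t -> t \in J n <-> Num.truncn (t / h) = n.
  move=> t0; have th : 0 <= t / h by rewrite divr_ge0// ltW.
  rewrite inE; case: n => [|n] /=; rewrite in_itv/= ?t0/=.
    split=> [ht|/eqP]; last by rewrite truncn_eq// ltr_pdivrMr// mul1r => /andP[].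
    by apply/eqP; rewrite truncn_eq// th ltr_pdivrMr// mul1r.
  split=> [ht|/eqP]; last by rewrite truncn_eq// ltr_pdivrMr// ler_pdivlMr.
  by apply/eqP; rewrite truncn_eq// ltr_pdivrMr// ler_pdivlMr.
transitivity (\int[lebesgue_measure]_(t in `]0%R, T[) \sum_(n < L) ((g n)%:E * (\1_(J n) t)%:E))%E.
  apply: eq_integral => t; rewrite inE/= in_itv/= => /andP[t0 tT].
  have th : 0 <= t / h by rewrite divr_ge0// ltW.
  have nL : (Num.truncn (t / h) < L)%N by rewrite truncn_lt_nat// ltr_pdivrMr// mulrC hL.
  rewrite (bigD1 (Ordinal nL))//= [\1_(J (Num.truncn (t / h))) t]indicE ((nJ t _ t0).2 erefl) mule1 big1 ?adde0// => i iL.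
  rewrite indicE; have [|_] := boolP (t \in J i); last by rewrite mule0.
  by move=> /(nJ _ _ t0) ti; case/eqP: iL; apply: val_inj.
have JT n : (n < L)%N -> J n `&` (`]0%R, T[%classic : set (measurableTypeR R)) = J n.
  move=> nL; apply/seteqP; split=> [t []//|t Jt]; split=> //.
  move: Jt; case: n nL => [|n] nL /=; rewrite !in_itv/= => /andP[a b].
    by rewrite a/= (lt_le_trans b)// -hL ler_peMr ?(ltW h0)// ler1n.
  rewrite (lt_le_trans _ a) ?mulr_gt0//= (lt_le_trans b)// -hL mulrC ler_pM2l//.
  by rewrite ler_nat.
have iJ n : (n < L)%N -> lebesgue_measure.-integrable `]0, T[%classic (fun t : measurableTypeR R => (\1_(J n) t)%:E).
  move=> nL; apply/integrableP; split.
    by apply/measurable_EFinP; apply: measurable_funTS; apply: measurable_indic; exact: mJ.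
  rewrite [X in (X < _)%E](_ : _ = (\int[lebesgue_measure]_(t in `]0%R, T[) (\1_(J n) t)%:E)%E); last first.
    by apply: eq_integral => t _; rewrite gee0_abs// lee_fin.
  rewrite integral_indic//.
  by rewrite JT//; have := ltry h; rewrite -(lebJ n).
transitivity (\sum_(n < L) \int[lebesgue_measure]_(t in `]0%R, T[) ((g n)%:E * (\1_(J n) t)%:E))%E.
  apply: (@integral_sum _ _ _ _ _ _ 'I_L (fun n (t : measurableTypeR R) => ((g n)%:E * (\1_(J n) t)%:E)%E)) => //.
  by move=> n; apply: integrableZl => //; exact: iJ.
rewrite -sumEFin; apply: eq_bigr => n _.
rewrite integralZl//; last exact: iJ.
rewrite integral_indic// JT//.
by rewrite EFinM muleC; congr (_ * _)%E; exact: lebJ.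
Qed.

Lemma integral_cylinder (F : V * R -> \bar R) : measurable_fun setT F -> (forall p, 0 <= F p)%E ->
  (\int[lebesgue_rVxR N]_(p in cylinder N T) F p =
   \int[lebesgue_measure]_(t in `]0%R, T[) \int[leb]_x F (x, t))%E.
Proof.
move=> mF F0; rewrite [LHS]integral_mkcond.
have mc : measurable (cylinder N T : set (V * measurableTypeR R)) by exact: measurable_cylinder.
have mr : measurable_fun setT ((F : V * measurableTypeR R -> \bar R) \_ (cylinder N T)).
  by apply/(measurable_restrictT _ _).1 => //; exact: measurable_funTS mF.
rewrite (@fubini_tonelli2 _ _ _ _ _ leb lebesgue_measure _ mr); last first.
  by move=> p; apply: erestrict_ge0 => q _; exact: F0.
rewrite [RHS]integral_mkcond; apply: eq_integral => t _.
rewrite /fubini_G /patch; case: ifPn => tT.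
  apply: eq_integral => x _; rewrite ifT// inE; split => //=.
  by move: tT; rewrite inE.
rewrite integral0_eq// => x _; case: ifPn => //.
by rewrite inE => -[_ /=] ht; move/negP: tT; rewrite inE.
Qed.

Lemma integrable_cylinder (f : V -> R) : leb.-integrable setT (EFin \o f) ->
  (lebesgue_rVxR N).-integrable (cylinder N T) (EFin \o (fun p => f p.1)).
Proof.
move=> fi.
have mf : measurable_fun setT f by apply/measurable_EFinP; exact: measurable_int fi.
have mc : measurable (cylinder N T : set (V * measurableTypeR R)) by exact: measurable_cylinder.
apply/integrableP; split.
  apply: measurable_funTS; apply/measurable_EFinP; exact: (measurableT_comp mf measurable_fst).
rewrite (integral_cylinder (F := fun p : V * R => `|(f p.1)%:E|%E))//; last first.
  apply: measurableT_comp => //; apply/measurable_EFinP; exact: (measurableT_comp mf measurable_fst).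
have /integrableP[_] := fi => hf.
rewrite (_ : (fun t : measurableTypeR R => _) = cst (\int[leb]_x `|(f x)%:E|)%E)// integral_cst//.
apply: lte_mul_pinfty => //.
- exact: integral_ge0.
- by rewrite ge0_fin_numE//; exact: integral_ge0.
- exact: lebesgue_itv_lty.
Qed.

Lemma cylinder_step_integral (G : nat -> V -> R) (g : V -> R) :
  (forall n, measurable_fun setT (G n)) -> leb.-integrable setT (EFin \o g) ->
  (forall n x, (n < L)%N -> `|G n x| <= g x) ->
  \int[lebesgue_rVxR N]_(p in cylinder N T) G (Num.truncn (p.2 / h)) p.1 =
  \sum_(n < L) h * \int[leb]_x G n x.
Proof.
move=> mG ig Gg.
have mc : measurable (cylinder N T : set (V * measurableTypeR R)) by exact: measurable_cylinder.
have mF := measurable_step_function h0 mG.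
pose F (p : V * measurableTypeR R) := (G (Num.truncn (p.2 / h)) p.1)%:E.
have nL (t : R) : 0 < t < T -> (Num.truncn (t / h) < L)%N.
  move=> /andP[t0 tT]; have th : 0 <= t / h by rewrite divr_ge0// ltW.
  by rewrite truncn_lt_nat// ltr_pdivrMr// mulrC hL.
have iF : (lebesgue_rVxR N).-integrable (cylinder N T) F.
  apply: le_integrable (integrable_cylinder ig) => //.
    by apply: measurable_funTS; apply/measurable_EFinP; exact: mF.
  move=> [x t] [_ /=]; rewrite in_itv/= => tT; rewrite lee_fin (le_trans (Gg _ _ _))//.
    exact: nL.
  exact: ler_norm.
rewrite /Rintegral integral_mkcond.
have iF' : (lebesgue_rVxR N).-integrable setT (F \_ (cylinder N T)) by apply/(integrable_mkcond F mc).
rewrite -(integral21_prod_meas1 iF').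
have -> : (\int[lebesgue_measure]_t fubini_G leb (F \_ (cylinder N T)) t =
   \int[lebesgue_measure]_(t in `]0%R, T[) (\int[leb]_x G (Num.truncn (t / h)) x)%:E)%E.
  rewrite [RHS]integral_mkcond; apply: eq_integral => t _.
  rewrite /fubini_G /patch; case: ifPn => tT.
    have iG : leb.-integrable setT (EFin \o G (Num.truncn (t / h))).
      apply: le_integrable ig => //; first exact/measurable_EFinP.
      move=> x _; rewrite lee_fin (le_trans (Gg _ _ _)) ?ler_norm//; apply: nL.
      by move: tT; rewrite inE/= in_itv.
    rewrite /Rintegral fineK//; last exact: integrable_fin_num iG.
    apply: eq_integral => x _; rewrite ifT// inE; split => //=.
    by move: tT; rewrite inE.
  rewrite integral0_eq// => x _; case: ifPn => //.
  by rewrite inE => -[_ /=] ht; move/negP: tT; rewrite inE.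
rewrite [X in fine X](_ : _ = (\sum_(n < L) h * \int[leb]_x G n x)%:E)//.
exact: (step_integral (fun n => \int[leb]_x G n x)).
Qed.

End step_integrals.

(** * The sequence of schemes and its limit *)

Section scheme.
Context (R : realType) (N : nat).
Local Notation V := 'rV[R]_N.
Local Notation leb := (@lebesgue_rV R N).
Variable mu : {measure set V -> \bar R}.
Hypothesis mu0 : mu [set 0] = 0%E.
Hypothesis mu_even : even_measure mu.
Hypothesis mu_levy : levy_integrable mu.
Local Notation trunc := (trunc mu_levy).
Variables (T M B : R) (phi : R -> R) (v0 : V -> R).
Hypothesis T0 : 0 < T.
Hypothesis mv0 : measurable_fun setT v0.
Hypothesis v0M : forall x, `|v0 x| <= M.
Hypothesis v0_fin : (\int[leb]_x `|v0 x|%:E < +oo)%E.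
Variables (phi_ : nat -> R -> R) (K_ : nat -> R) (L : nat -> nat).
Hypothesis phi_homo : forall k, {homo phi_ k : x y / x <= y}.
Hypothesis K0 : forall k, 0 <= K_ k.
Hypothesis phi_lip : forall k a b, `|phi_ k a - phi_ k b| <= K_ k * `|a - b|.
Hypothesis phi_close : forall k s, `|s| <= M -> `|phi_ k s - phi s| <= k.+1%:R^-1.
Hypothesis phi_le : forall k s, `|s| <= M -> `|phi_ k s| <= B.
Hypothesis L_gt : forall k, (k < L k)%N.
Hypothesis cfl : forall k, 4 * (T / (L k)%:R) * mass (trunc k) * K_ k <= 1.

(** A whole number of steps fills [0, T], so that summation by parts ends exactly where test
    functions vanish. *)
Definition time_step k := T / (L k)%:R.
Local Notation h := time_step.
Definition scheme k n := euler (trunc k) (phi_ k) (h k) v0 n.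
Definition interpolant k t x := scheme k (Num.truncn (t / h k)) x.
Local Notation w := interpolant.

Lemma L_gt0 k : (0 < L k)%N. Proof. exact: leq_ltn_trans (L_gt k). Qed.

Lemma time_step_gt0 k : 0 < h k. Proof. by rewrite divr_gt0// ltr0n L_gt0. Qed.
Local Notation h0 := time_step_gt0.
Local Notation h_ge0 k := (ltW (h0 k)).

Lemma time_stepE k : h k * (L k)%:R = T.
Proof. by rewrite /h divfK// pnatr_eq0 -lt0n L_gt0. Qed.

Lemma time_step_cvg : h @ \oo --> (0 : R).
Proof.
apply: (@squeeze_cvgr _ _ _ _ (cst 0) (fun k => T * k.+1%:R^-1)).
- apply: nearW => k; rewrite /cst (h_ge0 k)/= ler_wpM2l ?(ltW T0)// lef_pV2 ?posrE ?ltr0n ?L_gt0//.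
  by rewrite ler_nat L_gt.
- exact: cvg_cst.
- by rewrite -[X in _ --> X](mulr0 T); apply: cvgM; [exact: cvg_cst|exact: cvg_harmonic].
Qed.

Lemma B_ge0 : 0 <= B.
Proof. by apply: le_trans (phi_le 0 (v0M 0)). Qed.

Lemma measurable_scheme k n : measurable_fun setT (scheme k n).
Proof. exact: (measurable_euler _ _ (K0 k) (@phi_lip k)). Qed.

Lemma scheme_bounded k n x : `|scheme k n x| <= M.
Proof. exact: (euler_bounded (@phi_homo k) (K0 k) (@phi_lip k) (h_ge0 k) (cfl k)). Qed.

Lemma scheme_L1 k n : (\int[leb]_x `|scheme k n x|%:E <= \int[leb]_x `|v0 x|%:E)%E.
Proof. exact: (euler_L1 (@phi_homo k) (K0 k) (@phi_lip k) (h_ge0 k) (cfl k)). Qed.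

Lemma measurable_interpolant k : measurable_fun setT (fun p : V * R => w k p.2 p.1).
Proof. by apply: measurable_step_function; [exact: h0|exact: measurable_scheme]. Qed.

Lemma measurable_interpolant_at k t : measurable_fun setT (w k t).
Proof. exact: measurable_scheme. Qed.

Lemma interpolant_bounded k t x : `|w k t x| <= M.
Proof. exact: scheme_bounded. Qed.

Lemma interpolant_shift e : 0 < e -> exists2 r : R, 0 < r & forall y : V, `|y| <= r ->
  forall k t, (L1dist leb (fun x : V => w k t (x + y)%R) (w k t) <= e%:E)%E.
Proof.
move=> e0; have [r r0 hr] := translation_continuous (integrable_L1 mv0 v0_fin) e0.
exists r => // y yr k t; apply: le_trans (hr y yr).
exact: (euler_shift (@phi_homo k) (K0 k) (@phi_lip k) (h_ge0 k) (cfl k)).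
Qed.

(** The constant is B times the integral of [levy_dom], which depends neither on the truncation nor
    on x. *)
Lemma interpolant_time C C0 r omega : tame C C0 r omega -> exists2 A, 0 <= A &
  forall k s t x, 0 <= s -> 0 <= t ->
    `|smear w omega k t x - smear w omega k s x| <= A * (`|t - s| + h k).
Proof.
move=> to; have io := tame_integrable to; have mo := tame_measurable to.
have ob := tame_bounded to.
have ild := integrable_levy_dom mu_levy C C0 r.
have ld0 x : 0 <= levy_dom mu_levy C C0 r x.
  exact: le_trans (normr_ge0 _) (levyf_dom mu_even mu_levy to 0 x).
pose A := B * \int[leb]_x levy_dom mu_levy C C0 r x.
have A0 : 0 <= A by rewrite mulr_ge0 ?B_ge0// Rintegral_ge0.
exists A => // k s t x; wlog st : s t / s <= t => [hw|] s0 t0.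
  have [st|ts] := leP s t; first exact: hw.
  by rewrite distrC (distrC t); apply: hw => //; exact: ltW.
have mx : measurable_fun setT (fun y : V => v0 (y + x)) by exact: measurable_shift.
(* The translation by x goes into the initial datum, since the scheme commutes with it; the kernel
   stays in place with its [tame] constants. *)
have E n : (fun y : V => scheme k n (y + x)) = euler (trunc k) (phi_ k) (h k) (fun y => v0 (y + x)) n.
  by rewrite /scheme /euler; elim: n => //= n <-; rewrite euler_step_shift.
have S t' : smear w omega k t' x =
    \int[leb]_y (euler (trunc k) (phi_ k) (h k) (fun y => v0 (y + x)) (Num.truncn (t' / h k)) y * omega y).
  by rewrite -E /smear; apply: eq_Rintegral => y _; rewrite addrC.
rewrite !S.
have le_st : (Num.truncn (s / h k) <= Num.truncn (t / h k))%N.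
  by apply: le_truncn; rewrite ler_pM2r ?invr_gt0// h0.
rewrite -[X in euler _ _ _ _ X](subnKC le_st).
apply: (le_trans (euler_time (trunc_even mu_even mu_levy k) (@phi_homo k) (K0 k) (@phi_lip k) (h_ge0 k)
  (cfl k) mx (fun y => v0M (y + x)) _ _ mo ob io (@phi_le k))).
rewrite mulrC ler_pM//.
- by rewrite mulr_ge0 ?B_ge0// Rintegral_ge0.
- by rewrite mulrn_wge0// (h_ge0 k).
- rewrite ler_wpM2l ?B_ge0//; apply: le_Rintegral => //.
    exact: (integrable_norm (integrable_levyf _ io ob)).
  by move=> y _; exact: levyf_dom.
- exact: truncn_dist (h0 k) s0 st.
Qed.

Lemma interpolant_fast_subsequence : exists n : nat -> nat, (forall j, (j <= n j)%N) /\
  forall j t, 0 <= t <= T ->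
    (\int[leb]_(x in cube j%:R) `|w (n j) t x - w (n j.+1) t x|%:E <= (2^-1 ^+ j)%:E)%E.
Proof.
exact: (fast_subsequence T measurable_interpolant_at interpolant_bounded interpolant_shift interpolant_time time_step_cvg).
Qed.

Lemma phi_continuous k : continuous (phi_ k).
Proof.
move=> a; apply/cvgrPdist_le => e e0.
have K1 : 0 < K_ k + 1 by rewrite ltr_wpDl.
have : \forall b \near a, `|a - b| <= e / (K_ k + 1).
  by apply: (@cvgr_dist_le _ _ _ (nbhs a) _ id a cvg_id); rewrite divr_gt0.
apply: filterS => b ab; apply: (le_trans (phi_lip _ _ _)).
apply: (@le_trans _ _ ((K_ k + 1) * `|a - b|)); first by rewrite ler_wpM2r// lerDl.
by rewrite mulrC -ler_pdivlMr.
Qed.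

(** The constant is 4 times 2 B: the 4 undoes the h/4 of the energy step, and 2 B bounds phi_k(v0) -
    phi_k(0), hence Phi(v0) <= 2 B |v0|. *)
Lemma scheme_energy k n :
  (\sum_(i < n) (h k)%:E * \int[leb]_x (sqdiff (trunc k) (phi_ k \o scheme k i) x)%:E <=
   (8 * B)%:E * \int[leb]_x `|v0 x|%:E)%E.
Proof.
have M0 : 0 <= M by exact: le_trans (v0M 0).
have [Phi [mPhi Phi0 Phis Phi00]] := convex_primitive (@phi_continuous k) (@phi_homo k) M0.
have := euler_energy (@phi_homo k) (K0 k) (@phi_lip k) (h_ge0 k)
  (cfl k) mv0 v0M v0_fin mPhi Phi0 Phis n.
set S := (\sum_(i < n) _)%E => hS.
have S0 : (S <= (2 * B)%:E * \int[leb]_x `|v0 x|%:E)%E.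
  apply: (@le_trans _ _ (\int[leb]_x (Phi (v0 x))%:E)%E).
    apply: le_trans hS; rewrite leeDr//; apply: integral_ge0 => x _.
    by rewrite lee_fin Phi0// scheme_bounded.
  rewrite -ge0_integralZl//; last 2 first.
  - by apply/measurable_EFinP; exact: measurableT_comp.
  - by rewrite lee_fin mulr_ge0 ?B_ge0.
  apply: ge0_le_integral => //.
  - by move=> x _; rewrite lee_fin Phi0.
  - by apply/measurable_EFinP; exact: measurableT_comp.
  - by apply: measurable_funeM; apply/measurable_EFinP; exact: measurableT_comp.
  - move=> x _; rewrite -EFinM lee_fin.
    have := Phis 0 (v0 x); rewrite normr0 Phi00 !subr0 => /(_ M0 (v0M x)) h1.
    apply: (le_trans h1); apply: (le_trans (ler_norm _)); rewrite normrM ler_wpM2r//.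
    apply: (le_trans (ler_normB _ _)); rewrite mulr_natl mulr2n lerD ?phi_le// normr0//.
rewrite [leLHS](_ : _ = 4%:E * S)%E; last first.
  rewrite ge0_sume_distrr; last first.
    move=> i _; apply: mule_ge0; first by rewrite lee_fin divr_ge0// (h_ge0 k).
    by apply: integral_ge0 => x _; rewrite lee_fin sqdiff_ge0.
  by apply: eq_bigr => i _; rewrite muleA -EFinM; congr (_%:E * _)%E; field.
rewrite (_ : 8 * B = 4 * (2 * B)); last by ring.
by rewrite EFinM -muleA lee_wpmul2l.
Qed.

Lemma scheme_weak k n (psi : V -> R) D : measurable_fun setT psi -> (forall x, `|psi x| <= D) ->
  leb.-integrable setT (EFin \o psi) ->
  \int[leb]_x (scheme k n.+1 x * psi x) =
  \int[leb]_x (scheme k n x * psi x) + h k * \int[leb]_x (phi_ k (scheme k n x) * levyf (trunc k) psi x).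
Proof.
exact: (euler_weak (trunc_even mu_even mu_levy k) (@phi_homo k) (K0 k) (@phi_lip k) (h_ge0 k) (cfl k)).
Qed.

Section subsequence.
Hypothesis phi_cont : continuous phi.
Variable n : nat -> nat.
Hypothesis n_ge : forall j, (j <= n j)%N.
Hypothesis n_fast : forall j t, 0 <= t <= T ->
  (\int[leb]_(x in cube j%:R) `|w (n j) t x - w (n j.+1) t x|%:E <= (2^-1 ^+ j)%:E)%E.

Definition solution := limit_fun (fun j => w (n j)) M.
Local Notation u := solution.

Lemma measurable_solution : measurable_fun setT u.
Proof. by apply: measurable_limit_fun => j; exact: measurable_interpolant. Qed.

Lemma solution_bounded p : `|u p| <= M.
Proof. by apply: limit_fun_bounded => j t x; exact: interpolant_bounded. Qed.

Lemma solution_ae t : 0 <= t <= T -> {ae leb, forall x, w (n j) t x @[j --> \oo] --> u (x, t)}.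
Proof.
by apply: limit_fun_ae => // [j|j s x]; [exact: measurable_interpolant|exact: interpolant_bounded].
Qed.

Lemma solution_ae_cylinder :
  {ae lebesgue_rVxR N, forall p, cylinder N T p -> w (n j) p.2 p.1 @[j --> \oo] --> u p}.
Proof.
by apply: limit_fun_ae_cylinder => // [j|j s x]; [exact: measurable_interpolant|exact: interpolant_bounded].
Qed.

Lemma subsequence_cvg (a : nat -> R) (l : R) : a @ \oo --> l -> (a \o n) @ \oo --> l.
Proof.
move=> al; apply: cvg_comp al; move=> A [m _ mA]; exists m => // j /= mj.
by apply: mA => /=; exact: leq_trans mj (n_ge j).
Qed.

(** Uniform closeness of [phi_ k] to [phi] on [-M, M] allows the argument and the nonlinearity to
    vary together. *)
Lemma phi_cvg (a : nat -> R) (l : R) : (forall j, `|a j| <= M) -> a @ \oo --> l ->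
  phi_ (n j) (a j) @[j --> \oo] --> phi l.
Proof.
move=> aM al.
rewrite (_ : (fun j => _) = (fun j => (phi_ (n j) (a j) - phi (a j)) + phi (a j))); last first.
  by apply/funext => j; rewrite subrK.
rewrite -[X in _ --> X]add0r; apply: cvgD; last by (apply: cvg_comp al _; exact: phi_cont).
apply/norm_cvg0P.
have c0 : (fun j => (n j).+1%:R^-1) @ \oo --> (0 : R) by exact: (subsequence_cvg (@cvg_harmonic R)).
apply: (squeeze_cvgr _ (cvg_cst 0) c0).
by apply: nearW => j; rewrite /= normr_ge0 phi_close.
Qed.

(** * Passage to the limit in the weak formulation *)

Section weak_formulation.
Variable psi : V * R -> R.
Hypothesis psi_test : test_function T psi.
Local Notation "'psi_at' t" := (fun x : V => psi (x, t)) (at level 10).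

(** The discrete weak integrand. The operator acts on the test function at the right end of the time
    cell: this is what the product rule for differences leaves beside the forward quotient. *)
Definition scheme_integrand k m x :=
  scheme k m x * ((psi (x, m.+1%:R * h k) - psi (x, m%:R * h k)) / h k) +
  phi_ k (scheme k m x) * levyf (trunc k) (psi_at (m.+1%:R * h k)) x.

Lemma measurable_phi_scheme k m : measurable_fun setT (phi_ k \o scheme k m).
Proof. exact: (measurable_phi_comp (K0 k) (@phi_lip k) (measurable_scheme k m)). Qed.

(** With the pairing of the m-th iterate against psi at time m h, each summand is a difference of
    consecutive pairings. The sum telescopes, and the last pairing is 0. *)
Lemma scheme_discrete_weak k :
  \sum_(m < L k) h k * \int[leb]_x scheme_integrand k m x = - \int[leb]_x (v0 x * psi (x, 0)).
Proof.
have [C [C0 [r [tpsi _]]]] := test_tame psi_test.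
have ipsi t := tame_integrable (tpsi t); have mpsi t := tame_measurable (tpsi t).
have bpsi t := tame_bounded (tpsi t).
pose a m := \int[leb]_x (scheme k m x * psi (x, m%:R * h k)).
have iU m t : leb.-integrable setT (EFin \o (fun x => scheme k m x * psi (x, t))).
  exact: (integrable_boundedM (measurable_scheme k m) (scheme_bounded k m) (ipsi t)).
have hn : h k != 0 by rewrite gt_eqF ?(h0 k).
have E m : h k * \int[leb]_x scheme_integrand k m x = a m.+1 - a m.
  rewrite /a (scheme_weak k m (mpsi _) (bpsi _) (ipsi _)).
  set s := m.+1%:R * h k; set s' := m%:R * h k.
  have iW : leb.-integrable setT (EFin \o (fun x => phi_ k (scheme k m x) * levyf (trunc k) (psi_at s) x)).
    apply: (integrable_boundedM (measurable_phi_scheme k m) (C := B)).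
      by move=> x; apply: phi_le; exact: scheme_bounded.
    exact: (integrable_levyf (trunc k) (ipsi s) (bpsi s)).
  have iD : leb.-integrable setT (EFin \o (fun x => scheme k m x * psi (x, s) - scheme k m x * psi (x, s'))).
    by have := integrableB measurableT (iU m s) (iU m s'); apply: eq_integrable.
  rewrite -addrAC -(RintegralB measurableT (iU m s) (iU m s')) -RintegralZl//.
    rewrite -RintegralZl// -RintegralD//.
      by apply: eq_Rintegral => x _; rewrite /scheme_integrand -/s -/s'; field.
    by have := integrableZl measurableT (h k) iW; apply: eq_integrable.
  have := integrableD measurableT (integrableZl measurableT (h k)^-1 iD) iW.
  apply: eq_integrable => // x _; rewrite /scheme_integrand -/s -/s' /=; congr EFin; field.
  exact: hn.
rewrite (eq_bigr (fun m : 'I_(L k) => a m.+1 - a m)) => [|m _]; last exact: E.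
rewrite -(big_mkord xpredT (fun m => a m.+1 - a m)) telescope_sumr//.
have -> : a (L k) = 0.
  rewrite /a mulrC time_stepE /Rintegral integral0_eq// => x _.
  by rewrite (test_final psi_test) mulr0.
by rewrite sub0r /a mul0r.
Qed.

(** The mean value theorem replaces the difference quotient by a time derivative, bounded and
    supported in a cube; [levy_dom] controls the operator. *)
Lemma scheme_integrand_dominated : exists2 g : V -> R, leb.-integrable setT (EFin \o g) &
  forall k m x, `|scheme_integrand k m x| <= g x.
Proof.
have [C [C0 [r [tpsi _]]]] := test_tame psi_test.
have [B1 [r1 [B10 r10 hB1]]] := time_derivative_bounded psi_test.
exists (fun x => M * (B1 * \1_(cube r1) x) + B * levy_dom mu_levy C C0 r x).
  have i1 := integrableZl measurableT M (integrableZl measurableT B1 (integrable_cube_indic N r1)).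
  have := integrableD measurableT i1 (integrableZl measurableT B (integrable_levy_dom mu_levy C C0 r)).
  by apply: eq_integrable.
move=> k m x; rewrite (le_trans (ler_normD _ _))// lerD//; rewrite normrM.
  rewrite ler_pM ?scheme_bounded//.
  have lt_s : m%:R * h k < m.+1%:R * h k by rewrite ltr_pM2r ?(h0 k)// ltr_nat.
  have [c _ ->] := time_mvt psi_test x lt_s.
  rewrite -mulrBl -natrB// subSnn mul1r mulfK ?gt_eqF ?(h0 k)//.
rewrite ler_pM ?phi_le ?scheme_bounded//.
exact: levyf_dom.
Qed.

(** Serves the joint measurability of the limit operator, obtained as a pointwise limit of these
    functions. *)
Lemma measurable_levyf_trunc k : measurable_fun setT (fun p : V * R => levyf (trunc k) (psi_at p.2) p.1).
Proof.
have mpsi := continuous_measurable_prod (test_continuous psi_test).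
apply: measurable_funB; last first.
  apply: measurable_funM => //; apply: (measurableT_comp mpsi).
  by apply: measurable_fun_pair; [exact: measurable_fst|exact: measurable_snd].
apply: (@measurable_fun_Rintegral _ _ _ _ R (trunc k) (fun q : (V * R) * V => psi (q.1.1 + q.2, q.1.2))).
apply: (measurableT_comp mpsi); apply: measurable_fun_pair.
  apply: measurable_fun_addrV; last exact: measurable_snd.
  exact: (measurableT_comp measurable_fst measurable_fst).
exact: (measurableT_comp measurable_snd measurable_fst).
Qed.

Lemma levyf_trunc_cvg p : levyf (trunc k) (psi_at p.2) p.1 @[k --> \oo] --> levy_op mu (psi_at p.2) p.1.
Proof.
have [C [C0 [r [tpsi taylor]]]] := test_tame psi_test.
apply: (@levy_op_cvg R N mu mu_even mu_levy C C0 r C (fun=> psi_at p.2) (psi_at p.2) id p.1) => //.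
by move=> y; exact: cvg_cst.
Qed.

Lemma scheme_integrand_cvg x t : 0 < t < T -> w (n j) t x @[j --> \oo] --> u (x, t) ->
  scheme_integrand (n j) (Num.truncn (t / h (n j))) x @[j --> \oo] -->
  u (x, t) * derive1 (fun s => psi (x, s)) t + phi (u (x, t)) * levy_op mu (psi_at t) x.
Proof.
move=> /andP[t0 tT] wu.
have [C [C0 [r [tpsi taylor]]]] := test_tame psi_test.
pose m j := Num.truncn (t / h (n j)).
have hc : (h \o n) @ \oo --> (0 : R) by exact: (subsequence_cvg time_step_cvg).
(* Any choice of points in the cells containing t converges to t, as the cells shrink. It is applied
   to mean value points and to right endpoints. *)
have near_t (c : nat -> R) : (forall j, (m j)%:R * h (n j) <= c j <= (m j).+1%:R * h (n j)) -> c @ \oo --> t.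
  move=> cm; apply/subr_cvg0/norm_cvg0P; apply: (squeeze_cvgr _ (cvg_cst 0) hc).
  apply: nearW => j; rewrite normr_ge0/=.
  have th : 0 <= t / h (n j) by rewrite divr_ge0 ?(h_ge0 _)// ltW.
  have /andP[+ +] := truncn_itv th; rewrite -/(m j) ler_pdivlMr ?(h0 _)// ltr_pdivrMr ?(h0 _)//.
  have /andP[] := cm j; rewrite -[(m j).+1]addn1 natrD mulrDl mul1r ler_norml => ? ? ? ?.
  by apply/andP; split; lra.
apply: cvgD; apply: cvgM.
- exact: wu.
- have hmvt j : exists c, (m j)%:R * h (n j) <= c <= (m j).+1%:R * h (n j) /\
      (psi (x, (m j).+1%:R * h (n j)) - psi (x, (m j)%:R * h (n j))) / h (n j) = derive1 (fun s => psi (x, s)) c.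
    have lt_s : (m j)%:R * h (n j) < (m j).+1%:R * h (n j) by rewrite ltr_pM2r ?(h0 _)// ltr_nat.
    have [c /andP[c1 c2] ->] := time_mvt psi_test x lt_s.
    exists c; split; first by rewrite !ltW.
    by rewrite -mulrBl -natrB// subSnn mul1r mulfK ?gt_eqF ?(h0 _).
  have [c hc'] := choice hmvt.
  rewrite (_ : (fun j => _) = (fun j => derive1 (fun s => psi (x, s)) (c j))); last first.
    by apply/funext => j; have [_ ->] := hc' j.
  have ct : c @ \oo --> t by apply: near_t => j; have [] := hc' j.
  have cp : (fun j => (x, c j)) @ \oo --> (x, t).
    apply: (@cvg_pair nat _ _ \oo (nbhs x) (nbhs t) _ _ _ (cst x) c); [exact: cvg_cst|exact: ct].
  apply: (@cvg_comp _ _ _ (fun j => (x, c j)) (fun p : V * R => derive1 (fun s => psi (p.1, s)) p.2) \oo _ _ cp).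
  exact: (time_derivative_continuous psi_test (x := (x, t))).
- by apply: phi_cvg => // j; exact: interpolant_bounded.
- apply: (@levy_op_cvg R N mu mu_even mu_levy C C0 r C (fun j => psi_at ((m j).+1%:R * h (n j))) (psi_at t) n x) => //.
  move=> y.
  have ct : (fun j => (m j).+1%:R * h (n j)) @ \oo --> t.
    by apply: near_t => j; rewrite lexx andbT ler_wpM2r ?(h_ge0 _)// ler_nat.
  have cp : (fun j => (y, (m j).+1%:R * h (n j))) @ \oo --> (y, t).
    apply: (@cvg_pair nat _ _ \oo (nbhs y) (nbhs t) _ _ _ (cst y) (fun j => (m j).+1%:R * h (n j))); [exact: cvg_cst|exact: ct].
  apply: (@cvg_comp _ _ _ (fun j => (y, (m j).+1%:R * h (n j))) psi \oo _ _ cp).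
  exact: (test_continuous psi_test (x := (y, t))).
Qed.

Lemma solution_weak :
  (\int[lebesgue_rVxR N]_(p in cylinder N T)
     (u p * derive1 (fun s => psi (p.1, s)) p.2 +
      phi (u p) * levy_op mu (fun x => psi (x, p.2)) p.1)%:E =
   (- \int[leb]_x (v0 x * psi (x, 0)))%:E)%E.
Proof.
have mc : measurable (cylinder N T : set (V * measurableTypeR R)) by exact: measurable_cylinder.
have [g ig Gg] := scheme_integrand_dominated.
have mG k m : measurable_fun setT (scheme_integrand k m).
  have [C [C0 [r [tpsi _]]]] := test_tame psi_test.
  apply: measurable_funD; apply: measurable_funM.
  - exact: measurable_scheme.
  - apply: measurable_funM => //.
    by apply: measurable_funB; exact: tame_measurable (tpsi _).
  - exact: measurable_phi_scheme.
  - by apply: measurable_levyf; exact: tame_measurable (tpsi _).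
pose F_ j (p : V * measurableTypeR R) := scheme_integrand (n j) (Num.truncn (p.2 / h (n j))) p.1.
pose F (p : V * measurableTypeR R) := u p * derive1 (fun s => psi (p.1, s)) p.2 +
      phi (u p) * levy_op mu (fun x => psi (x, p.2)) p.1.
have mF : measurable_fun setT F.
  apply: measurable_funD; apply: measurable_funM.
  - exact: measurable_solution.
  - exact: (continuous_measurable_prod (time_derivative_continuous psi_test)).
  - apply: (measurableT_comp (continuous_measurable_fun phi_cont)); exact: measurable_solution.
  - by apply: measurable_fun_cvg measurable_levyf_trunc _ => p _; exact: levyf_trunc_cvg.
have [iF cF] : (lebesgue_rVxR N).-integrable (cylinder N T) (EFin \o F) /\
    \int[lebesgue_rVxR N]_(p in cylinder N T) F_ j p @[j --> \oo] -->
    \int[lebesgue_rVxR N]_(p in cylinder N T) F p.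
  apply: (Rintegral_dominated mc _ _ _ (integrable_cylinder T ig)).
  - by move=> j; apply: measurable_funTS; exact: measurable_step_function (h0 _) (mG _).
  - exact: measurable_funTS mF.
  - have := solution_ae_cylinder; apply: (@filterS _ _ (ae_filter_ringOfSetsType (leb \x lebesgue_measure)%E)) => -[x t] hp cp.
    apply: scheme_integrand_cvg; last exact: hp.
    by case: cp => _ /=; rewrite in_itv.
  - by move=> j p _; exact: Gg.
transitivity (\int[lebesgue_rVxR N]_(p in cylinder N T) F p)%:E.
  by rewrite /Rintegral fineK//; exact: integrable_fin_num iF.
congr EFin; rewrite -(cvg_lim (@Rhausdorff R) cF); apply: cvg_lim => //.
(* The integrals along the subsequence are a constant sequence, by the exact discrete identity, so
   their limit is that constant. *)
apply: cvg_near_cst; apply: nearW => j.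
rewrite (@cylinder_step_integral R N T (h (n j)) (L (n j)) (h0 _) (time_stepE _) (scheme_integrand (n j)) g)//.
exact: scheme_discrete_weak.
Qed.

End weak_formulation.
(* A copy of [mu] to carry the sigma-finite structure that Fubini's theorem
   requires; it is convertible to [mu]. *)
Definition levy_copy (A : set V) : \bar R := mu A.

HB.instance Definition _ := isMeasure.Build _ _ _ levy_copy
  (measure0 mu) (measure_ge0 mu) (@measure_semi_sigma_additive _ _ _ mu).

HB.instance Definition _ := @Measure_isSigmaFinite.Build _ _ _ levy_copy
  (sigma_finite_levy mu0 mu_levy).

Local Notation mu' := (levy_copy : {sigma_finite_measure set V -> \bar R}).

(** Twice the energy density on the product of (t, z) and x, in this order: Fatou is applied in x
    for fixed (t, z) and afterwards in (t, z). Indicators encode the domains, so that the truncated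
    region may vary with the index. *)
Definition increment_energy (D : set V) (f : V * R -> R) (q : (measurableTypeR R * V) * V) : R :=
  \1_(`]0, T[%classic : set R) q.1.1 *
  (\1_D q.1.2 * (f (q.2 + q.1.2, q.1.1) - f (q.2, q.1.1)) ^+ 2).

Lemma increment_energy_ge0 D f q : 0 <= increment_energy D f q.
Proof. by apply: mulr_ge0 => //; apply: mulr_ge0 => //; exact: sqr_ge0. Qed.

Lemma measurable_increment_energy D f : measurable D -> measurable_fun setT f ->
  measurable_fun setT (increment_energy D f).
Proof.
move=> mD mf; have m1 : measurable_fun setT (fun q : (measurableTypeR R * V) * V => q.1.1).
  exact: (measurableT_comp measurable_fst measurable_fst).
have m2 : measurable_fun setT (fun q : (measurableTypeR R * V) * V => q.1.2).
  exact: (measurableT_comp measurable_snd measurable_fst).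
apply: measurable_funM.
  apply: (measurableT_comp (f := \1_(`]0, T[%classic : set R) : measurableTypeR R -> R)); last exact: m1.
  by apply: measurable_indic; exact: measurable_itv.
apply: measurable_funM.
  by apply: (measurableT_comp (f := \1_D : V -> R)); [exact: measurable_indic|exact: m2].
apply: measurable_funX; apply: measurable_funB.
  apply: (measurableT_comp (f := f)) => //; apply: measurable_fun_pair => //.
  by apply: measurable_fun_addrV => //; exact: measurable_snd.
by apply: (measurableT_comp (f := f)) => //; apply: measurable_fun_pair => //; exact: measurable_snd.
Qed.

Lemma increment_energy_swap D f t : measurable D -> measurable_fun setT f -> t \in `]0, T[ ->
  (\int[mu]_z \int[leb]_x (increment_energy D f ((t, z), x))%:E =
   \int[leb]_x \int[mu]_(z in D) ((f (x + z, t) - f (x, t)) ^+ 2)%:E)%E.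
Proof.
move=> mD mf tT.
pose H (p : V * V) := (increment_energy D f ((t, p.1), p.2))%:E.
have mH : measurable_fun setT H.
  apply/measurable_EFinP; apply: (measurableT_comp (measurable_increment_energy mD mf)).
  apply: measurable_fun_pair; last exact: measurable_snd.
  by apply: measurable_fun_pair => //; exact: measurable_fst.
have H0 p : (0 <= H p)%E by rewrite lee_fin increment_energy_ge0.
rewrite [LHS](@fubini_tonelli _ _ _ _ _ mu' leb H mH H0).
apply: eq_integral => x _; rewrite [RHS]integral_mkcond; apply: eq_integral => z _.
rewrite /H /increment_energy /= indicE mem_set// mul1r /patch indicE.
by case: ifP => _; rewrite ?mul1r ?mul0r.
Qed.

Definition scheme_phi j (p : V * R) := phi_ (n j) (w (n j) p.2 p.1).
Definition solution_phi (p : V * R) := phi (u p).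

Lemma measurable_scheme_phi j : measurable_fun setT (scheme_phi j).
Proof.
apply: (measurableT_comp (continuous_measurable_fun (@phi_continuous (n j)))).
exact: measurable_interpolant.
Qed.

Lemma measurable_solution_phi : measurable_fun setT solution_phi.
Proof.
by apply: (measurableT_comp (continuous_measurable_fun phi_cont)); exact: measurable_solution.
Qed.

Let pos : set V := [set z | 0 < enorm z].

Let mpos : measurable pos.
Proof. exact: measurable_ball_enorm. Qed.

Lemma far_indic_cvg (z : V) : \1_(far (n j)) z @[j --> \oo] --> (\1_pos z : R).
Proof.
rewrite [\1_pos z]indicE; have [z0|z0] := boolP (z \in pos); last first.
  apply: cvg_near_cst; apply: nearW => j; rewrite indicE memNset// => zf.
  by case/negP: z0; rewrite inE; apply: lt_trans zf; rewrite invr_gt0.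
apply: cvg_near_cst; move: z0; rewrite inE => z0.
have := @near_infty_natSinv_lt R (PosNum z0); apply: filterS => j /= jz.
rewrite indicE mem_set// /far/=; apply: le_lt_trans jz.
by rewrite lef_pV2 ?posrE// ler_nat ltnS.
Qed.

(** For fixed (t, z), almost every x has convergence at both x and x + z by translation invariance,
    and the indicators of the truncated regions converge for every z. *)
Lemma increment_energy_fatou p :
  (\int[leb]_x (increment_energy pos solution_phi (p, x))%:E <=
   limn_einf (fun j => \int[leb]_x (increment_energy (far (n j)) (scheme_phi j) (p, x))%:E))%E.
Proof.
apply: (fatou_ae measurableT (f_ := fun j x => increment_energy (far (n j)) (scheme_phi j) (p, x))).
- move=> j; apply: (measurableT_comp (measurable_increment_energy (measurable_far _) (measurable_scheme_phi j))).
  exact: measurable_pair1.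
- apply: (measurableT_comp (measurable_increment_energy mpos measurable_solution_phi)).
  exact: measurable_pair1.
- by move=> j x _; exact: increment_energy_ge0.
- by move=> x _; exact: increment_energy_ge0.
case: p => t z; have [tT|tT] := boolP (t \in (`]0, T[%classic : set R)); last first.
  apply: aeW => x _; rewrite /increment_energy /=; apply: cvg_near_cst; apply: nearW => j.
  by rewrite indicE (negbTE tT) !mul0r.
have t0T : 0 <= t <= T by move: tT; rewrite inE/= in_itv/= => /andP[? ?]; rewrite !ltW.
have h1 := solution_ae t0T; have h2 := ae_shift z h1.
move: h1 h2; apply: filterS2 => x cx cxz _.
rewrite /increment_energy; apply: cvgM; first exact: cvg_cst.
apply: cvgM; first exact: far_indic_cvg.
have c1 : scheme_phi j (x + z, t) @[j --> \oo] --> solution_phi (x + z, t).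
  by apply: phi_cvg => // j; exact: interpolant_bounded.
have c2 : scheme_phi j (x, t) @[j --> \oo] --> solution_phi (x, t).
  by apply: phi_cvg => // j; exact: interpolant_bounded.
by apply: (cvgM (cvgB c1 c2) (cvgB c1 c2)).
Qed.

Lemma integral_sqdiff k m x : (\int[mu]_(z in far k)
    ((phi_ k (scheme k m (x + z)) - phi_ k (scheme k m x)) ^+ 2)%:E =
  (sqdiff (trunc k) (phi_ k \o scheme k m) x)%:E)%E.
Proof.
have mw := measurable_phi_scheme k m.
have mq : measurable_fun setT (fun z : V => (phi_ k (scheme k m (x + z)) - phi_ k (scheme k m x)) ^+ 2).
  apply: measurable_funX; apply: measurable_funB => //.
  exact: (measurable_shiftl x mw).
rewrite /sqdiff /Rintegral fineK; last first.
  apply: integrable_fin_num => //.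
  apply: (@bounded_integrable _ _ R (trunc k) _ ((2 * B) ^+ 2)) => // z.
  rewrite ger0_norm ?sqr_ge0// -[leLHS]real_normK ?num_real// ler_pXn2r ?nnegrE ?mulr_ge0 ?B_ge0//.
  rewrite (le_trans (ler_normB _ _))// mulr_natl mulr2n lerD// phi_le// scheme_bounded//.
rewrite ge0_integral_mfrestr//; first exact/measurable_EFinP.
by move=> z; rewrite lee_fin sqr_ge0.
Qed.

Lemma scheme_increment_energy j :
  (\int[lebesgue_measure \x mu']_p \int[leb]_x (increment_energy (far (n j)) (scheme_phi j) (p, x))%:E <=
   (8 * B)%:E * \int[leb]_x `|v0 x|%:E)%E.
Proof.
set k := n j.
have mE := measurable_increment_energy (measurable_far k) (measurable_scheme_phi j).
pose G (p : measurableTypeR R * V) := (\int[leb]_x (increment_energy (far k) (scheme_phi j) (p, x))%:E)%E.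
have mG : measurable_fun setT G.
  apply: (@measurable_fun_fubini_tonelli_F _ _ _ _ _ leb (fun q => (increment_energy (far k) (scheme_phi j) q)%:E)).
    exact/measurable_EFinP.
  by move=> q; rewrite lee_fin increment_energy_ge0.
have G0 p : (0 <= G p)%E.
  by apply: integral_ge0 => x _; rewrite lee_fin increment_energy_ge0.
rewrite (@fubini_tonelli1 _ _ _ _ _ lebesgue_measure mu' G mG G0).
pose s m := (\int[leb]_x (sqdiff (trunc k) (phi_ k \o scheme k m) x)%:E)%E.
have s0 m : (0 <= s m)%E by apply: integral_ge0 => x _; rewrite lee_fin sqdiff_ge0.
have bound m := scheme_energy k m.
(* A positive multiple of [s m] is a summand of a finite energy sum; finiteness is required because
   [step_integral] is about real values. *)
have sfin m : s m \is a fin_num.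
  rewrite ge0_fin_numE//; have hk := h0 k.
  have lt1 : ((h k)%:E * s m < +oo)%E.
    apply: (@le_lt_trans _ _ ((8 * B)%:E * \int[leb]_x `|v0 x|%:E)%E).
      apply: le_trans (bound m.+1); rewrite big_ord_recr /= leeDr//.
      by apply: sume_ge0 => i _; rewrite mule_ge0 ?s0// lee_fin (h_ge0 k).
    apply: lte_mul_pinfty => //; last by rewrite lee_fin mulr_ge0 ?B_ge0.
  by move: lt1; rewrite ltey; case: (s m) (s0 m) => //= _; rewrite gt0_muley// lte_fin.
have -> : (\int[lebesgue_measure]_t fubini_F mu' G t =
    \int[lebesgue_measure]_(t in `]0%R, T[) (fine (s (Num.truncn (t / h k))))%:E)%E.
  rewrite [RHS]integral_mkcond; apply: eq_integral => t _; rewrite /patch; case: ifPn => tT; last first.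
    rewrite /fubini_F integral0_eq// => z _; rewrite /G integral0_eq// => x _.
    by rewrite /increment_energy/= indicE (negbTE tT) mul0r.
  rewrite fineK// /fubini_F /G.
  have tT' : t \in `]0, T[ by move: tT; rewrite inE.
  rewrite [LHS](increment_energy_swap (measurable_far k) (measurable_scheme_phi j) tT').
  by apply: eq_integral => x _; rewrite -integral_sqdiff.
rewrite [leLHS](@step_integral R T (h k) (L k) (h0 k) (time_stepE k) (fun m => fine (s m))).
apply: le_trans (bound (L k)); rewrite -sumEFin; apply: lee_sum => m _.
by rewrite EFinM fineK.
Qed.

(** A second use of Fatou, in (t, z), combined with the bound on the schemes; Tonelli then restores
    the order of integration in [energy], whose factor 1/2 is carried along. *)
Lemma solution_energy : L2_energy T mu (phi \o u).
Proof.
split; first exact: measurable_funTS measurable_solution_phi.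
have mE := measurable_increment_energy mpos measurable_solution_phi.
pose G (p : measurableTypeR R * V) := (\int[leb]_x (increment_energy pos solution_phi (p, x))%:E)%E.
pose G_ j (p : measurableTypeR R * V) := (\int[leb]_x (increment_energy (far (n j)) (scheme_phi j) (p, x))%:E)%E.
have mG : measurable_fun setT G.
  apply: (@measurable_fun_fubini_tonelli_F _ _ _ _ _ leb (fun q => (increment_energy pos solution_phi q)%:E)).
    exact/measurable_EFinP.
  by move=> q; rewrite lee_fin increment_energy_ge0.
have G0 p : (0 <= G p)%E.
  by apply: integral_ge0 => x _; rewrite lee_fin increment_energy_ge0.
have mG_ j : measurable_fun setT (G_ j).
  apply: (@measurable_fun_fubini_tonelli_F _ _ _ _ _ leb
    (fun q => (increment_energy (far (n j)) (scheme_phi j) q)%:E)).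
    by apply/measurable_EFinP; exact: measurable_increment_energy (measurable_far _) (measurable_scheme_phi j).
  by move=> q; rewrite lee_fin increment_energy_ge0.
have G_0 j p : (0 <= G_ j p)%E.
  by apply: integral_ge0 => x _; rewrite lee_fin increment_energy_ge0.
have fin : (\int[lebesgue_measure \x mu']_p G p <= (8 * B)%:E * \int[leb]_x `|v0 x|%:E)%E.
  apply: (@le_trans _ _ (\int[lebesgue_measure \x mu']_p limn_einf (fun j => G_ j p))%E).
    apply: ge0_le_integral => //.
    - rewrite /limn_einf; apply: measurableT_comp => //.
      by apply: (measurable_fun_limn_esup (f := fun j p => - (G_ j p))%E) => j; exact: measurableT_comp (mG_ j).
    - by move=> p _; exact: increment_energy_fatou.
  apply: (le_trans (fatou _ measurableT mG_ (fun j p _ => G_0 j p))).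
  by apply: limn_einf_le_near; apply: nearW => j; exact: scheme_increment_energy.
have vfin : ((8 * B)%:E * \int[leb]_x `|v0 x|%:E < +oo)%E.
  by apply: lte_mul_pinfty => //; rewrite lee_fin mulr_ge0 ?B_ge0.
apply: le_lt_trans (_ : (2^-1)%:E * \int[lebesgue_measure \x mu']_p G p < +oo)%E; last first.
  apply: lte_mul_pinfty => //; exact: le_lt_trans fin vfin.
rewrite (@fubini_tonelli1 _ _ _ _ _ lebesgue_measure mu' G mG G0) -ge0_integralZl//; last 2 first.
- exact: (@measurable_fun_fubini_tonelli_F _ _ _ _ _ mu' G).
- by move=> t _; apply: integral_ge0.
rewrite le_eqVlt; apply/orP; left; apply/eqP.
rewrite [LHS]integral_mkcond; apply: eq_integral => t _; rewrite /patch; case: ifPn => tT; last first.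
  rewrite /fubini_F integral0_eq ?mule0// => z _; rewrite /G integral0_eq// => x _.
  by rewrite /increment_energy/= indicE (negbTE tT) mul0r.
have tT' : t \in `]0, T[ by move: tT; rewrite inE.
congr (_ * _)%E; rewrite [RHS](increment_energy_swap mpos measurable_solution_phi tT').
by apply: eq_integral => x _; apply: eq_integral => z _; rewrite expr2.
Qed.

(** * Integrability and time continuity of the limit *)

Lemma measurable_solution_at t : measurable_fun setT (fun x => u (x, t)).
Proof. exact: (measurableT_comp measurable_solution (measurable_pair2 t)). Qed.

Lemma solution_L1 t : 0 <= t <= T -> (\int[leb]_x `|u (x, t)|%:E <= \int[leb]_x `|v0 x|%:E)%E.
Proof.
move=> tT; apply: (fatou_le measurableT (f_ := fun j x => `|w (n j) t x|)) => //.
- by move=> j; apply: measurableT_comp => //; exact: measurable_interpolant_at.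
- by apply: measurableT_comp => //; exact: measurable_solution_at.
- by have := solution_ae tT; apply: filterS => x cx _; exact: cvg_norm.
- by apply: nearW => j; exact: scheme_L1.
Qed.

Lemma integrable_solution : (lebesgue_rVxR N).-integrable (cylinder N T) (EFin \o u).
Proof.
apply/integrableP; split.
  by apply: measurable_funTS; apply/measurable_EFinP; exact: measurable_solution.
have mn : measurable_fun setT (fun p : V * R => `|(u p)%:E|%E).
  by apply: measurableT_comp => //; apply/measurable_EFinP; exact: measurable_solution.
rewrite (integral_cylinder T mn)//.
apply: (@le_lt_trans _ _ (\int[lebesgue_measure]_(t in `]0%R, T[) (cst (\int[leb]_x `|v0 x|%:E) t))%E); last first.
  rewrite integral_cst//; apply: lte_mul_pinfty => //.
  - exact: integral_ge0.
  - by rewrite ge0_fin_numE//; exact: integral_ge0.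
  - exact: lebesgue_itv_lty.
apply: ge0_le_integral => //.
- by move=> t _; exact: integral_ge0.
- by apply: measurable_funTS; apply: (@measurable_fun_fubini_tonelli_G _ _ _ _ _ leb _ mn).
- move=> t; rewrite /= in_itv/= => /andP[t0 tT]; apply: solution_L1; by rewrite !ltW.
Qed.

Lemma compact_measurable_rV (K : set V) : compact K -> measurable K.
Proof.
move=> cK; rewrite -[K]setCK; apply: measurableC; apply: sub_sigma_algebra.
by rewrite openC; apply: compact_closed => //; exact: norm_hausdorff.
Qed.

(** The limit is its own continuous representative, being an almost everywhere limit at every time
    of [0, T], endpoints included. Fatou transfers the modulus of continuity in time. *)
Lemma solution_continuous : continuous_L1loc T u.
Proof.
have mn s t : measurable_fun setT (fun x : V => `|u (x, s) - u (x, t)|%:E).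
  by apply: measurable_normB; exact: measurable_solution_at.
exists (fun t x => u (x, t)); split.
- move=> t; rewrite in_itv/= => tT K cK.
  apply: (@integrableS _ _ _ leb setT) => //; first exact: compact_measurable_rV.
  by apply: integrable_L1; [exact: measurable_solution_at|exact: le_lt_trans (solution_L1 tT) v0_fin].
- move=> t; rewrite in_itv/= => tT K cK.
  have [j Kj] := compact_sub_cube cK.
  have mK := compact_measurable_rV cK; have mc := @measurable_cube R N j%:R.
  apply/cvge0P => [s|e e0]; first exact: integral_ge0.
  have [d d0 hd] := time_equicontinuity measurable_interpolant_at interpolant_bounded
    interpolant_shift interpolant_time j e0.
  have : \forall s \near t, `|t - s| <= d by exact: (@cvgr_dist_le _ _ _ (nbhs t) _ id t cvg_id _ d0).
  apply: filterS => s ts; rewrite /= in_itv/= => sT.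
  (* The restriction on the mesh in [time_equicontinuity] holds eventually, so the modulus of the
     limit has no mesh term. *)
  have hn : \forall j \near \oo, h (n j) <= d.
    have hc : (h \o n) @ \oo --> (0 : R) by exact: (subsequence_cvg time_step_cvg).
    have : \forall j \near \oo, `|0 - (h \o n) j| <= d by exact: (@cvgr_dist_le _ _ _ \oo _ _ _ hc _ d0).
    by apply: filterS => i; rewrite sub0r normrN => /(le_trans (ler_norm _)).
  apply: (fatou_le mK (f_ := fun i x => `|w (n i) s x - w (n i) t x|)) => //.
  - move=> i; apply: measurable_funTS; apply: measurableT_comp => //.
    by apply: measurable_funB; exact: measurable_interpolant_at.
  - apply: measurable_funTS; apply: measurableT_comp => //.
    by apply: measurable_funB; exact: measurable_solution_at.
  - have := solution_ae sT; have := solution_ae tT; apply: filterS2 => x c1 c2 _.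
    by apply: cvg_norm; exact: cvgB.
  - apply: filterS hn => i hi; have /andP[s0 _] := sT; have /andP[t0 _] := tT.
    apply: le_trans (hd (n i) t s t0 s0 _ hi); last by rewrite distrC.
    apply: ge0_subset_integral => //; apply: measurable_funTS; apply: measurable_normB;
      exact: measurable_interpolant_at.
- by apply: aeW => t _; exact: aeW.
Qed.

Let u_restricted : V * measurableTypeR R -> R := u \_ (cylinder N T).

Let measurable_u_restricted : measurable_fun setT u_restricted.
Proof.
have mc : measurable (cylinder N T : set (V * measurableTypeR R)) by exact: measurable_cylinder.
by apply/(measurable_restrictT _ _).1 => //; exact: measurable_funTS measurable_solution.
Qed.

Lemma Lfun1_solution : u \_ (cylinder N T) \in Lfun (lebesgue_rVxR N) 1.
Proof.
rewrite inE; apply/andP; split; rewrite inE; first exact: measurable_u_restricted.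
rewrite /= /finite_norm Lnorm1.
have /integrableP[_] := integrable_solution.
have -> : (\int[lebesgue_rVxR N]_(p in cylinder N T) `|(EFin \o u) p| =
    \int[lebesgue_rVxR N]_p `|(u_restricted p)%:E|)%E; last by [].
rewrite integral_mkcond; congr (integral _ _ _); apply: funext => p.
by rewrite /patch /u_restricted /patch /=; case: ifP => // _; rewrite normr0.
Qed.

Lemma Lfuny_solution : u \_ (cylinder N T) \in Lfun (lebesgue_rVxR N) +oo.
Proof.
rewrite inE; apply/andP; split; rewrite inE; first exact: measurable_u_restricted.
rewrite /= /finite_norm unlock; case: ifPn => _; last exact: ltry.
apply: (@le_lt_trans _ _ M%:E); last exact: ltry.
apply/ess_sup_inf.ess_supP; apply: aeW => p; rewrite /= lee_fin /patch; case: ifP => _; first exact: solution_bounded.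
by rewrite normr0 (le_trans _ (v0M 0)).
Qed.

End subsequence.
End scheme.

(** The scheme works with bounds valid at every point; clamping at the essential bound provides them
    and changes the datum on a null set only. *)
Lemma ae_bounded_representative (R : realType) (N : nat) (f : 'rV[R]_N -> R) :
  f \in Lfun (lebesgue_rV N) 1 -> f \in Lfun (lebesgue_rV N) +oo ->
  exists (g : 'rV[R]_N -> R) (M : R), [/\ measurable_fun setT g, forall x, `|g x| <= M,
    (\int[lebesgue_rV N]_x `|g x|%:E < +oo)%E & {ae lebesgue_rV N, forall x, f x = g x}].
Proof.
move=> /andP[]; rewrite !inE /= => mf; rewrite /finite_norm Lnorm1 => f1.
move=> /andP[]; rewrite !inE /= => _; rewrite /finite_norm unlock.
(* The norm of index infinity is an essential supremum when the space has positive measure and 0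
   otherwise; this selects the first case. *)
have l0 : (0 < lebesgue_rV N [set: 'rV[R]_N])%E.
  have c0 : (0 < lebesgue_rV N (@cube R N 1))%E.
    by rewrite lebesgue_cube// lte_fin prodr_gt0// => i _; rewrite addr_gt0.
  by apply: lt_le_trans c0 _; apply: le_measure; rewrite ?inE//; exact: measurable_cube.
rewrite l0 => fy; have [M0 fM0] := ess_sup_inf.ess_supr_bounded (f := fun x => `|f x|) fy.
pose M := Num.max 0 M0; pose g x := Num.max (- M) (Num.min M (f x)).
have M_0 : 0 <= M by rewrite /M le_max lexx.
have gM x : `|g x| <= M.
  by rewrite ler_norml /g le_max lexx/= ge_max ge_min lexx/= andbT (le_trans _ M_0)// oppr_le0.
have mg : measurable_fun setT g.
  exact: (measurable_maxr (measurable_cst (- M)) (measurable_minr (measurable_cst M) mf)).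
exists g, M; split => //; last first.
  apply: filterS fM0 => x fx; have : `|f x| <= M by rewrite /M le_max fx orbT.
  by rewrite ler_norml /g => /andP[h1 h2]; rewrite (min_idPr h2) (max_idPr h1).
apply: le_lt_trans f1; apply: ge0_le_integral => //.
- by apply/measurable_EFinP; exact: measurableT_comp.
- by apply/measurable_EFinP; exact: measurableT_comp.
- move=> x _; rewrite lee_fin /g; have [h|h] := leP M (f x).
    have -> : Num.max (- M) M = M by apply/max_idPr; lra.
    by rewrite !ger0_norm//; exact: le_trans h.
  have [h'|h'] := leP (f x) (- M); last by [].
  by rewrite normrN (ger0_norm M_0) ler0_norm; lra.
Qed.

Theorem theorem2p13 (R : realType) (N : nat) (T : R) (phi : R -> R)
    (mu : {measure set 'rV[R]_N -> \bar R}) (u0 : 'rV[R]_N -> R) :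
  (0 < N)%N -> 0 < T ->
  continuous phi -> {homo phi : x y / x <= y} ->
  radon_off0 mu -> even_measure mu -> levy_integrable mu ->
  u0 \in Lfun (lebesgue_rV N) 1 -> u0 \in Lfun (lebesgue_rV N) +oo ->
  exists u : 'rV[R]_N * R -> R,
    [/\ distributional_solution T mu phi u0 u,
        [/\ u \_ (cylinder N T) \in Lfun (lebesgue_rVxR N) 1,
            u \_ (cylinder N T) \in Lfun (lebesgue_rVxR N) +oo &
            continuous_L1loc T u] &
        L2_energy T mu (phi \o u)].
Proof.
move=> _ T0 phi_cont phi_mono [mu0 _ _] mu_even mu_levy u01 u0y.
have [v0 [M [mv0 v0M v0_fin u0v0]]] := ae_bounded_representative u01 u0y.
have M0 : 0 <= M by exact: le_trans (v0M 0).
have [phi_ hphi] := choice (fun k : nat => lipschitz_approximation phi_cont phi_mono M0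
  (ltac:(by rewrite invr_gt0) : 0 < k.+1%:R^-1)).
have [K_ {}hphi] := choice hphi.
have phi_homo k : {homo phi_ k : x y / x <= y} by have [] := hphi k.
have K0 k : 0 <= K_ k by have [] := hphi k.
have phi_lip k a b : `|phi_ k a - phi_ k b| <= K_ k * `|a - b| by have [_ _ + _] := hphi k; exact.
have phi_close k s : `|s| <= M -> `|phi_ k s - phi s| <= k.+1%:R^-1 by have [_ _ _] := hphi k; exact.
(* The summand 1 accounts for the approximation error 1/(k+1). *)
pose B := `|phi M| + `|phi (- M)| + 1.
have phi_le k s : `|s| <= M -> `|phi_ k s| <= B.
  move=> sM; rewrite -[phi_ k s](subrK (phi s)) (le_trans (ler_normD _ _))// addrC lerD//.
    exact: homo_bounded.
  by rewrite (le_trans (phi_close k s sM))// invf_le1// ler1n.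
(* The archimedean bound secures the step restriction; adding k and a successor secures [k < L k],
   hence steps tending to 0. *)
pose L k := (Num.bound (4 * T * mass (trunc mu_levy k) * K_ k) + k).+1.
have L_gt k : (k < L k)%N by rewrite ltnS leq_addl.
have cfl k : 4 * (T / (L k)%:R) * mass (trunc mu_levy k) * K_ k <= 1.
  have a0 : 0 <= 4 * T * mass (trunc mu_levy k) * K_ k by rewrite !mulr_ge0 ?mass_ge0// ltW.
  rewrite (_ : _ * K_ k = 4 * T * mass (trunc mu_levy k) * K_ k / (L k)%:R); last by ring.
  rewrite ler_pdivrMr ?ltr0n// mul1r (le_trans (ltW (archi_boundP a0)))// ler_nat.
  exact: leqW (leq_addr _ _).
have [n [n_ge n_fast]] := interpolant_fast_subsequence mu_even T0 mv0 v0M v0_fin phi_homo K0 phi_lip phi_le L_gt cfl.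
exists (solution mu_levy T M v0 phi_ L n).
split; [split=> [|psi psi_test]| |].
- move=> K cK Kcyl.
  have mc : measurable (cylinder N T : set ('rV[R]_N * measurableTypeR R)) by exact: measurable_cylinder.
  have mK : measurable (K : set ('rV[R]_N * measurableTypeR R)) by exact: compact_measurable_prod.
  exact: integrableS mc mK Kcyl (integrable_solution T0 mv0 v0M v0_fin phi_homo K0 phi_lip L_gt cfl n_fast).
- rewrite (solution_weak mu_even T0 mv0 v0M phi_homo K0 phi_lip phi_close phi_le L_gt cfl phi_cont n_ge n_fast psi_test).
  have [C [C0 [r [tpsi _]]]] := test_tame psi_test.
  have ipsi := integrable_boundedM mv0 v0M (tame_integrable (tpsi 0)).
  have mpsi := tame_measurable (tpsi 0).
  have mu0' : measurable_fun setT u0 by move: u01 => /andP[]; rewrite inE.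
  (* The initial datum and its bounded representative agree almost everywhere, so the initial term
     is the same finite number. *)
  rewrite (_ : (\int[lebesgue_rV N]_x (u0 x * psi (x, 0))%:E)%E = (\int[lebesgue_rV N]_x (v0 x * psi (x, 0)))%:E).
    by rewrite -EFinD addNr.
  rewrite /Rintegral fineK; last exact: integrable_fin_num ipsi.
  apply: ae_eq_integral => //.
  - by apply/measurable_EFinP; exact: measurable_funM.
  - by apply/measurable_EFinP; exact: measurable_funM.
  - by apply: filterS u0v0 => x -> _.
- split.
  + exact: (Lfun1_solution T0 mv0 v0M v0_fin phi_homo K0 phi_lip L_gt cfl n_fast).
  + exact: (Lfuny_solution T0 mv0 v0M phi_homo K0 phi_lip L_gt cfl).
  + exact: (solution_continuous mu_even T0 mv0 v0M v0_fin phi_homo K0 phi_lip phi_le L_gt cfl n_ge n_fast).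
- exact: (solution_energy mu0 T0 mv0 v0M v0_fin phi_homo K0 phi_lip phi_close phi_le L_gt cfl phi_cont n_ge n_fast).
Qed.
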